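(* Suppose that for some $\varepsilon>0$ $$\sup_{n\in\mathbb{Z}}\bigl\{\exp(\varepsilon|n|)\,(|1-a_n|+|p_n|+|q_n|)\bigr\}<\infty .$$ Then the operator $L_\lambda$ has a finite number of eigenvalues and spectral singularities, and each of them is of finite multiplicity.
   Context: Standing assumptions: $(a_n)$, $(p_n)$, $(q_n)$, $n\in\mathbb{Z}$, are complex sequences with $a_n\neq0$ for all $n$ (the standing condition $\sum_{n}|n|(|1-a_n|+|p_n|+|q_n|)<\infty$ is implied by the hypothesis). For $\lambda\in\mathbb{C}$, $L_\lambda$ is the operator in $\ell^2(\mathbb{Z})$ given by $(L_\lambda y)_n=\Delta(a_{n-1}\Delta y_{n-1})+(q_n+2\lambda p_n+\lambda^2)y_n$, with $\Delta y_n=y_{n+1}-y_n$. Jost solutions. For $\operatorname{Im}z\ge0$ and $\lambda=2\cos(z/2)$, the equation $L_\lambda y=0$ has the solutions $f_n^+(z)=\alpha_n^+e^{inz}(1+\sum_{m\ge1}K_{n,m}^+e^{imz/2})$ and $f_n^-(z)=\alpha_n^-e^{-inz}(1+\sum_{m\le-1}K_{n,m}^-e^{-imz/2})$, where, with $h_n=2-a_n-a_{n-1}+q_n$, $\alpha_n^+=(-1)^n(\prod_{r\ge n}a_r)^{-1}$, $K_{n,1}^+=2\sum_{r\ge n+1}p_r$, $K_{n,2}^+=\sum_{r\ge n+1}(h_r+2p_rK_{r,1}^+)$, $K_{n,3}^+=\sum_{r\ge n+1}(h_rK_{r,1}^++2p_r(K_{r,2}^++1))$, $K_{n,4}^+=\sum_{r\ge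 n+1}((1-a_r^2)+h_rK_{r,2}^++2p_r(K_{r,3}^++K_{r,1}^+))$, $K_{n,m+4}^+=K_{n+1,m}^++\sum_{r\ge n+1}((1-a_r^2)K_{r+1,m}^++h_rK_{r,m+2}^++2p_r(K_{r,m+1}^++K_{r,m+3}^+))$ for $m\ge1$; and $\alpha_n^-=(-1)^n(\prod_{r\le n-1}a_r)^{-1}$, $K_{n,-1}^-=2\sum_{r\le n-1}p_r$, $K_{n,-2}^-=\sum_{r\le n-1}(h_r+2p_rK_{r,-1}^-)$, $K_{n,-3}^-=\sum_{r\le n-1}(h_rK_{r,-1}^-+2p_r(K_{r,-2}^-+1))$, $K_{n,-4}^-=\sum_{r\le n-1}((1-a_{r-1}^2)+h_rK_{r,-2}^-+2p_r(K_{r,-3}^-+K_{r,-1}^-))$, $K_{n,m-4}^-=K_{n-1,m}^-+\sum_{r\le n-1}((1-a_{r-1}^2)K_{r-1,m}^-+h_rK_{r,m-2}^-+2p_r(K_{r,m-1}^-+K_{r,m-3}^-))$ for $m\le-1$. These are analytic in $z$ for $\operatorname{Im}z>0$ and continuous for $\operatorname{Im}z\ge0$. Put $\Phi(z)=W[f^-(z),f^+(z)]$ with $W[u,v]=a_n(u_nv_{n+1}-u_{n+1}v_n)$ (independent of $n$); $\Phi$ is $4\pi$-periodic. Let $P^+=\{\eta+i\varphi:\eta\in[-\pi,3\pi],\varphi>0\}$ and $P_0=(-\pi,3\pi)\setminus\{0,\pi,2\pi\}$. Eigenvalues are the $\lambda$ for which $L_\lambda y=0$ has a nonzero solution in $\ell^2(\mathbb{Z})$;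 they form the set $\{\lambda=2\cos\frac z2:z\in P^+,\Phi(z)=0\}$. The spectral singularities (poles of the resolvent kernel embedded in the continuous spectrum) form the set $\{\lambda=2\cos\frac z2:z\in P_0,\Phi(z)=0\}$. The multiplicity of an eigenvalue or spectral singularity is the multiplicity of the corresponding zero of $\Phi$ in $P^+\cup P_0$. *)

(* Defs.v *)
(* Stdlib reals, with Coquelicot's complex numbers, series and power series. *)
From Stdlib Require Import Reals ZArith List.
From Coquelicot Require Import Coquelicot.

Open Scope C_scope.

(** * Complex analysis *)

(* Limits are taken componentwise; as with [Lim_seq], the value is meaningful
   only when the sequence converges. *)
Definition Clim (u : nat -> C) : C :=
  (real (Lim_seq (fun n => Re (u n))), real (Lim_seq (fun n => Im (u n)))).

Definition Csum (u : nat -> C) : C := Clim (fun N => sum_n u N).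

Fixpoint Cprod_upto (u : nat -> C) (N : nat) : C :=
  match N with
  | O => u O
  | S N' => Cprod_upto u N' * u N
  end.

Definition Cprod (u : nat -> C) : C := Clim (Cprod_upto u).

Definition Cexp (z : C) : C :=
  (exp (Re z) * cos (Im z), exp (Re z) * sin (Im z))%R.

Definition Ccos (z : C) : C := (Cexp (Ci * z) + Cexp (- (Ci * z))) / 2.

Definition analytic_at (h : C -> C) (z0 : C) : Prop :=
  exists c : nat -> C,
    locally z0 (fun z : C =>
      @is_pseries C_AbsRing C_NormedModule c (z - z0) (h z)).

(* [z0] is a zero of multiplicity [m] of [F].  At an interior point of the
   closed upper half-plane this is the usual multiplicity.  At a real point it
   is the multiplicity for the analytic continuation of [F] across the real
   axis near [z0] (whose existence is part of the definition): only the values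
   of [F] on the closed upper half-plane are used. *)
Definition zero_multiplicity (F : C -> C) (z0 : C) (m : nat) : Prop :=
  exists h : C -> C,
    analytic_at h z0 /\ h z0 <> 0 /\
    locally z0 (fun z : C => (0 <= Im z)%R -> F z = (z - z0) ^ m * h z).

(* [z0], possibly on the real axis, is a pole of a function [F] given on the
   open upper half-plane near [z0]. *)
Definition upper_pole (F : C -> C) (z0 : C) : Prop :=
  exists (m : nat) (h : C -> C),
    (1 <= m)%nat /\ analytic_at h z0 /\ h z0 <> 0 /\
    locally z0 (fun z : C => (0 < Im z)%R -> F z = h z / (z - z0) ^ m).

Definition finite_Cset (P : C -> Prop) : Prop :=
  exists s : list C, forall l : C, P l -> In l s.

(** * Sequences indexed by the integers *)

Definition sum_ge (n : Z) (u : Z -> C) : C :=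
  Csum (fun k => u (n + Z.of_nat k)%Z).
Definition sum_le (n : Z) (u : Z -> C) : C :=
  Csum (fun k => u (n - Z.of_nat k)%Z).
Definition prod_ge (n : Z) (u : Z -> C) : C :=
  Cprod (fun k => u (n + Z.of_nat k)%Z).
Definition prod_le (n : Z) (u : Z -> C) : C :=
  Cprod (fun k => u (n - Z.of_nat k)%Z).

Definition ell2 (y : Z -> C) : Prop :=
  ex_series (fun k : nat => (Cmod (y (Z.of_nat k)) ^ 2)%R) /\
  ex_series (fun k : nat => (Cmod (y (- Z.of_nat k)%Z) ^ 2)%R).

Definition delta (k n : Z) : C := if Z.eqb n k then 1 else 0.

Definition fwd_diff (y : Z -> C) (n : Z) : C := y (n + 1)%Z - y n.

Definition sgnZ (n : Z) : C := if Z.even n then 1 else - (1).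

(** * The pencil and its Jost solutions *)

Section Pencil.

Variables a p q : Z -> C.

Definition Lop (l : C) (y : Z -> C) (n : Z) : C :=
  fwd_diff (fun j => a (j - 1)%Z * fwd_diff y (j - 1)%Z) n
  + (q n + 2 * l * p n + l ^ 2) * y n.

Definition hcoef (n : Z) : C := 2 - a n - a (n - 1)%Z + q n.

Definition alpha_plus (n : Z) : C := sgnZ n * / prod_ge n a.
Definition alpha_minus (n : Z) : C := sgnZ n * / prod_le (n - 1) a.

(* [Kplus m n] is K^+_{n,m} for m >= 1; the value 1 at m = 0 is not used. *)
Fixpoint Kplus (m : nat) : Z -> C :=
  match m with
  | O => fun _ => 1
  | S O => fun n => 2 * sum_ge (n + 1) p
  | S (S O as m1) => fun n =>
      sum_ge (n + 1) (fun r => hcoef r + 2 * p r * Kplus m1 r)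
  | S (S (S O as m1) as m2) => fun n =>
      sum_ge (n + 1) (fun r =>
        hcoef r * Kplus m1 r + 2 * p r * (Kplus m2 r + 1))
  | S (S (S (S O as m1) as m2) as m3) => fun n =>
      sum_ge (n + 1) (fun r =>
        (1 - a r ^ 2) + hcoef r * Kplus m2 r
        + 2 * p r * (Kplus m3 r + Kplus m1 r))
  | S (S (S (S m0 as m1) as m2) as m3) => fun n =>
      Kplus m0 (n + 1)%Z
      + sum_ge (n + 1) (fun r =>
          (1 - a r ^ 2) * Kplus m0 (r + 1)%Z + hcoef r * Kplus m2 r
          + 2 * p r * (Kplus m1 r + Kplus m3 r))
  end.

(* [Kminus m n] is K^-_{n,-m} for m >= 1; the value 1 at m = 0 is not used. *)
Fixpoint Kminus (m : nat) : Z -> C :=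
  match m with
  | O => fun _ => 1
  | S O => fun n => 2 * sum_le (n - 1) p
  | S (S O as m1) => fun n =>
      sum_le (n - 1) (fun r => hcoef r + 2 * p r * Kminus m1 r)
  | S (S (S O as m1) as m2) => fun n =>
      sum_le (n - 1) (fun r =>
        hcoef r * Kminus m1 r + 2 * p r * (Kminus m2 r + 1))
  | S (S (S (S O as m1) as m2) as m3) => fun n =>
      sum_le (n - 1) (fun r =>
        (1 - a (r - 1)%Z ^ 2) + hcoef r * Kminus m2 r
        + 2 * p r * (Kminus m3 r + Kminus m1 r))
  | S (S (S (S m0 as m1) as m2) as m3) => fun n =>
      Kminus m0 (n - 1)%Z
      + sum_le (n - 1) (fun r =>
          (1 - a (r - 1)%Z ^ 2) * Kminus m0 (r - 1)%Z + hcoef r * Kminus m2 r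
          + 2 * p r * (Kminus m1 r + Kminus m3 r))
  end.

Definition jost_plus (z : C) (n : Z) : C :=
  alpha_plus n * Cexp (Ci * IZR n * z)
  * (1 + Csum (fun k => Kplus (S k) n * Cexp (Ci * INR (S k) * z / 2))).

(* The index m <= -1 of the expansion is written m = - (k + 1). *)
Definition jost_minus (z : C) (n : Z) : C :=
  alpha_minus n * Cexp (- (Ci * IZR n * z))
  * (1 + Csum (fun k => Kminus (S k) n * Cexp (Ci * INR (S k) * z / 2))).

Definition wronskian (u v : Z -> C) (n : Z) : C :=
  a n * (u n * v (n + 1)%Z - u (n + 1)%Z * v n).

(* The Wronskian of two solutions does not depend on [n]. *)
Definition Phi (z : C) : C := wronskian (jost_minus z) (jost_plus z) 0.

(** * Spectral notions *)

Definition lam (z : C) : C := 2 * Ccos (z / 2).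

Definition P_plus (z : C) : Prop :=
  (- PI <= Re z <= 3 * PI)%R /\ (0 < Im z)%R.

Definition P_zero (z : C) : Prop :=
  (- PI < Re z < 3 * PI)%R /\ Im z = 0%R /\
  Re z <> 0%R /\ Re z <> PI /\ Re z <> (2 * PI)%R.

Definition eigenvalue (l : C) : Prop :=
  exists y : Z -> C,
    ell2 y /\ (exists n, y n <> 0) /\ (forall n, Lop l y n = 0).

(* As [L_l] is a bounded operator on l^2(Z) for bounded coefficients, the
   inverse of a bijective [L_l] is automatically bounded. *)
Definition resolvent_set (l : C) : Prop :=
  forall g : Z -> C, ell2 g ->
    exists y : Z -> C,
      ell2 y /\ (forall n, Lop l y n = g n) /\
      (forall y' : Z -> C, ell2 y' -> (forall n, Lop l y' n = g n) ->
         forall n, y' n = y n).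

(* The matrix of the inverse of [L_l]: its [k]-th column is the inverse image
   of the [k]-th unit vector. *)
Definition resolvent_kernel (l : C) (G : Z -> Z -> C) : Prop :=
  resolvent_set l /\
  forall k : Z,
    ell2 (fun n => G n k) /\
    forall n : Z, Lop l (fun j => G j k) n = delta k n.

(* A point of the continuous spectrum [-2, 2], taken as the boundary value at
   [z0] of [lam z] with [Im z > 0], at which the resolvent kernel, as a
   function of [z], has a pole. *)
Definition spectral_singularity (l : C) : Prop :=
  exists z0 : C, P_zero z0 /\ l = lam z0 /\
  exists G : C -> Z -> Z -> C,
    locally z0 (fun z : C => (0 < Im z)%R -> resolvent_kernel (lam z) (G z)) /\
    exists n k : Z, upper_pole (fun z => G z n k) z0.

Definition corresponding_zero (l z : C) : Prop :=
  (P_plus z \/ P_zero z) /\ l = lam z /\ Phi z = 0.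

(* A real [l] may correspond to two points of [P_zero], since [lam] is even;
   all corresponding zeros are required to have finite multiplicity. *)
Definition finite_multiplicity (l : C) : Prop :=
  (exists z : C, corresponding_zero l z) /\
  (forall z : C, corresponding_zero l z ->
     exists m : nat, zero_multiplicity Phi z m).

End Pencil.

(* Main.v *)
Require Import Defs.
From Stdlib Require Import Reals ZArith List.
From Stdlib Require Import Lra Lia Psatz FunctionalExtensionality Classical FinFun.
From Coquelicot Require Import Coquelicot.

(* With w = exp(i z / 2) the Jost solutions are power series in w, and
   the exponential decay of the coefficients makes K_{n,m} decay
   geometrically in m.  Hence w^2 Phi is a power series in w that
   converges on a disc larger than the unit disc and does not vanish at
   w = 0, so by Jensen's inequality it has finitely many zeros in the
   closed unit disc.  Green's identity shows that an l^2 solution of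
   L_lambda y = 0 makes y_n Phi vanish for all n, and that the entries of
   the resolvent kernel times Phi stay bounded near the real axis;
   eigenvalues and spectral singularities therefore come from zeros of
   Phi.  If a zero had infinite multiplicity, Phi would vanish along a
   vertical segment, again giving infinitely many zeros. *)

Local Open Scope R_scope.


(** The decay of K_{n,m} in m is the crux. The recursion gives K_{n,m+4} as K_{n+1,m}, with
    coefficient 1, plus tail sums, so the sums alone yield no decay in m. It comes from the decay in
    n: four steps in m move n by one and gain exp(-eps), hence the rate exp(-eps/4) per step. The
    tail sums cost a factor 1 + O(exp(-eps n)) each time, and a weight depending on n collects these
    factors.

    The power w^2 compensates f^-_1, which carries exp(-iz) = w^(-2). The constant term that remains
    is -a_0 alpha^-_1 alpha^+_0, a product of nonzero numbers, and this is what lets Jensen's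
    inequality be centred at w = 0. Real z lie on |w| = 1, so their zeros are counted only thanks to
    the larger disc of convergence.

    Multiplicity at a real z0 asks for a continuation below the axis, while the Jost solutions are
    controlled only for Im z >= 0. The series in w is therefore re-expanded in powers of z - z0, as
    a sum of exponentials. Everything at minus infinity follows from plus infinity by reflecting the
    index. *)

Notation is_Cseries := (@is_series C_AbsRing C_NormedModule).

Definition summable (u : nat -> C) : Prop := ex_series (fun k => Cmod (u k)).

Lemma Re_sum_n (u : nat -> C) n : Re (sum_n u n) = sum_n (fun k => Re (u k)) n.
Proof.
  induction n as [|n IH]; [now rewrite !sum_O|].
  now rewrite !sum_Sn, <- IH.
Qed.

Lemma Im_sum_n (u : nat -> C) n : Im (sum_n u n) = sum_n (fun k => Im (u k)) n.
Proof.
  induction n as [|n IH]; [now rewrite !sum_O|].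
  now rewrite !sum_Sn, <- IH.
Qed.

Lemma im_le_Cmod (c : C) : Rabs (Im c) <= Cmod c.
Proof. exact (Rle_trans _ _ _ (Rmax_r _ _) (Rmax_Cmod c)). Qed.

Lemma Cmod_minus_sym (x y : C) : Cmod (x - y) = Cmod (y - x).
Proof. rewrite <- Cmod_opp. f_equal. ring. Qed.

Lemma Cmod_triangle_minus (x y : C) : Cmod (x - y) <= Cmod x + Cmod y.
Proof. rewrite <- (Cmod_opp y). apply Cmod_triangle. Qed.

Lemma Cmod_triangle_inv (x y : C) : Cmod x - Cmod y <= Cmod (x - y).
Proof.
  assert (H := Cmod_triangle (x - y) y).
  replace (x - y + y)%C with x in H by ring. lra.
Qed.

(** * Complex sequences and series *)

(** Stated through moduli, so that comparison and squeeze arguments for real sequences apply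
    directly; [Clim_unique] links it to the componentwise [Clim]. *)
Definition Cseq_lim (u : nat -> C) (l : C) : Prop :=
  is_lim_seq (fun n => Cmod (u n - l)) 0.

Lemma Cseq_lim_Re u l : Cseq_lim u l -> is_lim_seq (fun n => Re (u n)) (Re l).
Proof.
  intros H.
  apply is_lim_seq_ext with (fun n => Re (u n - l)%C + Re l).
  { intros n. destruct (u n), l; simpl; ring. }
  replace (Finite (Re l)) with (Finite (0 + Re l)) by (f_equal; ring).
  apply (is_lim_seq_plus' _ _ 0 (Re l)); [|apply is_lim_seq_const].
  apply is_lim_seq_abs_0.
  apply is_lim_seq_le_le with (fun _ => 0) (fun n => Cmod (u n - l)); trivial.
  - intros n. split; [apply Rabs_pos | apply re_le_Cmod].
  - apply is_lim_seq_const.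
Qed.

Lemma Cseq_lim_Im u l : Cseq_lim u l -> is_lim_seq (fun n => Im (u n)) (Im l).
Proof.
  intros H.
  apply is_lim_seq_ext with (fun n => Im (u n - l)%C + Im l).
  { intros n. destruct (u n), l; simpl; ring. }
  replace (Finite (Im l)) with (Finite (0 + Im l)) by (f_equal; ring).
  apply (is_lim_seq_plus' _ _ 0 (Im l)); [|apply is_lim_seq_const].
  apply is_lim_seq_abs_0.
  apply is_lim_seq_le_le with (fun _ => 0) (fun n => Cmod (u n - l)); trivial.
  - intros n. split; [apply Rabs_pos | apply im_le_Cmod].
  - apply is_lim_seq_const.
Qed.

Lemma Clim_unique u l : Cseq_lim u l -> Clim u = l.
Proof.
  intros H. unfold Clim.
  rewrite (is_lim_seq_unique _ _ (Cseq_lim_Re _ _ H)).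
  rewrite (is_lim_seq_unique _ _ (Cseq_lim_Im _ _ H)).
  now destruct l.
Qed.

Lemma is_Cseries_lim u l : is_Cseries u l <-> Cseq_lim (sum_n u) l.
Proof.
  split.
  - intros H. apply (is_lim_seq_spec _ 0). intros eps.
    destruct (proj1 (filterlim_locally_ball_norm _ _) H eps) as [N HN].
    exists N. intros n Hn. specialize (HN n Hn).
    rewrite Rminus_0_r, Rabs_right by (apply Rle_ge, Cmod_ge_0).
    exact HN.
  - intros H. apply (proj2 (filterlim_locally_ball_norm _ _)). intros eps.
    destruct (proj2 (is_lim_seq_spec _ 0) H eps) as [N HN].
    exists N. intros n Hn. specialize (HN n Hn).
    rewrite Rminus_0_r, Rabs_right in HN by (apply Rle_ge, Cmod_ge_0).
    exact HN.
Qed.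

Lemma Csum_unique u l : is_Cseries u l -> Csum u = l.
Proof. intros H. apply Clim_unique, is_Cseries_lim, H. Qed.

Lemma Csum_correct u : summable u -> is_Cseries u (Csum u).
Proof.
  intros H.
  destruct (@ex_series_le C_AbsRing C_CompleteNormedModule u (fun k => Cmod (u k)))
    as [l Hl]; trivial.
  - intros n. apply Rle_refl.
  - now rewrite (Csum_unique u l Hl).
Qed.

Lemma summable_le u b :
  (forall k, Cmod (u k) <= b k) -> ex_series b -> summable u.
Proof.
  intros H Hb. apply (@ex_series_le R_AbsRing R_CompleteNormedModule _ b); trivial.
  intros n. unfold norm; simpl. unfold abs; simpl.
  rewrite Rabs_right; trivial. apply Rle_ge, Cmod_ge_0.
Qed.

Lemma summable_ext u v : (forall k, u k = v k) -> summable u -> summable v.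
Proof. intros H. apply ex_series_ext. intros k. now rewrite H. Qed.

Lemma Csum_ext u v : (forall k, u k = v k) -> Csum u = Csum v.
Proof.
  intros H. f_equal. apply functional_extensionality, H.
Qed.

Lemma summable_plus u v :
  summable u -> summable v -> summable (fun k => u k + v k)%C.
Proof.
  intros Hu Hv. apply summable_le with (fun k => Cmod (u k) + Cmod (v k)).
  - intros k. apply Cmod_triangle.
  - apply (ex_series_plus _ _ Hu Hv).
Qed.

Lemma Csum_plus u v : summable u -> summable v ->
  Csum (fun k => u k + v k)%C = (Csum u + Csum v)%C.
Proof.
  intros Hu Hv. apply Csum_unique.
  exact (is_series_plus _ _ _ _ (Csum_correct _ Hu) (Csum_correct _ Hv)).
Qed.

Lemma summable_scal c u : summable u -> summable (fun k => c * u k)%C.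
Proof.
  intros Hu. apply ex_series_ext with (fun k => scal (Cmod c) (Cmod (u k))).
  - intros k. now rewrite Cmod_mult.
  - apply (ex_series_scal_l _ _ Hu).
Qed.

Lemma Csum_scal c u : summable u -> Csum (fun k => c * u k)%C = (c * Csum u)%C.
Proof.
  intros Hu. apply Csum_unique.
  exact (is_series_scal_l c _ _ (Csum_correct _ Hu)).
Qed.

Lemma summable_S u : summable u <-> summable (fun k => u (S k)).
Proof. apply (ex_series_incr_1 (fun k => Cmod (u k))). Qed.

Lemma Csum_S u : summable u -> Csum u = (u O + Csum (fun k => u (S k)))%C.
Proof.
  intros Hu. apply Csum_unique, is_series_decr_1.
  replace (plus _ _) with (Csum (fun k => u (S k))).
  - apply Csum_correct. now apply -> summable_S.
  - change (Csum (fun k => u (S k)) = (u O + Csum (fun k => u (S k))) + - u O)%C.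
    ring.
Qed.

Lemma Csum_le u b : (forall k, Cmod (u k) <= b k) -> ex_series b ->
  Cmod (Csum u) <= Series b.
Proof.
  intros H Hb.
  assert (Hu := summable_le _ _ H Hb).
  assert (L := proj1 (is_Cseries_lim _ _) (Csum_correct _ Hu)).
  assert (P : forall N, Cmod (sum_n u N) <= sum_n b N).
  { induction N as [|N IH]; [rewrite !sum_O; apply H|].
    rewrite !sum_Sn. apply Rle_trans with (1 := Cmod_triangle _ _).
    apply Rplus_le_compat; [exact IH | apply H]. }
  assert (L2 : is_lim_seq (fun N => sum_n b N + Cmod (sum_n u N - Csum u)) (Series b + 0)).
  { apply is_lim_seq_plus'; [|exact L]. exact (Series_correct b Hb). }
  rewrite Rplus_0_r in L2.
  refine (is_lim_seq_le (fun _ => Cmod (Csum u)) _ (Cmod (Csum u)) (Series b) _ _ L2).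
  - intros N. specialize (P N).
    assert (T := Cmod_triangle (sum_n u N) (Csum u - sum_n u N)).
    replace (sum_n u N + (Csum u - sum_n u N))%C with (Csum u) in T by ring.
    rewrite Cmod_minus_sym in T. lra.
  - apply is_lim_seq_const.
Qed.

Lemma ex_series_geom_scal M r : 0 <= r < 1 -> ex_series (fun k => M * r ^ k).
Proof.
  intros Hr. apply (ex_series_scal_l M (fun k => r ^ k)).
  apply ex_series_geom. rewrite Rabs_right; lra.
Qed.

Lemma Series_geom_scal M r : 0 <= r < 1 -> Series (fun k => M * r ^ k) = M / (1 - r).
Proof.
  intros Hr. rewrite Series_scal_l, Series_geom; [reflexivity|].
  rewrite Rabs_right; lra.
Qed.

Lemma summable_geom u M r : 0 <= r < 1 ->
  (forall k, Cmod (u k) <= M * r ^ k) -> summable u.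
Proof.
  intros Hr H. exact (summable_le _ _ H (ex_series_geom_scal M r Hr)).
Qed.

Lemma Csum_geom u M r : 0 <= r < 1 ->
  (forall k, Cmod (u k) <= M * r ^ k) -> Cmod (Csum u) <= M / (1 - r).
Proof.
  intros Hr H. rewrite <- Series_geom_scal by assumption.
  apply Csum_le; [exact H | apply ex_series_geom_scal, Hr].
Qed.

Lemma is_series_lim_seq (b : nat -> R) (l : R) :
  is_series b l -> is_lim_seq (sum_n b) l.
Proof. exact (fun H => H). Qed.

Definition Cconv (u v : nat -> C) (n : nat) : C :=
  sum_n (fun k => u k * v (n - k)%nat)%C n.

(** Cauchy product of absolutely convergent series, reduced to the four real products of real and
    imaginary parts, which converge absolutely because they are dominated by the moduli. *)
Lemma Csum_Cconv u v : summable u -> summable v ->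
  Csum (Cconv u v) = (Csum u * Csum v)%C.
Proof.
  intros Hu Hv.
  assert (Lu := proj1 (is_Cseries_lim _ _) (Csum_correct _ Hu)).
  assert (Lv := proj1 (is_Cseries_lim _ _) (Csum_correct _ Hv)).
  assert (Rs : forall w, summable w -> ex_series (fun n => Rabs (Re (w n)))
    /\ ex_series (fun n => Rabs (Im (w n)))).
  { intros w Hw. split; refine (@ex_series_le R_AbsRing R_CompleteNormedModule _ _ _ Hw);
      intros n; unfold norm; simpl; unfold abs; simpl; rewrite Rabs_Rabsolu;
      [apply re_le_Cmod | apply im_le_Cmod]. }
  assert (Res : forall w l, Cseq_lim (sum_n w) l -> is_series (fun n => Re (w n)) (Re l)).
  { intros w l H. apply Cseq_lim_Re in H. unfold is_series.
    refine (is_lim_seq_ext _ _ _ _ H). intros n. apply Re_sum_n. }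
  assert (Ims : forall w l, Cseq_lim (sum_n w) l -> is_series (fun n => Im (w n)) (Im l)).
  { intros w l H. apply Cseq_lim_Im in H. unfold is_series.
    refine (is_lim_seq_ext _ _ _ _ H). intros n. apply Im_sum_n. }
  destruct (Rs u Hu) as [Au Bu], (Rs v Hv) as [Av Bv].
  assert (RR := is_series_mult _ _ _ _ (Res _ _ Lu) (Res _ _ Lv) Au Av).
  assert (II := is_series_mult _ _ _ _ (Ims _ _ Lu) (Ims _ _ Lv) Bu Bv).
  assert (RI := is_series_mult _ _ _ _ (Res _ _ Lu) (Ims _ _ Lv) Au Bv).
  assert (IR := is_series_mult _ _ _ _ (Ims _ _ Lu) (Res _ _ Lv) Bu Av).
  assert (Hre := is_series_lim_seq _ _ (is_series_minus _ _ _ _ RR II)).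
  assert (Him := is_series_lim_seq _ _ (is_series_plus _ _ _ _ RI IR)).
  assert (Ere : Lim_seq (fun N => Re (sum_n (Cconv u v) N))
     = Re (Csum u) * Re (Csum v) - Im (Csum u) * Im (Csum v)).
  { apply is_lim_seq_unique. refine (is_lim_seq_ext _ _ _ _ Hre). intros N.
    rewrite Re_sum_n. apply sum_n_ext. intros n. unfold Cconv. rewrite Re_sum_n.
    rewrite <- !sum_n_Reals.
    change (sum_n (fun k => Re (u k) * Re (v (n - k)%nat)) n
       + - sum_n (fun k => Im (u k) * Im (v (n - k)%nat)) n
       = sum_n (fun k => Re (u k * v (n - k)%nat)%C) n).
    (* The upper limit is freed from the n inside v (n - k), so that induction on it is possible. *)
    assert (G : forall m,
      sum_n (fun k => Re (u k) * Re (v (n - k)%nat)) m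
       + - sum_n (fun k => Im (u k) * Im (v (n - k)%nat)) m
       = sum_n (fun k => Re (u k * v (n - k)%nat)%C) m).
    { induction m as [|m IH]; [rewrite !sum_O; unfold Cmult, Re, Im; simpl; ring|].
      rewrite !sum_Sn, <- IH. unfold plus, Cmult, Re, Im; simpl; ring. }
    apply G. }
  assert (Eim : Lim_seq (fun N => Im (sum_n (Cconv u v) N))
     = Re (Csum u) * Im (Csum v) + Im (Csum u) * Re (Csum v)).
  { apply is_lim_seq_unique. refine (is_lim_seq_ext _ _ _ _ Him). intros N.
    rewrite Im_sum_n. apply sum_n_ext. intros n. unfold Cconv. rewrite Im_sum_n.
    rewrite <- !sum_n_Reals.
    change (sum_n (fun k => Re (u k) * Im (v (n - k)%nat)) n
       + sum_n (fun k => Im (u k) * Re (v (n - k)%nat)) n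
       = sum_n (fun k => Im (u k * v (n - k)%nat)%C) n).
    assert (G : forall m,
      sum_n (fun k => Re (u k) * Im (v (n - k)%nat)) m
       + sum_n (fun k => Im (u k) * Re (v (n - k)%nat)) m
       = sum_n (fun k => Im (u k * v (n - k)%nat)%C) m).
    { induction m as [|m IH]; [rewrite !sum_O; unfold Cmult, Re, Im; simpl; ring|].
      rewrite !sum_Sn, <- IH. unfold plus, Cmult, Re, Im; simpl; ring. }
    apply G. }
  unfold Csum at 1, Clim. rewrite Ere, Eim.
  unfold Cmult, Re, Im. simpl. reflexivity.
Qed.


(** * Zeros of power series *)

Definition pseval (c : nat -> C) (w : C) : C := Csum (fun k => c k * w ^ k)%C.

Lemma pseval_summable c M r w : 0 <= r -> (forall k, Cmod (c k) <= M * r ^ k) ->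
  Cmod w * r < 1 -> summable (fun k => c k * w ^ k)%C.
Proof.
  intros Hr Hc Hw. assert (Hp := Cmod_ge_0 w).
  apply summable_geom with M (Cmod w * r); [nra|].
  intros k. rewrite Cmod_mult, Cmod_pow, Rpow_mult_distr.
  assert (0 <= Cmod w ^ k) by now apply pow_le.
  specialize (Hc k). nra.
Qed.

(** Coefficients of the product of h with the linear polynomial x w + y. *)
Definition lin_mul (x y : C) (h : nat -> C) (n : nat) : C :=
  match n with
  | O => y * h O
  | S m => x * h m + y * h (S m)
  end.

Lemma pseval_lin_mul x y h w : summable (fun k => h k * w ^ k)%C ->
  pseval (lin_mul x y h) w = ((x * w + y) * pseval h w)%C.
Proof.
  intros Hh. unfold pseval.
  assert (Hh' := proj1 (summable_S _) Hh).
  rewrite Csum_S.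
  - rewrite (Csum_ext _ (fun k => (x * w) * (h k * w ^ k)
      + y * (h (S k) * w ^ S k))%C).
    + rewrite (Csum_plus _ _ (summable_scal (x * w) _ Hh) (summable_scal y _ Hh')),
        (Csum_scal _ _ Hh), (Csum_scal _ _ Hh'), (Csum_S _ Hh). simpl. ring.
    + intros k. simpl. ring.
  - apply summable_S.
    apply summable_ext with (fun k => (x * w) * (h k * w ^ k)
      + y * (h (S k) * w ^ S k))%C.
    + intros k. simpl. ring.
    + apply summable_plus; now apply summable_scal.
Qed.

(** Coefficients of g(w) / (w - a) when g(a) = 0, by synthetic division from the tail. No division
    by a occurs, so a = 0 is allowed, and geometric decay makes the sum converge for all |a| <=
    1. *)
Definition div_root (g : nat -> C) (a : C) (n : nat) : C :=
  Csum (fun j => g (S n + j)%nat * a ^ j)%C.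

Lemma div_root_tail_bound g M r a n : 0 <= r < 1 -> Cmod a <= 1 ->
  (forall k, Cmod (g k) <= M * r ^ k) ->
  forall j, Cmod (g (n + j)%nat * a ^ j) <= M * r ^ n * r ^ j.
Proof.
  intros Hr Ha Hg j. rewrite Cmod_mult, Cmod_pow, Rmult_assoc, <- pow_add.
  assert (0 <= Cmod a ^ j <= 1).
  { split; [apply pow_le, Cmod_ge_0|].
    rewrite <- (pow1 j). apply pow_incr. split; [apply Cmod_ge_0 | exact Ha]. }
  assert (H0 := Cmod_ge_0 (g (n + j)%nat)). specialize (Hg (n + j)%nat). nra.
Qed.

Lemma div_root_bound g M r a n : 0 <= r < 1 -> Cmod a <= 1 ->
  (forall k, Cmod (g k) <= M * r ^ k) ->
  Cmod (div_root g a n) <= M * r / (1 - r) * r ^ n.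
Proof.
  intros Hr Ha Hg.
  replace (M * r / (1 - r) * r ^ n) with (M * r ^ S n / (1 - r))
    by (simpl; field; lra).
  apply Csum_geom; [exact Hr|]. now apply div_root_tail_bound.
Qed.

Lemma div_root_S g M r a n : 0 <= r < 1 -> Cmod a <= 1 ->
  (forall k, Cmod (g k) <= M * r ^ k) ->
  Csum (fun j => g (n + j)%nat * a ^ j)%C = (g n + a * div_root g a n)%C.
Proof.
  intros Hr Ha Hg.
  rewrite Csum_S.
  - rewrite Nat.add_0_r. simpl. rewrite Cmult_1_r. f_equal.
    unfold div_root. rewrite <- Csum_scal.
    + apply Csum_ext. intros k. rewrite <- plus_n_Sm. simpl. ring.
    + apply summable_geom with (M * r ^ S n) r; [exact Hr|].
      now apply div_root_tail_bound.
  - apply summable_geom with (M * r ^ n) r; [exact Hr|].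
    now apply div_root_tail_bound.
Qed.

Lemma div_root_spec g M r a : 0 <= r < 1 -> Cmod a <= 1 ->
  (forall k, Cmod (g k) <= M * r ^ k) -> pseval g a = 0 ->
  g = lin_mul 1 (- a) (div_root g a).
Proof.
  intros Hr Ha Hg H0. apply functional_extensionality. intros [|n]; simpl.
  - assert (E := div_root_S g M r a 0 Hr Ha Hg).
    change (pseval g a = g O + a * div_root g a O)%C in E. rewrite H0 in E.
    replace (g O) with ((g O + a * div_root g a O) - a * div_root g a O)%C by ring.
    rewrite <- E. ring.
  - assert (E := div_root_S g M r a (S n) Hr Ha Hg).
    change (div_root g a n = g (S n) + a * div_root g a (S n))%C in E.
    rewrite E. ring.
Qed.

(* [w - a] and [1 - conj a w] have the same modulus on the unit circle, so
   multiplying by either one gives the same l^2 norm. *)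
Lemma lin_mul_conj_norm h a N :
  sum_n (fun n => Cmod (lin_mul 1 (- a) h n) ^ 2) N
  = sum_n (fun n => Cmod (lin_mul (- Cconj a) 1 h n) ^ 2) N
    - (1 - Cmod a ^ 2) * Cmod (h N) ^ 2.
Proof.
  induction N as [|N IH].
  - rewrite !sum_O. simpl lin_mul.
    rewrite !Cmod2_alt. unfold Cmult, Copp, Re, Im. simpl. ring.
  - rewrite !sum_Sn, IH. unfold plus; simpl plus. simpl lin_mul.
    rewrite !Cmod2_alt. unfold Cmult, Cplus, Copp, Cconj, Re, Im. simpl. ring.
Qed.

Lemma sum_n_pos_incr (b : nat -> R) N M : (forall k, 0 <= b k) -> (N <= M)%nat ->
  sum_n b N <= sum_n b M.
Proof.
  intros Hb H. induction H as [|M H IH]; [lra|].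
  rewrite sum_Sn. specialize (Hb (S M)). unfold plus; simpl. lra.
Qed.

(** One zero a is removed at a time: with g = (w - a) h, pass to g' = (1 - conj a w) h. The l^2 norm
    is kept, the other zeros survive because they differ from a, and the constant terms satisfy
    |g_0| = |a| |g'_0|, which yields one factor r^2 per zero after squaring. *)
Lemma jensen_sq r (l : list C) : 0 <= r < 1 -> NoDup l ->
  forall g M rho B, 0 <= rho < 1 -> (forall k, Cmod (g k) <= M * rho ^ k) ->
  (forall N, sum_n (fun k => Cmod (g k) ^ 2) N <= B) ->
  (forall a, In a l -> Cmod a <= r /\ pseval g a = 0) ->
  Cmod (g O) ^ 2 <= (r ^ 2) ^ length l * B.
Proof.
  intros Hr. induction l as [|a l IH]; intros Hl g M rho B Hrho Hg HB Hz.
  - specialize (HB O). rewrite sum_O in HB. simpl. simpl in HB. lra.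
  - inversion Hl as [|? ? Hal Hl']; subst.
    destruct (Hz a (or_introl eq_refl)) as [Ha Hga].
    assert (Ha1 : Cmod a <= 1) by lra.
    set (h := div_root g a).
    assert (Eg : g = lin_mul 1 (- a) h) by now apply div_root_spec with M rho.
    assert (Hh : forall n, Cmod (h n) <= M * rho / (1 - rho) * rho ^ n)
      by (intros n; now apply div_root_bound).
    set (M' := M * rho / (1 - rho)) in *.
    set (g' := lin_mul (- Cconj a) 1 h).
    assert (Sh : forall b, Cmod b <= 1 -> summable (fun k => h k * b ^ k)%C).
    { intros b Hb. apply pseval_summable with M' rho; [lra | exact Hh | nra]. }
    assert (HM' : 0 <= M').
    { specialize (Hh O). simpl in Hh. assert (T := Cmod_ge_0 (h O)). lra. }
    (* The shift in [lin_mul] costs a factor 1 / rho, so rho = 0 is treated apart; there h vanishes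
       identically. *)
    assert (Hdec : exists M'', forall k, Cmod (g' k) <= M'' * rho ^ k).
    { destruct (Req_dec rho 0) as [->|Hrho0].
      - exists M'. intros [|k].
        + unfold g'. simpl lin_mul. rewrite Cmult_1_l. apply Hh.
        + assert (Z : forall n, h n = 0).
          { intros n. apply Cmod_eq_0. specialize (Hh n).
            assert (T := Cmod_ge_0 (h n)). unfold M' in Hh.
            replace (M * 0 / (1 - 0)) with 0 in Hh by field. lra. }
          unfold g'. simpl lin_mul. rewrite !Z, !Cmult_0_r, Cplus_0_l, Cmod_0.
          simpl. lra.
      - exists (M' + M' / rho). intros [|k].
        + unfold g'. simpl lin_mul. rewrite Cmult_1_l.
          apply Rle_trans with (1 := Hh O). simpl.
          assert (0 <= M' / rho) by (apply Rdiv_le_0_compat; lra). lra.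
        + unfold g'. simpl lin_mul. apply Rle_trans with (1 := Cmod_triangle _ _).
          rewrite Cmult_1_l, Cmod_mult, Cmod_opp, Cmod_conj.
          replace ((M' + M' / rho) * rho ^ S k) with (M' * rho ^ k + M' * rho ^ S k)
            by (simpl; field; lra).
          assert (H1 := Hh k). assert (H2 := Hh (S k)).
          assert (T := Cmod_ge_0 (h k)). assert (T2 := Cmod_ge_0 a). nra. }
    destruct Hdec as [M'' Hg'].
    assert (HB' : forall N, sum_n (fun k => Cmod (g' k) ^ 2) N <= B).
    { intros N.
      (* Partial norms of g and g' differ by a boundary term of size |h_{n+N}|^2. Enlarging the
         partial sum of g' to n + N and letting n grow removes it, so the same B works for g'. *)
      assert (L : is_lim_seq (fun n => B + M' ^ 2 * (rho ^ 2) ^ (n + N)) (B + M' ^ 2 * 0)).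
      { apply is_lim_seq_plus'; [apply is_lim_seq_const|].
        apply (is_lim_seq_scal_l _ (M' ^ 2) 0).
        apply is_lim_seq_incr_n. apply is_lim_seq_geom.
        rewrite Rabs_right; nra. }
      rewrite Rmult_0_r, Rplus_0_r in L.
      refine (is_lim_seq_le (fun _ => sum_n (fun k => Cmod (g' k) ^ 2) N) _
        (sum_n (fun k => Cmod (g' k) ^ 2) N) B _ (is_lim_seq_const _) L).
      intros n.
      apply Rle_trans with (sum_n (fun k => Cmod (g' k) ^ 2) (n + N)).
      { apply sum_n_pos_incr; [intros k; apply pow2_ge_0 | lia]. }
      assert (E := lin_mul_conj_norm h a (n + N)). rewrite <- Eg in E.
      fold g' in E. specialize (HB (n + N)%nat).
      assert (Q : Cmod (h (n + N)%nat) ^ 2 <= M' ^ 2 * (rho ^ 2) ^ (n + N)).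
      { rewrite <- pow_mult, (Nat.mul_comm 2), pow_mult, <- Rpow_mult_distr.
        apply pow_incr. split; [apply Cmod_ge_0 | apply Hh]. }
      assert (T := Cmod_ge_0 a). assert (0 <= Cmod a ^ 2 <= 1) by nra.
      assert (T2 := pow2_ge_0 (Cmod (h (n + N)%nat))). nra. }
    assert (Hz' : forall b, In b l -> Cmod b <= r /\ pseval g' b = 0).
    { intros b Hb. destruct (Hz b (or_intror Hb)) as [Hbr Hgb].
      split; [exact Hbr|].
      rewrite Eg, pseval_lin_mul in Hgb by (apply Sh; lra).
      unfold g'. rewrite pseval_lin_mul by (apply Sh; lra).
      destruct (Ceq_dec (pseval h b) 0) as [Z|NZ].
      - rewrite Z. ring.
      - exfalso. apply Hal. replace a with b; [exact Hb|].
        assert (E : (1 * b + - a = 0)%C).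
        { destruct (Ceq_dec (1 * b + - a)%C 0) as [Z|NZ']; [exact Z|].
          exfalso. exact (Cmult_neq_0 _ _ NZ' NZ Hgb). }
        replace b with ((1 * b + - a) + a)%C by ring. rewrite E. ring. }
    specialize (IH Hl' g' M'' rho B Hrho Hg' HB' Hz').
    rewrite Eg. simpl lin_mul. rewrite Cmod_mult, Cmod_opp.
    unfold g' in IH. simpl lin_mul in IH. rewrite Cmult_1_l in IH.
    change ((r ^ 2) ^ length (a :: l)) with (r ^ 2 * (r ^ 2) ^ length l).
    rewrite Rpow_mult_distr, Rmult_assoc.
    apply Rmult_le_compat; try apply pow2_ge_0; [|exact IH].
    apply pow_incr. split; [apply Cmod_ge_0 | exact Ha].
Qed.

(** Jensen's inequality gives nothing for zeros of modulus 1, so the variable is rescaled: g(s w) =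
    c(w) puts all zeros into radius s < 1, and g still converges beyond the unit disc because rho <
    s. Then |c_0|^2 <= s^(2 length) B bounds the length. *)
Lemma zeros_bounded c M rho : 0 <= rho < 1 ->
  (forall k, Cmod (c k) <= M * rho ^ k) -> c O <> 0 ->
  exists N, forall l, NoDup l ->
    (forall a, In a l -> Cmod a <= 1 /\ pseval c a = 0) -> (length l <= N)%nat.
Proof.
  intros Hrho Hc Hc0.
  set (s := (1 + rho) / 2).
  assert (Hs : 0 < s < 1) by (unfold s; lra).
  set (rho' := rho / s).
  assert (Hrho' : 0 <= rho' < 1).
  { unfold rho'. split; [apply Rdiv_le_0_compat; lra|].
    apply Rlt_div_l; unfold s; lra. }
  set (g := fun k => (c k * / (RtoC s) ^ k)%C).
  assert (Hs0 : RtoC s <> 0) by (intros E; apply RtoC_inj in E; lra).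
  assert (Hg : forall k, Cmod (g k) <= M * rho' ^ k).
  { intros k. unfold g. rewrite Cmod_mult, Cmod_inv, Cmod_pow, Cmod_R by (now apply Cpow_nz).
    rewrite Rabs_right by lra. unfold rho', Rdiv.
    rewrite Rpow_mult_distr, pow_inv, <- Rmult_assoc.
    apply Rmult_le_compat_r; [|apply Hc].
    left. apply Rinv_0_lt_compat, pow_lt; lra. }
  set (B := M ^ 2 / (1 - rho' ^ 2)).
  assert (HB : forall N, sum_n (fun k => Cmod (g k) ^ 2) N <= B).
  { intros N.
    assert (Hq : 0 <= rho' ^ 2 < 1) by nra.
    unfold B. rewrite <- Series_geom_scal by exact Hq.
    assert (Hle : forall k, Cmod (g k) ^ 2 <= M ^ 2 * (rho' ^ 2) ^ k).
    { intros k. rewrite <- pow_mult, (Nat.mul_comm 2), pow_mult, <- Rpow_mult_distr.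
      apply pow_incr. split; [apply Cmod_ge_0 | apply Hg]. }
    apply Rle_trans with (sum_n (fun k => M ^ 2 * (rho' ^ 2) ^ k) N).
    - now apply sum_n_m_le.
    - refine (is_lim_seq_incr_compare _ _
        (Series_correct _ (ex_series_geom_scal (M ^ 2) (rho' ^ 2) Hq)) _ N).
      intros n. rewrite sum_Sn. unfold plus; simpl plus.
      specialize (Hle (S n)). assert (T := pow2_ge_0 (Cmod (g (S n)))). simpl; simpl in *. lra. }
  assert (HB0 : 0 <= B).
  { specialize (HB O). rewrite sum_O in HB. assert (T := pow2_ge_0 (Cmod (g O))). lra. }
  assert (Hpos : 0 < Cmod (c O) ^ 2) by (apply pow_lt, Cmod_gt_0, Hc0).
  (* Beyond this N the Jensen bound would fall below |c_0|^2; B + 1 keeps the denominator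
     positive. *)
  destruct (pow_lt_1_zero (s ^ 2)) with (y := Cmod (c O) ^ 2 / (B + 1)) as [N HN].
  { rewrite Rabs_right; nra. }
  { apply Rdiv_lt_0_compat; lra. }
  exists N. intros l Hl Hz.
  destruct (Nat.le_gt_cases (length l) N) as [H|H]; [exact H|exfalso].
  assert (Hl' : NoDup (map (fun a => (s * a)%C) l)).
  { apply Injective_map_NoDup; [|exact Hl].
    intros x y E. replace x with (/ s * (s * x))%C by (field; exact Hs0).
    rewrite E. field; exact Hs0. }
  assert (J := jensen_sq s _ (conj (Rlt_le _ _ (proj1 Hs)) (proj2 Hs)) Hl' g M rho' B Hrho' Hg HB).
  rewrite length_map in J.
  assert (G0 : g O = c O) by (unfold g; simpl; field; intros E; apply RtoC_inj in E; lra).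
  rewrite G0 in J.
  specialize (HN (length l) (Nat.lt_le_incl _ _ H)).
  rewrite Rabs_right in HN by (apply Rle_ge, pow_le, pow2_ge_0).
  apply Rlt_div_r in HN; [|lra].
  assert (T : 0 <= (s ^ 2) ^ length l) by apply pow_le, pow2_ge_0.
  assert (J' : Cmod (c O) ^ 2 <= (s ^ 2) ^ length l * B).
  { apply J. intros b Hb. apply in_map_iff in Hb. destruct Hb as [a [<- Ha]].
    destruct (Hz a Ha) as [Ha1 Ha2]. split.
    - rewrite Cmod_mult, Cmod_R, Rabs_right by lra. nra.
    - rewrite <- Ha2. unfold pseval. apply Csum_ext. intros k. unfold g.
      rewrite Cpow_mult_l. field. now apply Cpow_nz. }
  nra.
Qed.

(** If no list exhausts P, any list of distinct elements of P can be prolonged, so lists of every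
    length exist. *)
Lemma finite_Cset_of_bound (P : C -> Prop) N :
  (forall l, NoDup l -> (forall x, In x l -> P x) -> (length l <= N)%nat) ->
  finite_Cset P.
Proof.
  intros H. apply NNPP. intros Hn.
  assert (G : forall k, exists l, NoDup l /\ (forall x, In x l -> P x) /\ length l = k).
  { induction k as [|k [l [H1 [H2 H3]]]].
    - exists nil. repeat split; [constructor | contradiction].
    - assert (E : exists x, P x /\ ~ In x l).
      { apply NNPP. intros E. apply Hn. exists l. intros x Hx. apply NNPP.
        intros Hxl. apply E. now exists x. }
      destruct E as [x [Hx Hxl]]. exists (x :: l). repeat split.
      + now constructor.
      + intros y [<-|Hy]; auto.
      + simpl. now rewrite H3. }
  destruct (G (S N)) as [l [H1 [H2 H3]]]. specialize (H l H1 H2). lia.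
Qed.


(** * The complex exponential *)

Lemma exp_le_compat x y : x <= y -> exp x <= exp y.
Proof. intros [H| ->]; [left; now apply exp_increasing | right; reflexivity]. Qed.

Lemma Cexp_plus (x y : C) : Cexp (x + y) = (Cexp x * Cexp y)%C.
Proof.
  destruct x as [a b], y as [c d]. unfold Cexp, Cmult, Cplus, Re, Im. simpl.
  rewrite exp_plus, cos_plus, sin_plus. f_equal; ring.
Qed.

Lemma Cexp_0 : Cexp 0 = 1.
Proof. unfold Cexp; simpl. rewrite exp_0, cos_0, sin_0. unfold RtoC. f_equal; ring. Qed.

Lemma Cmod_Cexp (x : C) : Cmod (Cexp x) = exp (Re x).
Proof.
  unfold Cmod, Cexp; simpl fst; simpl snd.
  replace (_ + _) with (exp (Re x) ^ 2 * (Rsqr (sin (Im x)) + Rsqr (cos (Im x))))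
    by (unfold Rsqr; ring).
  rewrite sin2_cos2, Rmult_1_r, sqrt_pow2; [reflexivity | left; apply exp_pos].
Qed.

Lemma Cexp_neq_0 (x : C) : Cexp x <> 0.
Proof. apply Cmod_gt_0. rewrite Cmod_Cexp. apply exp_pos. Qed.

Lemma Cexp_opp (x : C) : Cexp (- x) = (/ Cexp x)%C.
Proof.
  assert (E : (Cexp x * Cexp (- x) = 1)%C).
  { rewrite <- Cexp_plus, <- Cexp_0. f_equal. ring. }
  replace (Cexp (- x)) with (/ Cexp x * (Cexp x * Cexp (- x)))%C
    by (field; apply Cexp_neq_0).
  rewrite E. ring.
Qed.

Lemma Cexp_nat (n : nat) (x : C) : Cexp (INR n * x) = (Cexp x ^ n)%C.
Proof.
  induction n as [|n IH].
  - simpl. rewrite <- Cexp_0. f_equal. ring.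
  - rewrite S_INR, RtoC_plus. simpl. rewrite <- IH, <- Cexp_plus. f_equal. ring.
Qed.

(** The range of the argument is that of [asin] y and [PI - asin] y. Doubled, it becomes the strip
    -PI <= Re z <= 3 PI of [P_plus]. *)
Lemma Clog_exists (w : C) : w <> 0 ->
  exists z, Cexp z = w /\ - (PI / 2) <= Im z <= 3 * (PI / 2).
Proof.
  intros Hw. assert (Hm := proj1 (Cmod_gt_0 w) Hw).
  set (r := Cmod w) in *. set (x := Re w / r). set (y := Im w / r).
  assert (Hxy : x ^ 2 + y ^ 2 = 1).
  { unfold x, y. apply Rmult_eq_reg_l with (r ^ 2); [|apply pow_nonzero; lra].
    transitivity (Re w ^ 2 + Im w ^ 2); [field; lra|].
    rewrite Rmult_1_r. symmetry. apply Cmod2_alt. }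
  assert (Hy : -1 <= y <= 1) by nra.
  assert (Hs : sqrt (1 - y²) = Rabs x).
  { replace (1 - y²) with (x²) by (unfold Rsqr; nra). apply sqrt_Rsqr_abs. }
  assert (E : exists phi, cos phi = x /\ sin phi = y /\ - (PI / 2) <= phi <= 3 * (PI / 2)).
  { assert (B := asin_bound y). assert (P := PI_RGT_0).
    destruct (Rle_dec 0 x) as [Hx|Hx].
    - exists (asin y). rewrite cos_asin, sin_asin, Hs, Rabs_right by lra.
      repeat split; lra.
    - exists (PI - asin y). rewrite sin_PI_x, sin_asin by lra.
      replace (PI - asin y) with (- asin y + PI) at 1 by ring.
      rewrite neg_cos, cos_neg, cos_asin, Hs, Rabs_left by lra.
      repeat split; lra. }
  destruct E as [phi [Hc [Hsn Hb]]].
  exists (ln r, phi). split; [|exact Hb].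
  unfold Cexp; simpl. rewrite exp_ln, Hc, Hsn by exact Hm.
  rewrite (surjective_pairing w). unfold x, y, Re, Im. f_equal; field; lra.
Qed.

Lemma Csqrt_exists (d : C) : exists s, (s * s = d)%C.
Proof.
  destruct (Ceq_dec d 0) as [->|Hd]; [exists 0; ring|].
  destruct (Clog_exists d Hd) as [z [<- _]].
  exists (Cexp (z / 2)). rewrite <- Cexp_plus. f_equal. field.
Qed.

Definition Cexp_poly (N : nat) (x : C) : C :=
  sum_n (fun k => x ^ k * / INR (fact k))%C N.

Lemma is_derive_Re_Cexp (d x : C) t :
  is_derive (fun t : R => Re (d * Cexp (t * x))%C) t (Re (d * x * Cexp (t * x))%C).
Proof.
  destruct d as [d1 d2], x as [u v].
  unfold Cexp, Cmult, Re, Im; simpl. auto_derive; [trivial|]. unfold Rminus. ring.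
Qed.

Lemma is_derive_n_Re_Cexp (c x : C) n t :
  is_derive_n (fun t : R => Re (c * Cexp (t * x))%C) n t
    (Re (c * x ^ n * Cexp (t * x))%C).
Proof.
  revert t. induction n as [|n IH]; intros t.
  - change (Re (c * Cexp (t * x)) = Re (c * 1 * Cexp (t * x))). now rewrite Cmult_1_r.
  - change (is_derive (Derive_n (fun t : R => Re (c * Cexp (t * x))%C) n) t
      (Re (c * (x * x ^ n) * Cexp (t * x))%C)).
    apply is_derive_ext with (fun t : R => Re (c * x ^ n * Cexp (t * x))%C).
    + intros s. symmetry. apply is_derive_n_unique, IH.
    + replace (c * (x * x ^ n))%C with (c * x ^ n * x)%C by ring.
      apply is_derive_Re_Cexp.
Qed.

(** Lagrange's form of the remainder is a real statement, so it is applied on [0, 1] to t |-> Re (c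
    exp (t x)). The directions c = 1 and c = -i then give the real and the imaginary part. *)
Lemma Re_Cexp_remainder (c x : C) N : Cmod c = 1 ->
  Rabs (Re (c * (Cexp x - Cexp_poly N x))%C)
  <= Cmod x ^ S N / INR (fact (S N)) * exp (Cmod x).
Proof.
  intros Hc.
  destruct (Taylor_Lagrange (fun t : R => Re (c * Cexp (t * x))%C) N 0 1) as [s [Hs E]].
  - lra.
  - intros t _ k _. destruct k; [exact I|].
    eexists. apply (is_derive_n_Re_Cexp c x (S k) t).
  - rewrite Rminus_0_r, pow1 in E.
    rewrite (is_derive_n_unique _ _ _ _ (is_derive_n_Re_Cexp c x (S N) s)) in E.
    rewrite Cmult_1_l in E.
    assert (P : sum_f_R0 (fun m => 1 ^ m / INR (fact m)
        * Derive_n (fun t : R => Re (c * Cexp (t * x))%C) m 0) N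
        = Re (c * Cexp_poly N x)%C).
    { clear E. unfold Cexp_poly. rewrite <- sum_n_Reals.
      assert (T : forall m, 1 ^ m / INR (fact m)
        * Derive_n (fun t : R => Re (c * Cexp (t * x))%C) m 0
        = Re (c * (x ^ m * / INR (fact m)))%C).
      { intros m. rewrite (is_derive_n_unique _ _ _ _ (is_derive_n_Re_Cexp c x m 0)).
        rewrite Cmult_0_l, Cexp_0, pow1, Cmult_1_r, <- RtoC_inv, Cmult_assoc
          by apply INR_fact_neq_0.
        generalize (c * x ^ m)%C. intros [d1 d2]. unfold Cmult, Re; simpl.
        field. apply INR_fact_neq_0. }
      rewrite (sum_n_ext _ _ N T). clear T.
      induction N as [|N IH]; [now rewrite !sum_O|].
      rewrite !sum_Sn, IH. unfold plus; simpl plus.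
      generalize (sum_n (fun k => x ^ k * / INR (fact k))%C N).
      intros d. change (Re (c * d) + Re (c * (x ^ S N * / INR (fact (S N))))
        = Re (c * (d + x ^ S N * / INR (fact (S N))))%C).
      rewrite Cmult_plus_distr_l. reflexivity. }
    rewrite P in E.
    replace (Re (c * (Cexp x - Cexp_poly N x))%C)
      with (Re (c * Cexp x)%C - Re (c * Cexp_poly N x)%C)
      by (unfold Cminus; rewrite Cmult_plus_distr_l; unfold Cmult, Cplus, Copp, Re, Im; simpl; ring).
    rewrite E.
    replace (_ + _ - _) with (1 / INR (fact (S N)) * Re (c * x ^ S N * Cexp (s * x))%C) by ring.
    assert (F := INR_fact_lt_0 (S N)).
    rewrite Rabs_mult, Rabs_right by (apply Rle_ge, Rdiv_le_0_compat; lra).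
    assert (G := re_le_Cmod (c * x ^ S N * Cexp (s * x))).
    rewrite !Cmod_mult, Hc, Cmod_pow, Cmod_Cexp, Rmult_1_l in G.
    assert (G2 : exp (Re (s * x)%C) <= exp (Cmod x)).
    { apply exp_le_compat. apply Rle_trans with (1 := Rle_abs _).
      apply Rle_trans with (1 := re_le_Cmod _).
      rewrite Cmod_mult, Cmod_R, Rabs_right by lra. assert (T := Cmod_ge_0 x). nra. }
    assert (T : 0 <= Cmod x ^ S N) by apply pow_le, Cmod_ge_0.
    replace (Cmod x ^ S N / INR (fact (S N)) * exp (Cmod x))
      with (1 / INR (fact (S N)) * (Cmod x ^ S N * exp (Cmod x))) by (field; lra).
    apply Rmult_le_compat_l; [apply Rdiv_le_0_compat; lra|].
    apply Rle_trans with (1 := G). now apply Rmult_le_compat_l.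
Qed.

Lemma pow_fact_le_exp y n : 0 <= y -> y ^ n / INR (fact n) <= exp y.
Proof.
  intros Hy. apply Rle_trans with (2 := exp_ge_taylor y n Hy).
  assert (T : forall k, 0 <= y ^ k / INR (fact k)).
  { intros k. apply Rdiv_le_0_compat; [now apply pow_le | apply INR_fact_lt_0]. }
  destruct n as [|n]; [apply Rle_refl|].
  simpl sum_f_R0. assert (0 <= sum_f_R0 (fun k => y ^ k / INR (fact k)) n)
    by (apply cond_pos_sum, T).
  simpl in *. lra.
Qed.

(** The factor 2^(-N) is extracted from |x|^(N+1) / (N+1)! by means of (2|x|)^(N+1) / (N+1)! <= exp
    (2|x|); with the exp (|x|) of the remainder this makes exp (3|x|). The geometric factor is
    uniform in x up to that weight, which permits exchanging sums later. *)
Lemma Cexp_remainder (x : C) N :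
  Cmod (Cexp x - Cexp_poly N x) <= (1 / 2) ^ N * exp (3 * Cmod x).
Proof.
  set (d := (Cexp x - Cexp_poly N x)%C).
  set (b := Cmod x ^ S N / INR (fact (S N)) * exp (Cmod x)).
  assert (H1 : Rabs (Re d) <= b).
  { replace d with (1 * d)%C by ring. apply Re_Cexp_remainder, Cmod_1. }
  assert (H2 : Rabs (Im d) <= b).
  { replace (Im d) with (Re (- Ci * d)%C) by (unfold Cmult, Copp, Ci, Re, Im; simpl; ring).
    apply Re_Cexp_remainder. now rewrite Cmod_opp, Cmod_Ci. }
  assert (H3 : Cmod d <= 2 * b).
  { replace d with (Re d + Ci * Im d)%C
      by (destruct d; unfold Cmult, Cplus, Ci, Re, Im, RtoC; simpl; f_equal; ring).
    apply Rle_trans with (1 := Cmod_triangle _ _).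
    rewrite Cmod_mult, Cmod_Ci, !Cmod_R. lra. }
  apply Rle_trans with (1 := H3).
  assert (Hx := Cmod_ge_0 x).
  assert (H4 := pow_fact_le_exp (2 * Cmod x) (S N)).
  rewrite Rpow_mult_distr in H4.
  replace (3 * Cmod x) with (2 * Cmod x + Cmod x) by ring. rewrite exp_plus.
  rewrite <- Rmult_assoc. unfold b. rewrite <- Rmult_assoc.
  apply Rmult_le_compat_r; [left; apply exp_pos|].
  assert (F := INR_fact_lt_0 (S N)).
  assert (Q : 0 < 2 ^ N) by (apply pow_lt; lra).
  replace ((1 / 2) ^ N) with (/ 2 ^ N) by (unfold Rdiv; rewrite Rmult_1_l, pow_inv; reflexivity).
  apply Rmult_le_reg_l with (2 ^ N); [exact Q|].
  rewrite <- (Rmult_assoc _ (/ _)), Rinv_r, Rmult_1_l by lra.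
  apply Rle_trans with (2 := H4 ltac:(lra)). right. simpl pow. field. lra.
Qed.

(** * Convergent power series *)

Lemma pseval_is_pseries c M r t : 0 <= r -> (forall k, Cmod (c k) <= M * r ^ k) ->
  Cmod t * r < 1 -> @is_pseries C_AbsRing C_NormedModule c t (pseval c t).
Proof.
  intros Hr Hc Ht. unfold is_pseries.
  apply is_series_ext with (fun k => c k * t ^ k)%C.
  - intros k. change (c k * t ^ k = t ^ k * c k)%C.
    ring.
  - apply Csum_correct. now apply pseval_summable with M r.
Qed.

Lemma is_pseries_pseval c (t l : C) :
  @is_pseries C_AbsRing C_NormedModule c t l -> pseval c t = l.
Proof.
  intros H. apply Csum_unique. refine (is_series_ext _ _ _ _ H).
  intros k. change (t ^ k * c k = c k * t ^ k)%C.
  ring.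
Qed.

Lemma is_lim_seq_0_bounded (u : nat -> R) : (forall n, 0 <= u n) ->
  is_lim_seq u 0 -> exists M, forall n, u n <= M.
Proof.
  intros Hp H. destruct (proj2 (is_lim_seq_spec u 0) H (mkposreal 1 Rlt_0_1)) as [N HN].
  simpl in HN. exists (1 + sum_n u N). intros n.
  assert (0 <= sum_n u N).
  { clear -Hp. induction N as [|N IH]; [rewrite sum_O; apply Hp|].
    rewrite sum_Sn. specialize (Hp (S N)). unfold plus; simpl. lra. }
  destruct (Nat.le_gt_cases N n) as [Hn|Hn].
  - specialize (HN n Hn). rewrite Rminus_0_r in HN.
    assert (T := Rle_abs (u n)). lra.
  - assert (T : u n <= sum_n u n).
    { destruct n as [|n]; [rewrite sum_O; lra|].
      rewrite sum_Sn. assert (S0 : 0 <= sum_n u n).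
      { clear -Hp. induction n as [|n IH]; [rewrite sum_O; apply Hp|].
        rewrite sum_Sn. specialize (Hp (S n)). unfold plus; simpl. lra. }
      unfold plus; simpl. lra. }
    assert (T2 := sum_n_pos_incr u n N Hp (Nat.lt_le_incl _ _ Hn)). lra.
Qed.

(** Convergence at one nonzero point bounds the partial sums, hence their differences c_k t^k. *)
Lemma is_pseries_coef_bound (c : nat -> C) (t l : C) : t <> 0 ->
  @is_pseries C_AbsRing C_NormedModule c t l ->
  exists M, forall k, Cmod (c k) <= M * (/ Cmod t) ^ k.
Proof.
  intros Ht H. assert (Hm := proj1 (Cmod_gt_0 t) Ht).
  assert (L := proj1 (is_Cseries_lim _ _) H).
  destruct (is_lim_seq_0_bounded _ (fun n => Cmod_ge_0 _) L) as [M HM].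
  assert (HS : forall n, Cmod (sum_n (fun k => t ^ k * c k)%C n) <= M + Cmod l).
  { intros n.
    assert (HMn : Cmod ((sum_n (fun k => t ^ k * c k)%C n : C) - l) <= M) by exact (HM n).
    revert HMn. generalize (sum_n (fun k => t ^ k * c k)%C n : C). intros s Hs.
    assert (T := Cmod_triangle_inv s l). lra. }
  exists (2 * (M + Cmod l)). intros k.
  assert (B : Cmod (c k * t ^ k) <= 2 * (M + Cmod l)).
  { destruct k as [|k].
    - assert (H0 := HS O). rewrite sum_O in H0. rewrite Cmult_comm.
      assert (T := Cmod_ge_0 (t ^ 0 * c O)). lra.
    - assert (H1 := HS (S k)). assert (H2 := HS k). rewrite sum_Sn in H1.
      set (A := sum_n (fun k => t ^ k * c k)%C k) in *.
      replace (c (S k) * t ^ S k)%C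
        with ((A + t ^ S k * c (S k)) - A)%C by ring.
      apply Rle_trans with (1 := Cmod_triangle_minus _ _).
      replace (2 * (M + Cmod l)) with ((M + Cmod l) + (M + Cmod l)) by ring.
      apply Rplus_le_compat; [exact H1 | exact H2]. }
  rewrite Cmod_mult, Cmod_pow in B. rewrite pow_inv.
  assert (P := pow_lt _ k Hm).
  apply Rle_div_r in B; [|exact P]. exact B.
Qed.

Lemma pseval_0 c : pseval c 0 = c O.
Proof.
  apply is_pseries_pseval. unfold is_pseries.
  refine (is_series_ext _ _ _ _ (is_pseries_0 c : is_series _ _)). reflexivity.
Qed.

Lemma pseval_S c M r t : 0 <= r -> (forall k, Cmod (c k) <= M * r ^ k) ->
  Cmod t * r < 1 -> pseval c t = (c O + t * pseval (fun k => c (S k)) t)%C.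
Proof.
  intros Hr Hc Ht. unfold pseval. rewrite Csum_S by now apply pseval_summable with M r.
  simpl pow. rewrite <- Csum_scal.
  - simpl. rewrite Cmult_1_r. f_equal. apply Csum_ext. intros k. ring.
  - apply pseval_summable with (M * r) r; trivial.
    intros k. specialize (Hc (S k)). simpl in Hc. lra.
Qed.

Lemma pseval_lipschitz c M r t : 0 <= r -> (forall k, Cmod (c k) <= M * r ^ k) ->
  Cmod t * r <= 1 / 2 -> Cmod (pseval c t - c O) <= 2 * M * r * Cmod t.
Proof.
  intros Hr Hc Ht. rewrite (pseval_S c M r) by (trivial; lra).
  replace (c O + t * pseval (fun k => c (S k)) t - c O)%C
    with (t * pseval (fun k => c (S k)) t)%C by ring.
  rewrite Cmod_mult, Rmult_comm. apply Rmult_le_compat_r; [apply Cmod_ge_0|].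
  assert (T := Cmod_ge_0 t).
  assert (HM : 0 <= M).
  { specialize (Hc O). simpl in Hc. assert (T0 := Cmod_ge_0 (c O)). lra. }
  apply Rle_trans with (M * r / (1 - Cmod t * r)).
  - apply Csum_geom; [nra|]. intros k. rewrite Cmod_mult, Cmod_pow, Rpow_mult_distr.
    specialize (Hc (S k)). simpl in Hc.
    assert (0 <= Cmod t ^ k) by now apply pow_le. nra.
  - apply Rle_div_l; [lra|]. assert (0 <= M * r) by nra. nra.
Qed.

Lemma pseval_shift c M r t m : 0 <= r -> (forall k, Cmod (c k) <= M * r ^ k) ->
  Cmod t * r < 1 -> (forall k, (k < m)%nat -> c k = 0) ->
  pseval c t = (t ^ m * pseval (fun k => c (m + k)%nat) t)%C.
Proof.
  intros Hr. revert c M. induction m as [|m IH]; intros c M Hc Ht Hz.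
  - simpl. now rewrite Cmult_1_l.
  - rewrite (pseval_S c M r), (Hz O) by (trivial; lia).
    rewrite (IH (fun k => c (S k)) (M * r)); trivial.
    + simpl. ring.
    + intros k. specialize (Hc (S k)). simpl in Hc. lra.
    + intros k Hk. apply Hz. lia.
Qed.

(** Balls of [C] are boxes in the two components; comparing them with discs costs the factor sqrt
    2. *)
Lemma locally_Cmod (z0 : C) (P : C -> Prop) :
  locally z0 P <-> exists d, 0 < d /\ forall t, Cmod t < d -> P (z0 + t)%C.
Proof.
  split.
  - intros [e He]. exists e. split; [apply cond_pos|]. intros t Ht.
    apply He. apply C_NormedModule_mixin_compat1.
    change (Cmod (z0 + t - z0) < e). now replace (z0 + t - z0)%C with t by ring.
  - intros [d [Hd H]].
    assert (H2 : 0 < sqrt 2) by (apply sqrt_lt_R0; lra).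
    assert (He : 0 < d / sqrt 2) by now apply Rdiv_lt_0_compat.
    exists (mkposreal _ He). intros y Hy.
    assert (T := C_NormedModule_mixin_compat2 z0 y (mkposreal _ He) Hy).
    simpl in T. replace (sqrt 2 * (d / sqrt 2)) with d in T by (field; lra).
    replace y with (z0 + (y - z0))%C by ring. apply H. exact T.
Qed.

Lemma analytic_at_coef h z0 : analytic_at h z0 ->
  exists c M r d, 0 <= r /\ 0 < d /\ (forall k, Cmod (c k) <= M * r ^ k) /\
    forall t, Cmod t < d -> h (z0 + t)%C = pseval c t.
Proof.
  intros [c Hc]. apply locally_Cmod in Hc. destruct Hc as [d [Hd Hc]].
  assert (Hd2 : Cmod (RtoC (d / 2)) = d / 2) by (rewrite Cmod_R, Rabs_right; lra).
  destruct (is_pseries_coef_bound c (RtoC (d / 2)) (h (z0 + RtoC (d / 2))%C)) as [M HM].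
  - apply Cmod_gt_0. lra.
  - specialize (Hc (RtoC (d / 2)) ltac:(lra)).
    now replace (z0 + RtoC (d / 2) - z0)%C with (RtoC (d / 2)) in Hc by ring.
  - exists c, M, (/ Cmod (RtoC (d / 2))), d. repeat split; trivial.
    + rewrite Hd2. left. apply Rinv_0_lt_compat. lra.
    + intros t Ht. symmetry. apply is_pseries_pseval.
      specialize (Hc t Ht). now replace (z0 + t - z0)%C with t in Hc by ring.
Qed.

Lemma analytic_at_lipschitz h z0 : analytic_at h z0 ->
  exists K d, 0 <= K /\ 0 < d /\
    forall t, Cmod t < d -> Cmod (h (z0 + t)%C - h z0) <= K * Cmod t.
Proof.
  intros H. destruct (analytic_at_coef h z0 H) as [c [M [r [d [Hr [Hd [Hc Hh]]]]]]].
  assert (HM : 0 <= M).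
  { specialize (Hc O). simpl in Hc. assert (T0 := Cmod_ge_0 (c O)). lra. }
  assert (H0 : h z0 = c O).
  { rewrite <- pseval_0, <- Hh by (rewrite Cmod_0; exact Hd). f_equal. ring. }
  exists (2 * M * r), (Rmin d (/ (2 * (r + 1)))).
  assert (Hi : 0 < / (2 * (r + 1))) by (apply Rinv_0_lt_compat; lra).
  repeat split.
  - repeat apply Rmult_le_pos; lra.
  - now apply Rmin_glb_lt.
  - intros t Ht. rewrite Hh, H0 by (apply Rlt_le_trans with (1 := Ht), Rmin_l).
    apply pseval_lipschitz; trivial.
    assert (T := Rlt_le_trans _ _ _ Ht (Rmin_r _ _)). assert (T2 := Cmod_ge_0 t).
    apply Rle_trans with (/ (2 * (r + 1)) * (r + 1)); [nra|].
    right. field. lra.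
Qed.

(** The pole is approached along z0 + i s. A bound B on F would give |h (z0 + i s)| <= B s^m <= |B|
    s, and with the Lipschitz constant K of h at z0, |h z0| <= (K + |B|) s, which fails for small
    s. *)
Lemma upper_pole_unbounded F z0 d B : 0 < d -> upper_pole F z0 ->
  (forall t, Cmod t < d -> 0 < Im (z0 + t)%C -> Cmod (F (z0 + t)%C) <= B) ->
  Im z0 = 0 -> False.
Proof.
  intros Hd [m [h [Hm [Hh [Hh0 HF]]]]] HB Hz0.
  apply locally_Cmod in HF. destruct HF as [d1 [Hd1 HF]].
  destruct (analytic_at_lipschitz h z0 Hh) as [K [d2 [HK [Hd2 HL]]]].
  assert (Hpos := proj1 (Cmod_gt_0 _) Hh0).
  assert (HB1 : 0 <= Rabs B) by apply Rabs_pos.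
  set (s := Rmin (Rmin (Rmin d d1) (Rmin d2 1)) (Cmod (h z0) / (K + Rabs B + 1)) / 2).
  assert (Hq : 0 < Cmod (h z0) / (K + Rabs B + 1)) by (apply Rdiv_lt_0_compat; lra).
  assert (Hs : 0 < s /\ s < d /\ s < d1 /\ s < d2 /\ s < 1
     /\ s < Cmod (h z0) / (K + Rabs B + 1)).
  { unfold s.
    assert (0 < Rmin (Rmin (Rmin d d1) (Rmin d2 1)) (Cmod (h z0) / (K + Rabs B + 1)))
      by (repeat apply Rmin_glb_lt; lra).
    revert H. generalize (Cmod (h z0) / (K + Rabs B + 1)). intros x Hx.
    unfold Rmin in *. repeat destruct Rle_dec; lra. }
  destruct Hs as [S0 [S1 [S2 [S3 [S4 S5]]]]].
  assert (Ht : Cmod (Ci * s) = s)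
    by (rewrite Cmod_mult, Cmod_Ci, Cmod_R, Rabs_right; lra).
  assert (Hi : 0 < Im (z0 + Ci * s)%C).
  { unfold Cplus, Cmult, Ci, Im in *; simpl. rewrite Hz0. lra. }
  assert (E1 := HB (Ci * s)%C ltac:(lra) Hi).
  assert (E2 := HL (Ci * s)%C ltac:(lra)).
  rewrite (HF (Ci * s)%C ltac:(lra) Hi) in E1.
  replace (z0 + Ci * s - z0)%C with (Ci * s)%C in E1 by ring.
  assert (Hn : (Ci * s)%C <> 0) by (apply Cmod_gt_0; lra).
  rewrite Cmod_div, Cmod_pow, Ht in E1 by now apply Cpow_nz.
  rewrite Ht in E2.
  assert (Hsm : 0 < s ^ m <= s).
  { split; [apply pow_lt; lra|]. destruct m as [|m]; [lia|]. simpl.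
    assert (s ^ m <= 1) by (rewrite <- (pow1 m); apply pow_incr; lra).
    assert (0 < s ^ m) by (apply pow_lt; lra). nra. }
  apply Rle_div_l in E1; [|lra].
  assert (E3 : Cmod (h z0) <= Cmod (h (z0 + Ci * s)%C) + K * s).
  { assert (T := Cmod_triangle_inv (h z0) (h (z0 + Ci * s)%C)).
    rewrite Cmod_minus_sym in T. lra. }
  apply Rlt_div_r in S5; [|lra].
  assert (T := Rle_abs B). nra.
Qed.

(** The multiplicity is the least index of a nonzero coefficient. The cofactor is the shifted power
    series itself, which is analytic on both sides of the axis although F is compared with it only
    where Im z >= 0. *)
Lemma zero_multiplicity_exists F z0 c M r d : 0 <= r -> 0 < d ->
  (forall k, Cmod (c k) <= M * r ^ k) ->
  (forall t, Cmod t < d -> 0 <= Im (z0 + t)%C -> F (z0 + t)%C = pseval c t) ->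
  (exists k, c k <> 0) -> exists m, zero_multiplicity F z0 m.
Proof.
  intros Hr Hd Hc HF [k Hk].
  destruct (dec_inh_nat_subset_has_unique_least_element (fun k => c k <> 0))
    as [m [[Hm Hmin] _]].
  { intros j. apply classic. }
  { now exists k. }
  assert (Hz : forall j, (j < m)%nat -> c j = 0).
  { intros j Hj. apply NNPP. intros H. specialize (Hmin j H). lia. }
  assert (Hc' : forall j, Cmod (c (m + j)%nat) <= M * r ^ m * r ^ j).
  { intros j. rewrite Rmult_assoc, <- pow_add. apply Hc. }
  assert (Hi : 0 < / (r + 1)) by (apply Rinv_0_lt_compat; lra).
  assert (Hd' : forall t, Cmod t < / (r + 1) -> Cmod t * r < 1).
  { intros t Ht. assert (T := Cmod_ge_0 t).
    apply Rle_lt_trans with (Cmod t * (r + 1)); [nra|].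
    apply Rlt_le_trans with (/ (r + 1) * (r + 1)); [nra | right; field; lra]. }
  exists m, (fun z => pseval (fun j => c (m + j)%nat) (z - z0)). repeat split.
  - exists (fun j => c (m + j)%nat). apply locally_Cmod.
    exists (/ (r + 1)). split; [exact Hi|]. intros t Ht.
    replace (z0 + t - z0)%C with t by ring.
    apply pseval_is_pseries with (M * r ^ m) r; trivial. now apply Hd'.
  - replace (z0 - z0)%C with (RtoC 0) by ring. rewrite pseval_0. now rewrite Nat.add_0_r.
  - apply locally_Cmod. exists (Rmin d (/ (r + 1))). split; [now apply Rmin_glb_lt|].
    intros t Ht Him. replace (z0 + t - z0)%C with t by ring.
    rewrite HF; trivial.
    + apply pseval_shift with M r; trivial. apply Hd'.
      apply Rlt_le_trans with (1 := Ht), Rmin_r.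
    + apply Rlt_le_trans with (1 := Ht), Rmin_l.
Qed.

(** * Exponential sums *)

(** Taylor coefficients at t = 0 of the sum over m of b_m exp (x_m t). *)
Definition expsum_coef (b x : nat -> C) (k : nat) : C :=
  (/ INR (fact k) * Csum (fun m => b m * x m ^ k))%C.

Section ExpSum.

Variables (b x : nat -> C) (tau : R).
Hypothesis Htau : 0 < tau.
Hypothesis Hsum : ex_series (fun m => Cmod (b m) * exp (3 * (tau * Cmod (x m)))).

Let S0 := Series (fun m => Cmod (b m) * exp (3 * (tau * Cmod (x m)))).

Lemma expsum_pow_le m k :
  Cmod (b m * x m ^ k) <= INR (fact k) * (/ tau) ^ k
    * (Cmod (b m) * exp (3 * (tau * Cmod (x m)))).
Proof.
  rewrite Cmod_mult, Cmod_pow.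
  assert (Hx := Cmod_ge_0 (x m)).
  assert (H1 := pow_fact_le_exp (tau * Cmod (x m)) k ltac:(nra)).
  assert (H2 : exp (tau * Cmod (x m)) <= exp (3 * (tau * Cmod (x m)))).
  { apply exp_le_compat. nra. }
  assert (F := INR_fact_lt_0 k).
  apply Rle_div_l in H1; [|lra].
  assert (P := pow_lt tau k Htau).
  replace (Cmod (x m) ^ k) with ((/ tau) ^ k * (tau * Cmod (x m)) ^ k)
    by (rewrite Rpow_mult_distr, pow_inv; field; lra).
  assert (Q : 0 < (/ tau) ^ k) by now apply pow_lt, Rinv_0_lt_compat.
  assert (B := Cmod_ge_0 (b m)).
  replace (INR (fact k) * (/ tau) ^ k * (Cmod (b m) * exp (3 * (tau * Cmod (x m)))))
    with (Cmod (b m) * ((/ tau) ^ k * (exp (3 * (tau * Cmod (x m))) * INR (fact k)))) by ring.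
  apply Rmult_le_compat_l; [exact B|]. apply Rmult_le_compat_l; [lra|].
  apply Rle_trans with (1 := H1). apply Rmult_le_compat_r; lra.
Qed.

Lemma expsum_pow_summable k : summable (fun m => b m * x m ^ k)%C.
Proof.
  apply (summable_le _ _ (fun m => expsum_pow_le m k)).
  exact (ex_series_scal_l (INR (fact k) * (/ tau) ^ k) _ Hsum).
Qed.

Lemma expsum_coef_bound k : Cmod (expsum_coef b x k) <= S0 * (/ tau) ^ k.
Proof.
  unfold expsum_coef. assert (F := INR_fact_lt_0 k).
  rewrite Cmod_mult, <- RtoC_inv, Cmod_R, Rabs_right
    by (try lra; apply Rle_ge; left; now apply Rinv_0_lt_compat).
  assert (H := Csum_le _ _ (fun m => expsum_pow_le m k)
    (ex_series_scal_l (INR (fact k) * (/ tau) ^ k) _ Hsum)).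
  rewrite Series_scal_l in H. fold S0 in H.
  apply Rmult_le_reg_l with (INR (fact k)); [exact F|].
  rewrite <- Rmult_assoc, Rinv_r, Rmult_1_l by lra. lra.
Qed.

(** The N-th partial sum of the power series is the exponential sum with every exp replaced by its
    Taylor polynomial of degree N. By [Cexp_remainder] the total error is at most 2^(-N) S0, and
    this is where the weight exp (3 tau |x_m|) in [Hsum] comes from. *)
Lemma expsum_pseries t : Cmod t <= tau ->
  pseval (expsum_coef b x) t = Csum (fun m => b m * Cexp (x m * t))%C.
Proof.
  intros Ht. apply Csum_unique, is_Cseries_lim.
  assert (HE : forall m N, Cmod (b m * (Cexp (x m * t) - Cexp_poly N (x m * t)))
    <= (1 / 2) ^ N * (Cmod (b m) * exp (3 * (tau * Cmod (x m))))).
  { intros m N. rewrite Cmod_mult.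
    assert (H1 := Cexp_remainder (x m * t) N).
    assert (H2 : exp (3 * Cmod (x m * t)) <= exp (3 * (tau * Cmod (x m)))).
    { apply exp_le_compat. rewrite Cmod_mult. assert (T := Cmod_ge_0 (x m)). nra. }
    assert (B := Cmod_ge_0 (b m)).
    assert (P : 0 < (1 / 2) ^ N) by (apply pow_lt; lra).
    replace ((1 / 2) ^ N * (Cmod (b m) * exp (3 * (tau * Cmod (x m)))))
      with (Cmod (b m) * ((1 / 2) ^ N * exp (3 * (tau * Cmod (x m))))) by ring.
    apply Rmult_le_compat_l; [exact B|]. apply Rle_trans with (1 := H1).
    apply Rmult_le_compat_l; lra. }
  assert (HP : forall N, summable (fun m => b m * Cexp_poly N (x m * t))%C /\
    Csum (fun m => b m * Cexp_poly N (x m * t))%C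
    = sum_n (fun k => expsum_coef b x k * t ^ k)%C N).
  { assert (Term : forall k, summable (fun m => (t ^ k * / INR (fact k)) * (b m * x m ^ k))%C).
    { intros k. apply summable_scal, expsum_pow_summable. }
    assert (TermE : forall k, Csum (fun m => (t ^ k * / INR (fact k)) * (b m * x m ^ k))%C
      = (expsum_coef b x k * t ^ k)%C).
    { intros k. rewrite Csum_scal by apply expsum_pow_summable.
      unfold expsum_coef. ring. }
    assert (Ex : forall k m, ((t ^ k * / INR (fact k)) * (b m * x m ^ k)
      = b m * ((x m * t) ^ k * / INR (fact k)))%C).
    { intros k m. rewrite Cpow_mult_l. ring. }
    unfold Cexp_poly. induction N as [|N [IH1 IH2]].
    - split.
      + apply summable_ext with (2 := Term O). intros m. now rewrite sum_O, Ex.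
      + rewrite sum_O, <- TermE. apply Csum_ext. intros m. now rewrite sum_O, Ex.
    - assert (Split : forall m, (b m * sum_n (fun k => (x m * t) ^ k * / INR (fact k)) N
        + (t ^ S N * / INR (fact (S N))) * (b m * x m ^ S N)
        = b m * sum_n (fun k => (x m * t) ^ k * / INR (fact k)) (S N))%C).
      { intros m. rewrite sum_Sn, Ex. symmetry. apply Cmult_plus_distr_l. }
      split.
      + apply summable_ext with (1 := Split). now apply summable_plus.
      + rewrite <- (Csum_ext _ _ Split), Csum_plus, IH2, TermE, sum_Sn by trivial.
        reflexivity. }
  assert (HT : summable (fun m => b m * Cexp (x m * t))%C).
  { apply summable_ext with (fun m => b m * (Cexp (x m * t) - Cexp_poly 0 (x m * t))
      + b m * Cexp_poly 0 (x m * t))%C; [intros m; ring|].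
    apply summable_plus; [|apply HP].
    apply (summable_le _ _ (fun m => HE m O)).
    exact (ex_series_scal_l _ _ Hsum). }
  apply is_lim_seq_le_le with (fun _ => 0) (fun N => (1 / 2) ^ N * S0).
  - intros N. split; [apply Cmod_ge_0|]. destruct (HP N) as [HP1 HP2].
    enough (G : Cmod (sum_n (fun k => expsum_coef b x k * t ^ k)%C N
        - Csum (fun m => b m * Cexp (x m * t))%C) <= (1 / 2) ^ N * S0) by exact G.
    rewrite <- HP2, Cmod_minus_sym.
    assert (E : (Csum (fun m => b m * Cexp (x m * t)) - Csum (fun m => b m * Cexp_poly N (x m * t))
      = Csum (fun m => b m * (Cexp (x m * t) - Cexp_poly N (x m * t))))%C).
    { rewrite (Csum_ext (fun m => b m * (Cexp (x m * t) - Cexp_poly N (x m * t)))%C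
       (fun m => b m * Cexp (x m * t) + (- (1)) * (b m * Cexp_poly N (x m * t)))%C)
       by (intros m; ring).
      rewrite (Csum_plus _ _ HT (summable_scal (- (1)) _ HP1)), (Csum_scal _ _ HP1). ring. }
    rewrite E. unfold S0. rewrite <- Series_scal_l. apply Csum_le.
    + intros m. apply HE.
    + exact (ex_series_scal_l _ _ Hsum).
  - apply is_lim_seq_const.
  - replace (Finite 0) with (Rbar_mult 0 S0) by (simpl; f_equal; ring).
    apply is_lim_seq_scal_r, is_lim_seq_geom. rewrite Rabs_right; lra.
Qed.

End ExpSum.


(** * Infinite products *)

Lemma Cprod_upto_S (u : nat -> C) N :
  Cprod_upto u (S N) = (u O * Cprod_upto (fun k => u (S k)) N)%C.
Proof.
  induction N as [|N IH]; [reflexivity|].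
  change (Cprod_upto u (S N) * u (S (S N))
    = u O * (Cprod_upto (fun k => u (S k)) N * u (S (S N))))%C.
  rewrite IH. ring.
Qed.

Lemma Cprod_upto_inv (u : nat -> C) N : (forall k, u k <> 0) ->
  (Cprod_upto u N * Cprod_upto (fun k => / u k) N)%C = 1.
Proof.
  intros Hu. induction N as [|N IH].
  - simpl. field. apply Hu.
  - simpl. transitivity ((Cprod_upto u N * Cprod_upto (fun k => / u k) N)
      * (u (S N) * / u (S N)))%C; [ring|].
    rewrite IH. field. apply Hu.
Qed.

Section InfiniteProduct.

Variables (d V : R).
Hypothesis Hd : 0 < d < 1.

Lemma Cprod_upto_bound u N : (forall k, Cmod (1 - u k) <= V * d ^ k) ->
  Cmod (Cprod_upto u N) <= exp (V / (1 - d)).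
Proof.
  intros Hu.
  assert (HV : 0 <= V).
  { specialize (Hu O). simpl in Hu. assert (T := Cmod_ge_0 (1 - u O)). lra. }
  assert (H1 : forall k, Cmod (u k) <= exp (V * d ^ k)).
  { intros k. apply Rle_trans with (1 + V * d ^ k); [|apply exp_ineq1_le].
    assert (T := Cmod_triangle_minus 1 (1 - u k)).
    replace (1 - (1 - u k))%C with (u k) in T by ring.
    rewrite Cmod_1 in T. specialize (Hu k). lra. }
  apply Rle_trans with (exp (V * sum_n (fun k => d ^ k) N)).
  - induction N as [|N IH].
    + rewrite sum_O. apply H1.
    + rewrite sum_Sn. unfold plus; simpl plus.
      change (Cmod (Cprod_upto u N * u (S N))
        <= exp (V * (sum_n (fun k => d ^ k) N + d ^ S N))).
      rewrite Rmult_plus_distr_l, exp_plus, Cmod_mult.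
      apply Rmult_le_compat; [apply Cmod_ge_0 | apply Cmod_ge_0 | exact IH | apply H1].
  - apply exp_le_compat. unfold Rdiv. apply Rmult_le_compat_l; [exact HV|].
    rewrite <- Series_geom by (rewrite Rabs_right; lra).
    assert (He : ex_series (fun k => d ^ k)) by (apply ex_series_geom; rewrite Rabs_right; lra).
    refine (is_lim_seq_incr_compare _ _ (Series_correct _ He) _ N).
    intros n. rewrite sum_Sn. assert (0 < d ^ S n) by (apply pow_lt; lra).
    unfold plus; simpl in *. lra.
Qed.

(** Telescoping: the partial products are the partial sums of D, whose terms decay like d^k because
    the partial products stay bounded. *)
Lemma Cprod_converges u : (forall k, Cmod (1 - u k) <= V * d ^ k) ->
  Cseq_lim (Cprod_upto u) (Cprod u).
Proof.
  intros Hu.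
  set (D := fun k => match k with O => u O
    | S j => (Cprod_upto u (S j) - Cprod_upto u j)%C end).
  assert (HD : forall N, sum_n D N = Cprod_upto u N).
  { induction N as [|N IH]; [now rewrite sum_O|]. rewrite sum_Sn, IH.
    change (Cprod_upto u N + (Cprod_upto u (S N) - Cprod_upto u N) = Cprod_upto u (S N))%C.
    ring. }
  assert (SD : summable D).
  { apply summable_S.
    apply summable_geom with (exp (V / (1 - d)) * V * d) d; [lra|].
    intros k. unfold D. simpl Cprod_upto.
    replace (Cprod_upto u k * u (S k) - Cprod_upto u k)%C
      with (- (Cprod_upto u k * (1 - u (S k))))%C by ring.
    rewrite Cmod_opp, Cmod_mult.
    replace (exp (V / (1 - d)) * V * d * d ^ k) with (exp (V / (1 - d)) * (V * d ^ S k))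
      by (simpl; ring).
    apply Rmult_le_compat; try apply Cmod_ge_0; [now apply Cprod_upto_bound | apply Hu]. }
  assert (L : Cseq_lim (Cprod_upto u) (Csum D)).
  { apply is_lim_seq_ext with (2 := proj1 (is_Cseries_lim _ _) (Csum_correct _ SD)).
    intros n. f_equal. f_equal. apply HD. }
  unfold Cprod. now rewrite (Clim_unique _ _ L).
Qed.

Lemma Cprod_upper u : (forall k, Cmod (1 - u k) <= V * d ^ k) ->
  Cmod (Cprod u) <= exp (V / (1 - d)).
Proof.
  intros Hu. assert (L := Cprod_converges u Hu).
  assert (L2 : is_lim_seq (fun n => exp (V / (1 - d)) + Cmod (Cprod_upto u n - Cprod u))
    (exp (V / (1 - d)) + 0)) by (apply is_lim_seq_plus'; [apply is_lim_seq_const | exact L]).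
  rewrite Rplus_0_r in L2.
  refine (is_lim_seq_le (fun _ => Cmod (Cprod u)) _ (Cmod (Cprod u)) (exp (V / (1 - d)))
    _ (is_lim_seq_const _) L2).
  intros n. assert (T := Cmod_triangle_inv (Cprod u) (Cprod_upto u n)).
  rewrite Cmod_minus_sym in T. assert (B := Cprod_upto_bound u n Hu). lra.
Qed.

End InfiniteProduct.

(** Since 1 - 1/u = -(1 - u)/u, the product of the inverses obeys the same kind of upper bound, with
    V replaced by W V; this is a lower bound for the product. *)
Lemma Cprod_lower d V W (u : nat -> C) : 0 < d < 1 ->
  (forall k, Cmod (1 - u k) <= V * d ^ k) ->
  (forall k, u k <> 0) -> (forall k, Cmod (/ u k) <= W) ->
  exp (- (W * V / (1 - d))) <= Cmod (Cprod u).
Proof.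
  intros Hd Hu Hn HW.
  assert (Hv : forall k, Cmod (1 - / u k) <= (W * V) * d ^ k).
  { intros k. replace (1 - / u k)%C with (- (/ u k * (1 - u k)))%C by (field; apply Hn).
    rewrite Cmod_opp, Cmod_mult, Rmult_assoc.
    apply Rmult_le_compat; try apply Cmod_ge_0; [apply HW | apply Hu]. }
  assert (L := Cprod_converges d V Hd u Hu).
  assert (L2 : is_lim_seq (fun n => exp (- (W * V / (1 - d))) - Cmod (Cprod_upto u n - Cprod u))
    (exp (- (W * V / (1 - d))) - 0)) by (apply is_lim_seq_minus'; [apply is_lim_seq_const | exact L]).
  rewrite Rminus_0_r in L2.
  refine (is_lim_seq_le _ (fun _ => Cmod (Cprod u)) (exp (- (W * V / (1 - d)))) (Cmod (Cprod u))
    _ L2 (is_lim_seq_const _)).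
  intros n.
  assert (T := Cmod_triangle_inv (Cprod_upto u n) (Cprod u)).
  assert (B := Cprod_upto_bound d (W * V) Hd _ n Hv).
  assert (E := Cprod_upto_inv u n Hn).
  apply (f_equal Cmod) in E. rewrite Cmod_mult, Cmod_1 in E.
  assert (P := exp_pos (W * V / (1 - d))).
  assert (P2 : exp (- (W * V / (1 - d))) <= Cmod (Cprod_upto u n)).
  { rewrite exp_Ropp. apply Rmult_le_reg_l with (exp (W * V / (1 - d))); [exact P|].
    rewrite Rinv_r by lra. apply Rle_trans with (1 := Req_le _ _ (eq_sym E)).
    rewrite Rmult_comm. apply Rmult_le_compat_r; [apply Cmod_ge_0 | exact B]. }
  lra.
Qed.

(** From some index on |u_k| >= 1/2; the finitely many earlier inverses are dominated by their
    sum. *)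
Lemma inv_bounded d V (u : nat -> C) : 0 < d < 1 ->
  (forall k, Cmod (1 - u k) <= V * d ^ k) -> (forall k, u k <> 0) ->
  exists W, forall k, Cmod (/ u k) <= W.
Proof.
  intros Hd Hu Hn.
  assert (L : is_lim_seq (fun k => Cmod (1 - u k)) 0).
  { apply is_lim_seq_le_le with (fun _ => 0) (fun k => V * d ^ k).
    - intros k. split; [apply Cmod_ge_0 | apply Hu].
    - apply is_lim_seq_const.
    - replace (Finite 0) with (Rbar_mult V 0) by (simpl; f_equal; ring).
      apply is_lim_seq_scal_l, is_lim_seq_geom. rewrite Rabs_right; lra. }
  destruct (proj2 (is_lim_seq_spec _ 0) L (mkposreal (1 / 2) ltac:(lra))) as [N HN].
  simpl in HN.
  exists (2 + sum_n (fun k => Cmod (/ u k)) N). intros n.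
  assert (S0 : forall n, 0 <= sum_n (fun k => Cmod (/ u k)) n).
  { intros j. rewrite sum_n_Reals. apply cond_pos_sum. intros k. apply Cmod_ge_0. }
  destruct (Nat.le_gt_cases N n) as [H|H].
  - specialize (HN n H). rewrite Rminus_0_r, Rabs_right in HN by (apply Rle_ge, Cmod_ge_0).
    rewrite Cmod_inv by apply Hn.
    assert (T := Cmod_triangle_inv 1 (1 - u n)).
    replace (1 - (1 - u n))%C with (u n) in T by ring. rewrite Cmod_1 in T.
    assert (/ Cmod (u n) <= / (1 / 2)) by (apply Rinv_le_contravar; lra).
    specialize (S0 N). lra.
  - assert (T := sum_n_pos_incr (fun k => Cmod (/ u k)) n N (fun k => Cmod_ge_0 _)
      (Nat.lt_le_incl _ _ H)).
    assert (Cmod (/ u n) <= sum_n (fun k => Cmod (/ u k)) n).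
    { destruct n as [|n]; [rewrite sum_O; lra|]. rewrite sum_Sn.
      specialize (S0 n). unfold plus; simpl in *. lra. }
    lra.
Qed.

(** * The Jost solution at plus infinity *)

Section Jost.

Variables (a p q : Z -> C) (eps M : R).
Hypothesis ha : forall n, a n <> 0.
Hypothesis Heps : 0 < eps.
Hypothesis HM : forall n,
  Cmod (1 - a n) + Cmod (p n) + Cmod (q n) <= M * exp (- eps * IZR n).
Hypothesis HM' : forall n, Cmod (1 - a n) + Cmod (p n) + Cmod (q n) <= M.

Let E (n : Z) : R := exp (- eps * IZR n).
Let dl : R := exp (- eps).
(** A fourth root of [dl]: the recursion trades four steps in m for one step in n, and one step in n
    is worth [dl]. The hypotheses of the section decay only to the right, so that they can also be
    applied to reflected sequences. *)
Let th : R := exp (- eps / 4).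

Lemma M_nonneg : 0 <= M.
Proof.
  assert (T1 := Cmod_ge_0 (1 - a 0%Z)). assert (T2 := Cmod_ge_0 (p 0%Z)).
  assert (T3 := Cmod_ge_0 (q 0%Z)). specialize (HM' 0%Z). lra.
Qed.

Lemma E_pos n : 0 < E n.
Proof. apply exp_pos. Qed.

Lemma dl_bounds : 0 < dl < 1.
Proof.
  unfold dl. split; [apply exp_pos|]. rewrite <- exp_0. apply exp_increasing. lra.
Qed.

Lemma th_bounds : 0 < th < 1.
Proof.
  unfold th. split; [apply exp_pos|]. rewrite <- exp_0. apply exp_increasing. lra.
Qed.

Lemma th_pow4 : th ^ 4 = dl.
Proof. unfold th, dl. simpl. rewrite Rmult_1_r, <- !exp_plus. f_equal. field. Qed.

Lemma E_S n : E (n + 1) = E n * dl.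
Proof. unfold E, dl. rewrite <- exp_plus, plus_IZR. f_equal. ring. Qed.

Lemma E_add n k : E (n + Z.of_nat k) = E n * dl ^ k.
Proof.
  induction k as [|k IH].
  - rewrite Z.add_0_r. simpl. ring.
  - rewrite Nat2Z.inj_succ, <- Z.add_1_r, Z.add_assoc, E_S, IH. simpl. ring.
Qed.

Lemma E_antitone n k : (n <= k)%Z -> E k <= E n.
Proof.
  intros H. unfold E. apply exp_le_compat. apply IZR_le in H. nra.
Qed.

(** * Tail sums and coefficients of the recursion *)

Lemma sum_ge_summable n u V :
  (forall r, (n <= r)%Z -> Cmod (u r) <= V * E r) ->
  summable (fun k => u (n + Z.of_nat k)%Z).
Proof.
  intros Hu. assert (D := dl_bounds).
  apply summable_geom with (V * E n) dl; [lra|].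
  intros k. rewrite Rmult_assoc, <- E_add. apply Hu. lia.
Qed.

Lemma sum_ge_bound n u V :
  (forall r, (n <= r)%Z -> Cmod (u r) <= V * E r) ->
  Cmod (sum_ge n u) <= V * (E n / (1 - dl)).
Proof.
  intros Hu. assert (D := dl_bounds).
  replace (V * (E n / (1 - dl))) with (V * E n / (1 - dl)) by (field; lra).
  apply Csum_geom; [lra|].
  intros k. rewrite Rmult_assoc, <- E_add. apply Hu. lia.
Qed.

Lemma sum_ge_S n u V :
  (forall r, (n <= r)%Z -> Cmod (u r) <= V * E r) ->
  sum_ge n u = (u n + sum_ge (n + 1) u)%C.
Proof.
  intros Hu. unfold sum_ge. rewrite Csum_S by now apply sum_ge_summable with V.
  rewrite Z.add_0_r. f_equal. apply Csum_ext. intros k. f_equal. lia.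
Qed.

(** One constant for the three coefficients of the recursion: 2 + M bounds |1 + a|, and exp eps pays
    for the shifted index of a (n - 1) in [hcoef]. *)
Let M1 : R := M * (2 + M + exp eps).

Lemma M1_nonneg : 0 <= M1.
Proof. unfold M1. assert (T := M_nonneg). assert (T2 := exp_pos eps). nra. Qed.

Lemma sq_bound r : Cmod (1 - a r ^ 2) <= M1 * E r.
Proof.
  replace (1 - a r ^ 2)%C with ((1 - a r) * (2 - (1 - a r)))%C by ring.
  rewrite Cmod_mult.
  assert (T := Cmod_triangle_minus 2 (1 - a r)).
  rewrite Cmod_R, Rabs_right in T by lra.
  assert (H1 := HM r). assert (H2 := HM' r). fold (E r) in H1.
  assert (T1 := Cmod_ge_0 (1 - a r)). assert (T2 := Cmod_ge_0 (p r)).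
  assert (T3 := Cmod_ge_0 (q r)). assert (T4 := Cmod_ge_0 (2 - (1 - a r))).
  assert (P := E_pos r). assert (P2 := exp_pos eps). assert (P3 := M_nonneg).
  apply Rle_trans with (M * E r * (2 + M)).
  - apply Rmult_le_compat; lra.
  - unfold M1. assert (0 <= M * E r * exp eps) by (repeat apply Rmult_le_pos; lra). nra.
Qed.

Lemma hcoef_bound r : Cmod (hcoef a q r) <= M1 * E r.
Proof.
  unfold hcoef.
  replace (2 - a r - a (r - 1)%Z + q r)%C
    with ((1 - a r) + (1 - a (r - 1)%Z) + q r)%C by ring.
  assert (H := Cmod_triangle (1 - a r + (1 - a (r - 1)%Z)) (q r)).
  assert (H' := Cmod_triangle (1 - a r) (1 - a (r - 1)%Z)).
  assert (H1 := HM r). assert (H2 := HM (r - 1)%Z). fold (E r) in H1.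
  assert (T1 := Cmod_ge_0 (1 - a r)). assert (T2 := Cmod_ge_0 (p r)).
  assert (T3 := Cmod_ge_0 (q r)). assert (T4 := Cmod_ge_0 (1 - a (r - 1)%Z)).
  assert (T5 := Cmod_ge_0 (p (r - 1)%Z)). assert (T6 := Cmod_ge_0 (q (r - 1)%Z)).
  replace (exp (- eps * IZR (r - 1))) with (E r * exp eps) in H2.
  2:{ unfold E. rewrite <- exp_plus, minus_IZR. f_equal. ring. }
  assert (P := E_pos r). assert (P3 := M_nonneg).
  assert (0 <= M * M * E r) by (repeat apply Rmult_le_pos; lra).
  unfold M1. nra.
Qed.

Lemma p_bound r : Cmod (2 * p r) <= M1 * E r.
Proof.
  rewrite Cmod_mult, Cmod_R, Rabs_right by lra.
  assert (H1 := HM r). fold (E r) in H1.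
  assert (T1 := Cmod_ge_0 (1 - a r)). assert (T3 := Cmod_ge_0 (q r)).
  assert (P := E_pos r). assert (P2 := exp_pos eps). assert (P3 := M_nonneg).
  assert (0 <= M * E r) by nra. unfold M1.
  assert (0 <= M * M * E r) by (repeat apply Rmult_le_pos; lra).
  assert (0 <= M * E r * exp eps) by (repeat apply Rmult_le_pos; lra). nra.
Qed.

(* The weight absorbs the factors [1 + O(E n)] that the recursion
   [K_{n,m} -> K_{n-1,m+4}] produces at each step. *)
Let wt (n : Z) : R := exp (4 * M1 / (1 - dl) ^ 2 * E n).

Lemma wt_ge_1 n : 1 <= wt n.
Proof.
  unfold wt. rewrite <- exp_0 at 1. apply exp_le_compat.
  assert (D := dl_bounds). assert (T := M1_nonneg). assert (P := E_pos n).
  apply Rmult_le_pos; [|lra]. apply Rdiv_le_0_compat; [lra|]. apply pow_lt; lra.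
Qed.

Lemma wt_antitone n k : (n <= k)%Z -> wt k <= wt n.
Proof.
  intros H. unfold wt. apply exp_le_compat.
  assert (D := dl_bounds). assert (T := M1_nonneg).
  apply Rmult_le_compat_l; [|now apply E_antitone].
  apply Rdiv_le_0_compat; [lra|]. apply pow_lt; lra.
Qed.

(** After 1 + x <= exp x, comparing exponents leaves 2 dl - dl^2 <= 1, that is (1 - dl)^2 >= 0; the
    constant in [wt] is chosen for this. The 4 counts the four products in [Kterm]. *)
Lemma wt_step n : wt (n + 1) * (1 + 4 * M1 * (E (n + 1) / (1 - dl))) <= wt n.
Proof.
  assert (D := dl_bounds). assert (T := M1_nonneg). assert (P := E_pos n).
  apply Rle_trans with (wt (n + 1) * exp (4 * M1 * (E (n + 1) / (1 - dl)))).
  { apply Rmult_le_compat_l; [left; apply exp_pos | apply exp_ineq1_le]. }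
  unfold wt. rewrite <- exp_plus. apply exp_le_compat. rewrite E_S.
  set (c := 4 * M1 / (1 - dl) ^ 2).
  replace (4 * M1 * (E n * dl / (1 - dl))) with (c * (1 - dl) * E n * dl)
    by (unfold c; field; lra).
  assert (0 <= c * E n * ((1 - dl) * (1 - dl))).
  { apply Rmult_le_pos; [|nra]. apply Rmult_le_pos; [|lra].
    apply Rdiv_le_0_compat; [lra|]. apply pow_lt; lra. }
  nra.
Qed.

(** * Geometric decay of the kernel *)

Let K := Kplus a p q.

Let b1 : R := M1 / (1 - dl).

Lemma b1_nonneg : 0 <= b1.
Proof. unfold b1. assert (D := dl_bounds). apply Rdiv_le_0_compat; [apply M1_nonneg | lra]. Qed.

(** For the first four columns. The source 1 sums to b1 E; the part with be carries an extra factor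
    M1 E / (1 - dl), which the step of the weight from n + 1 to n absorbs, so be is passed on
    without loss. *)
Lemma base_bound u be n : 0 <= be ->
  (forall r, Cmod (u r) <= M1 * E r * (1 + be * (wt r * E r))) ->
  Cmod (sum_ge (n + 1) u) <= (b1 + be) * (wt n * E n).
Proof.
  intros Hbe Hu. assert (D := dl_bounds). assert (T := M1_nonneg).
  assert (P := E_pos n). assert (P1 := E_pos (n + 1)).
  assert (W := wt_ge_1 n). assert (W1 := wt_ge_1 (n + 1)).
  assert (Hs := wt_step n).
  assert (A := E_antitone n (n + 1) ltac:(lia)).
  assert (HS : Cmod (sum_ge (n + 1) u)
     <= M1 * (1 + be * (wt (n + 1) * E (n + 1))) * (E (n + 1) / (1 - dl))).
  { apply sum_ge_bound. intros r Hr. apply Rle_trans with (1 := Hu r).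
    assert (Pr := E_pos r). assert (Wr := wt_ge_1 r).
    assert (A1 := E_antitone _ _ Hr). assert (A2 := wt_antitone _ _ Hr).
    assert (X : wt r * E r <= wt (n + 1) * E (n + 1)) by (apply Rmult_le_compat; lra).
    replace (M1 * (1 + be * (wt (n + 1) * E (n + 1))) * E r)
      with (M1 * E r * (1 + be * (wt (n + 1) * E (n + 1)))) by ring.
    apply Rmult_le_compat_l; [nra|]. nra. }
  apply Rle_trans with (1 := HS).
  replace (M1 * (1 + be * (wt (n + 1) * E (n + 1))) * (E (n + 1) / (1 - dl)))
    with (b1 * E (n + 1) + be * ((wt (n + 1) * (M1 * (E (n + 1) / (1 - dl)))) * E (n + 1)))
    by (unfold b1; field; lra).
  assert (B := b1_nonneg).
  set (x := M1 * (E (n + 1) / (1 - dl))) in *.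
  assert (X0 : 0 <= x).
  { unfold x. apply Rmult_le_pos; [lra|]. apply Rdiv_le_0_compat; lra. }
  replace (4 * M1 * (E (n + 1) / (1 - dl))) with (4 * x) in Hs by (unfold x; ring).
  assert (Q : wt (n + 1) * x <= wt n) by nra.
  assert (Q2 : wt (n + 1) * x * E (n + 1) <= wt n * E n).
  { apply Rmult_le_compat; try lra. apply Rmult_le_pos; lra. }
  assert (Q3 : E (n + 1) <= wt n * E n) by nra.
  nra.
Qed.

Lemma K1_eq n : K 1 n = (2 * sum_ge (n + 1) p)%C.
Proof. reflexivity. Qed.

Lemma K2_eq n : K 2 n = sum_ge (n + 1) (fun r => hcoef a q r + 2 * p r * K 1 r)%C.
Proof. reflexivity. Qed.

Lemma K3_eq n : K 3 n = sum_ge (n + 1) (fun r =>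
  hcoef a q r * K 1 r + 2 * p r * (K 2 r + 1))%C.
Proof. reflexivity. Qed.

Lemma K4_eq n : K 4 n = sum_ge (n + 1) (fun r =>
  (1 - a r ^ 2) + hcoef a q r * K 2 r + 2 * p r * (K 3 r + K 1 r))%C.
Proof. reflexivity. Qed.

Definition Kterm (m : nat) (r : Z) : C :=
  ((1 - a r ^ 2) * K (S m) (r + 1)%Z + hcoef a q r * K (S (S (S m))) r
    + 2 * p r * (K (S (S m)) r + K (S (S (S (S m)))) r))%C.

Lemma K5_eq m n : K (5 + m) n = (K (S m) (n + 1)%Z + sum_ge (n + 1) (Kterm m))%C.
Proof. reflexivity. Qed.

Lemma Kterm_bound B m : 0 <= B ->
  (forall j, (1 <= j <= 4)%nat ->
     forall n, Cmod (K (j + m) n) <= B * (wt n * E n) * th ^ m) ->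
  forall n r, (n <= r)%Z -> Cmod (Kterm m r) <= 4 * M1 * (B * (wt n * E n) * th ^ m) * E r.
Proof.
  intros HB HK n r Hr.
  assert (T := M1_nonneg). assert (Pr := E_pos r). assert (Wr := wt_ge_1 r).
  assert (A1 := E_antitone _ _ Hr). assert (A2 := wt_antitone _ _ Hr).
  assert (Hth : 0 <= th ^ m) by (apply pow_le; left; apply th_bounds).
  set (X := B * (wt n * E n) * th ^ m).
  assert (G : forall k, (n <= k)%Z -> B * (wt k * E k) * th ^ m <= X).
  { intros k Hk. unfold X. apply Rmult_le_compat_r; [exact Hth|].
    apply Rmult_le_compat_l; [exact HB|].
    assert (Wk := wt_ge_1 k). assert (Pk := E_pos k).
    apply Rmult_le_compat; try lra; [now apply wt_antitone | now apply E_antitone]. }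
  assert (L1 := Rle_trans _ _ _ (HK 1%nat ltac:(lia) (r + 1)%Z) (G (r + 1)%Z ltac:(lia))).
  assert (L2 := Rle_trans _ _ _ (HK 2%nat ltac:(lia) r) (G r Hr)).
  assert (L3 := Rle_trans _ _ _ (HK 3%nat ltac:(lia) r) (G r Hr)).
  assert (L4 := Rle_trans _ _ _ (HK 4%nat ltac:(lia) r) (G r Hr)).
  assert (Y : forall x y, Cmod x <= M1 * E r -> Cmod y <= X -> Cmod (x * y) <= M1 * E r * X).
  { intros x y Hx Hy. rewrite Cmod_mult. apply Rmult_le_compat; trivial; apply Cmod_ge_0. }
  unfold Kterm. rewrite Cmult_plus_distr_l.
  assert (Y1 := Y _ _ (sq_bound r) L1). assert (Y2 := Y _ _ (p_bound r) L2).
  assert (Y3 := Y _ _ (hcoef_bound r) L3). assert (Y4 := Y _ _ (p_bound r) L4).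
  simpl in Y1, Y2, Y3, Y4.
  eapply Rle_trans; [apply Cmod_triangle|].
  apply Rle_trans with ((M1 * E r * X + M1 * E r * X) + (M1 * E r * X + M1 * E r * X)); [|right; ring].
  apply Rplus_le_compat; (eapply Rle_trans; [apply Cmod_triangle|]); apply Rplus_le_compat; assumption.
Qed.

(** Induction on m. In the recursion the values at n + 1 supply E (n + 1) = E n th^4, and the tail
    sum multiplies by 1 + 4 M1 E (n + 1) / (1 - dl), which turns wt (n + 1) into at most wt n. Hence
    B does not change from step to step. *)
Lemma K_bound_exists : exists B, 0 <= B /\
  forall m, (1 <= m)%nat -> forall n, Cmod (K m n) <= B * (wt n * E n) * th ^ m.
Proof.
  assert (D := dl_bounds). assert (T := M1_nonneg). assert (B1 := b1_nonneg).
  assert (TH := th_bounds).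
  assert (X0 : forall n, 0 < wt n * E n).
  { intros n. assert (W := wt_ge_1 n). assert (P := E_pos n). nra. }
  assert (Y : forall r x y be, Cmod x <= M1 * E r -> Cmod y <= be * (wt r * E r) ->
    Cmod (x * y) <= M1 * E r * (be * (wt r * E r))).
  { intros r x y be Hx Hy. rewrite Cmod_mult. apply Rmult_le_compat; trivial; apply Cmod_ge_0. }
  assert (H1 : forall n, Cmod (K 1 n) <= b1 * (wt n * E n)).
  { intros n. rewrite K1_eq.
    replace (2 * sum_ge (n + 1) p)%C with (sum_ge (n + 1) (fun r => 2 * p r)%C).
    - replace b1 with (b1 + 0) by ring. apply base_bound; [lra|].
      intros r. rewrite Rmult_0_l, Rplus_0_r, Rmult_1_r. apply p_bound.
    - unfold sum_ge. apply Csum_scal. apply sum_ge_summable with (M1).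
      intros r _. apply Rle_trans with (2 := p_bound r).
      rewrite Cmod_mult, Cmod_R, Rabs_right by lra. assert (Q := Cmod_ge_0 (p r)). lra. }
  assert (H2 : forall n, Cmod (K 2 n) <= (2 * b1) * (wt n * E n)).
  { intros n. rewrite K2_eq. replace (2 * b1) with (b1 + b1) by ring.
    apply base_bound; [lra|]. intros r. eapply Rle_trans; [apply Cmod_triangle|].
    rewrite Rmult_plus_distr_l, Rmult_1_r.
    apply Rplus_le_compat; [apply hcoef_bound|]. apply Y; [apply p_bound | apply H1]. }
  assert (H3 : forall n, Cmod (K 3 n) <= (4 * b1) * (wt n * E n)).
  { intros n. rewrite K3_eq. replace (4 * b1) with (b1 + 3 * b1) by ring.
    apply base_bound; [lra|]. intros r. rewrite Cmult_plus_distr_l, Cmult_1_r.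
    assert (Z1 := Y r _ _ _ (hcoef_bound r) (H1 r)).
    assert (Z2 := Y r _ _ _ (p_bound r) (H2 r)). assert (Z3 := p_bound r).
    eapply Rle_trans; [apply Cmod_triangle|].
    eapply Rle_trans; [apply Rplus_le_compat_l, Cmod_triangle|]. lra. }
  assert (H4 : forall n, Cmod (K 4 n) <= (8 * b1) * (wt n * E n)).
  { intros n. rewrite K4_eq. replace (8 * b1) with (b1 + 7 * b1) by ring.
    apply base_bound; [lra|]. intros r. rewrite Cmult_plus_distr_l.
    assert (Z0 := sq_bound r).
    assert (Z1 := Y r _ _ _ (hcoef_bound r) (H2 r)).
    assert (Z2 := Y r _ _ _ (p_bound r) (H3 r)).
    assert (Z3 := Y r _ _ _ (p_bound r) (H1 r)).
    eapply Rle_trans; [apply Cmod_triangle|].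
    eapply Rle_trans; [apply Rplus_le_compat; apply Cmod_triangle|]. lra. }
  (* 8 b1 dominates the constants of the first four columns, and th^(-4) makes up for th^j with j <=
     4. *)
  set (B := 8 * b1 / th ^ 4).
  assert (P4 : forall k, 0 < th ^ k) by (intros k; apply pow_lt; lra).
  assert (HB : 0 <= B) by (unfold B; apply Rdiv_le_0_compat; [lra | apply P4]).
  assert (Base : forall x n j, (j <= 4)%nat -> 0 <= x <= 8 * b1 ->
     x * (wt n * E n) <= B * (wt n * E n) * th ^ j).
  { intros x n j Hj Hx. replace (B * (wt n * E n) * th ^ j)
      with (8 * b1 * (th ^ j / th ^ 4) * (wt n * E n))
      by (unfold B; field; lra).
    apply Rmult_le_compat_r; [left; apply X0|].
    assert (1 <= th ^ j / th ^ 4).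
    { apply Rle_div_r; [apply P4|]. rewrite Rmult_1_l.
      replace 4%nat with (j + (4 - j))%nat by lia. rewrite pow_add.
      assert (th ^ (4 - j) <= 1) by (rewrite <- (pow1 (4 - j)); apply pow_incr; lra).
      specialize (P4 j). nra. }
    nra. }
  clearbody B. exists B. split; [exact HB|].
  (* A window of four consecutive columns is carried along, since the next column involves all
     four. *)
  assert (Ind : forall m, forall j, (1 <= j <= 4)%nat -> forall n,
    Cmod (K (j + m) n) <= B * (wt n * E n) * th ^ (j + m)).
  { induction m as [|m IH].
    - intros j Hj n. rewrite Nat.add_0_r.
      destruct j as [|[|[|[|[|j]]]]]; try lia;
        [ apply Rle_trans with (1 := H1 n) | apply Rle_trans with (1 := H2 n)
        | apply Rle_trans with (1 := H3 n) | apply Rle_trans with (1 := H4 n) ];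
        apply Base; try lia; lra.
    - intros j Hj n. destruct (Nat.eq_dec j 4) as [->|Hj4].
      + replace (4 + S m)%nat with (5 + m)%nat by lia.
        rewrite K5_eq.
        (* As j >= 1, one factor th can be taken from each column of the window; with the th^4
           gained from E (n + 1) this makes up th^(5 + m). *)
        assert (TB : forall j, (1 <= j <= 4)%nat -> forall n,
          Cmod (K (j + m) n) <= B * th * (wt n * E n) * th ^ m).
        { intros i Hi k. apply Rle_trans with (1 := IH i Hi k).
          rewrite pow_add.
          assert (th ^ i <= th).
          { destruct i as [|i]; [lia|]. simpl.
            assert (th ^ i <= 1) by (rewrite <- (pow1 i); apply pow_incr; lra). nra. }
          specialize (X0 k). specialize (P4 m).
          replace (B * (wt k * E k) * (th ^ i * th ^ m))
            with (B * (wt k * E k) * th ^ m * th ^ i) by ring.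
          replace (B * th * (wt k * E k) * th ^ m)
            with (B * (wt k * E k) * th ^ m * th) by ring.
          apply Rmult_le_compat_l; [|assumption].
          apply Rmult_le_pos; [apply Rmult_le_pos|]; lra. }
        assert (S1 := TB 1%nat ltac:(lia) (n + 1)%Z).
        assert (S2 := sum_ge_bound (n + 1)%Z (Kterm m) _
          (Kterm_bound (B * th) m ltac:(nra) TB (n + 1)%Z)).
        eapply Rle_trans; [apply Cmod_triangle|].
        apply Rle_trans with (1 := Rplus_le_compat _ _ _ _ S1 S2).
        set (X := B * th * th ^ m).
        assert (HX : 0 <= X) by (unfold X; specialize (P4 m); repeat apply Rmult_le_pos; lra).
        apply Rle_trans
          with (X * E (n + 1) * (wt (n + 1) * (1 + 4 * M1 * (E (n + 1) / (1 - dl)))));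
          [right; unfold X; ring|].
        replace (B * (wt n * E n) * th ^ (5 + m)) with (X * E (n + 1) * wt n).
        2:{ rewrite E_S, <- th_pow4. unfold X. rewrite pow_add. simpl. ring. }
        apply Rmult_le_compat_l; [|apply wt_step].
        assert (P := E_pos (n + 1)). nra.
      + replace (j + S m)%nat with (S j + m)%nat by lia. apply IH. lia. }
  intros m Hm n. destruct (Nat.le_gt_cases m 4) as [H|H].
  - rewrite <- (Nat.add_0_r m). apply (Ind O). lia.
  - replace m with (4 + (m - 4))%nat by lia. apply Ind. lia.
Qed.

Lemma K_geom : exists ka : Z -> R,
  (forall n, 0 <= ka n) /\ (forall n k, (n <= k)%Z -> ka k <= ka n) /\
  is_lim_seq (fun n => ka (Z.of_nat n)) 0 /\
  forall m, (1 <= m)%nat -> forall n, Cmod (K m n) <= ka n * th ^ m.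
Proof.
  destruct K_bound_exists as [B [HB HK]].
  assert (X0 : forall n, 0 < wt n * E n).
  { intros n. assert (W := wt_ge_1 n). assert (P := E_pos n). nra. }
  exists (fun n => B * (wt n * E n)). repeat split.
  - intros n. specialize (X0 n). nra.
  - intros n k H. apply Rmult_le_compat_l; [exact HB|].
    assert (W := wt_ge_1 k). assert (P := E_pos k).
    apply Rmult_le_compat; try lra; [now apply wt_antitone | now apply E_antitone].
  - apply is_lim_seq_le_le with (fun _ => 0) (fun n => B * wt 0 * dl ^ n).
    + intros n. specialize (X0 (Z.of_nat n)). split; [nra|].
      assert (Q := E_add 0 n). rewrite Z.add_0_l in Q.
      assert (Q0 : E 0 = 1) by (unfold E; rewrite Rmult_0_r; apply exp_0).
      rewrite Q0, Rmult_1_l in Q. rewrite <- Q.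
      assert (A := wt_antitone 0 (Z.of_nat n) ltac:(lia)).
      assert (P := E_pos (Z.of_nat n)). rewrite Rmult_assoc.
      apply Rmult_le_compat_l; [exact HB|]. nra.
    + apply is_lim_seq_const.
    + replace (Finite 0) with (Rbar_mult (B * wt 0) 0) by (simpl; f_equal; ring).
      apply is_lim_seq_scal_l, is_lim_seq_geom. assert (D := dl_bounds). rewrite Rabs_right; lra.
  - exact HK.
Qed.

(** Index 0 is included: the value 1 of [Kplus] there is the constant term of the Jost series, so
    that 1 + sum becomes a single power series. *)
Lemma K_geom_all n : exists k, forall m, Cmod (K m n) <= k * th ^ m.
Proof.
  destruct K_geom as [ka [Hk [_ [_ HK]]]]. exists (ka n + 1). intros m.
  assert (P : 0 < th ^ m) by (apply pow_lt, th_bounds).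
  destruct m as [|m].
  - simpl. unfold K. simpl. rewrite Cmod_1. specialize (Hk n). lra.
  - apply Rle_trans with (1 := HK (S m) ltac:(lia) n). nra.
Qed.

(** * Difference equations for the kernel and its generating series *)

Lemma K_diff1 n : (K 1 (n - 1)%Z - K 1 n)%C = (2 * p n)%C.
Proof.
  rewrite !K1_eq, Z.sub_add. rewrite (sum_ge_S n p M1).
  - ring.
  - intros r _. apply Rle_trans with (2 := p_bound r).
    rewrite Cmod_mult, Cmod_R, Rabs_right by lra. assert (Q := Cmod_ge_0 (p r)). lra.
Qed.

Lemma K_le_const n : exists k, 0 <= k /\ forall m r, (n <= r)%Z -> Cmod (K m r) <= k.
Proof.
  destruct K_geom as [ka [Hk [Ha [_ HK]]]]. exists (ka n + 1).
  split; [specialize (Hk n); lra|]. intros m r Hr.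
  assert (H1 := Hk n). assert (H2 := Hk r). assert (H3 := Ha n r Hr).
  destruct m as [|m].
  - unfold K. simpl. rewrite Cmod_1. lra.
  - apply Rle_trans with (1 := HK (S m) ltac:(lia) r).
    assert (th ^ S m <= 1) by (rewrite <- (pow1 (S m)); apply pow_incr; assert (T := th_bounds); lra).
    assert (0 < th ^ S m) by (apply pow_lt, th_bounds). nra.
Qed.

Lemma coef_mul_bound k r x y :
  Cmod x <= M1 * E r -> Cmod y <= k -> Cmod (x * y) <= M1 * E r * k.
Proof.
  intros Hx Hy. rewrite Cmod_mult. apply Rmult_le_compat; trivial; apply Cmod_ge_0.
Qed.

Lemma K_diff2 n : (K 2 (n - 1)%Z - K 2 n)%C = (hcoef a q n + 2 * p n * K 1 n)%C.
Proof.
  destruct (K_le_const n) as [k [Hk0 Hk]].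
  rewrite !K2_eq, Z.sub_add.
  rewrite (sum_ge_S n _ (M1 * (1 + k))); [ring|].
  intros r Hr. eapply Rle_trans; [apply Cmod_triangle|].
  assert (T1 := hcoef_bound r).
  assert (T2 := coef_mul_bound k r _ _ (p_bound r) (Hk 1%nat r Hr)). nra.
Qed.

Lemma K_diff3 n : (K 3 (n - 1)%Z - K 3 n)%C
  = (hcoef a q n * K 1 n + 2 * p n * (K 2 n + 1))%C.
Proof.
  destruct (K_le_const n) as [k [Hk0 Hk]].
  rewrite !K3_eq, Z.sub_add.
  rewrite (sum_ge_S n _ (M1 * (1 + 2 * k))); [ring|].
  intros r Hr. rewrite Cmult_plus_distr_l, Cmult_1_r.
  eapply Rle_trans; [apply Cmod_triangle|].
  eapply Rle_trans; [apply Rplus_le_compat_l, Cmod_triangle|].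
  assert (T1 := coef_mul_bound k r _ _ (hcoef_bound r) (Hk 1%nat r Hr)).
  assert (T2 := coef_mul_bound k r _ _ (p_bound r) (Hk 2%nat r Hr)).
  assert (T3 := p_bound r). nra.
Qed.

(** Reading K_0 as 1 makes the fourth column an instance of the general recursion. In the general
    case the difference of the leading terms combines with (1 - a_n^2) K_{n+1,m} to leave -a_n^2
    K_{n+1,m}. *)
Lemma K_diff4 m n : (K (4 + m) (n - 1)%Z - K (4 + m) n)%C
  = (K m n - a n ^ 2 * K m (n + 1)%Z + hcoef a q n * K (2 + m) n
     + 2 * p n * (K (1 + m) n + K (3 + m) n))%C.
Proof.
  destruct (K_le_const n) as [k [Hk0 Hk]].
  destruct m as [|m].
  - change (4 + 0)%nat with 4%nat. rewrite !K4_eq, Z.sub_add.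
    rewrite (sum_ge_S n _ (M1 * (1 + 3 * k))).
    + change (K 0 n) with (RtoC 1). change (K 0 (n + 1)%Z) with (RtoC 1). simpl. ring.
    + intros r Hr. rewrite Cmult_plus_distr_l.
      eapply Rle_trans; [apply Cmod_triangle|].
      eapply Rle_trans; [apply Rplus_le_compat; apply Cmod_triangle|].
      assert (T0 := sq_bound r).
      assert (T1 := coef_mul_bound k r _ _ (hcoef_bound r) (Hk 2%nat r Hr)).
      assert (T2 := coef_mul_bound k r _ _ (p_bound r) (Hk 3%nat r Hr)).
      assert (T3 := coef_mul_bound k r _ _ (p_bound r) (Hk 1%nat r Hr)). nra.
  - replace (4 + S m)%nat with (5 + m)%nat by lia.
    rewrite !K5_eq, Z.sub_add.
    rewrite (sum_ge_S n _ (M1 * (4 * k))).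
    + unfold Kterm. simpl. ring.
    + intros r Hr. unfold Kterm. rewrite Cmult_plus_distr_l.
      eapply Rle_trans; [apply Cmod_triangle|].
      eapply Rle_trans; [apply Rplus_le_compat; apply Cmod_triangle|].
      assert (T0 := coef_mul_bound k r _ _ (sq_bound r) (Hk (S m) (r + 1)%Z ltac:(lia))).
      assert (T1 := coef_mul_bound k r _ _ (hcoef_bound r) (Hk (S (S (S m))) r Hr)).
      assert (T2 := coef_mul_bound k r _ _ (p_bound r) (Hk (S (S m)) r Hr)).
      assert (T3 := coef_mul_bound k r _ _ (p_bound r) (Hk (S (S (S (S m)))) r Hr)). nra.
Qed.

(** The Jost solution stripped of alpha^+_n and exp (i n z), as a function of w. *)
Definition Fplus (n : Z) (w : C) : C := pseval (fun m => K m n) w.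

(** The difference equations of the columns, multiplied by w^m and summed. The coefficients of 1, w,
    w^2, w^3 are peeled off because their equations are irregular; from w^4 on [K_diff4] covers all
    of them. *)
Lemma Fplus_equation n w : Cmod w * th < 1 ->
  (Fplus (n - 1) w - Fplus n w)%C
  = (w ^ 4 * (Fplus n w - a n ^ 2 * Fplus (n + 1) w)
     + (hcoef a q n * w ^ 2 + 2 * p n * (w + w ^ 3)) * Fplus n w)%C.
Proof.
  intros Hw. assert (T := th_bounds). assert (T0 : 0 <= th) by lra.
  destruct (K_geom_all (n - 1)%Z) as [k0 H0].
  destruct (K_geom_all n) as [k1 H1].
  destruct (K_geom_all (n + 1)%Z) as [k2 H2].
  assert (Hs : forall j k (c : nat -> C), (forall m, Cmod (c m) <= k * th ^ m) ->
    forall m, Cmod (c (j + m)%nat) <= k * th ^ j * th ^ m).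
  { intros j k c Hc m. rewrite Rmult_assoc, <- pow_add. apply Hc. }
  set (X := fun j => pseval (fun m => K (j + m) n) w).
  assert (XS : forall j, X j = (K j n + w * X (S j))%C).
  { intros j. unfold X.
    rewrite (pseval_S _ _ _ w T0 (Hs j k1 _ H1) Hw), Nat.add_0_r.
    f_equal. f_equal. f_equal. apply functional_extensionality. intros m.
    f_equal. lia. }
  set (D := fun m => (K m (n - 1)%Z + (- (1)) * K m n)%C).
  assert (HD : forall m, Cmod (D m) <= (k0 + k1) * th ^ m).
  { intros m. unfold D. eapply Rle_trans; [apply Cmod_triangle|].
    rewrite Cmod_mult, Cmod_opp, Cmod_1, Rmult_1_l, Rmult_plus_distr_r.
    now apply Rplus_le_compat. }
  assert (Sm : forall j k (c : nat -> C), (forall m, Cmod (c m) <= k * th ^ m) ->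
    summable (fun m => c (j + m)%nat * w ^ m)%C).
  { intros j k c Hc. apply (pseval_summable (fun m => c (j + m)%nat) (k * th ^ j) th); trivial.
    now apply Hs. }
  assert (ED : (Fplus (n - 1) w - Fplus n w)%C = pseval D w).
  { unfold Fplus, pseval.
    rewrite (Csum_ext (fun m => D m * w ^ m)%C
      (fun m => K m (n - 1)%Z * w ^ m + (- (1)) * (K m n * w ^ m))%C)
      by (intros m; unfold D; ring).
    rewrite Csum_plus, Csum_scal; [ring | | |].
    - apply (Sm O _ _ H1).
    - apply (Sm O _ _ H0).
    - apply summable_scal, (Sm O _ _ H1). }
  assert (HD1 := Hs 1%nat _ _ HD). assert (HD2 := Hs 2%nat _ _ HD).
  assert (HD3 := Hs 3%nat _ _ HD).
  rewrite ED, (pseval_S _ _ _ w T0 HD Hw),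
    (pseval_S (fun m => D (S m)) _ _ w T0 HD1 Hw),
    (pseval_S (fun m => D (S (S m))) _ _ w T0 HD2 Hw),
    (pseval_S (fun m => D (S (S (S m)))) _ _ w T0 HD3 Hw).
  assert (E4 : pseval (fun m => D (S (S (S (S m))))) w
    = (X O - a n ^ 2 * Fplus (n + 1) w + hcoef a q n * X 2%nat
       + 2 * p n * (X 1%nat + X 3%nat))%C).
  { unfold pseval at 1.
    assert (R0 : summable (fun m => K m n * w ^ m)%C) by exact (Sm O _ _ H1).
    assert (R0' : summable (fun m => K m (n + 1)%Z * w ^ m)%C) by exact (Sm O _ _ H2).
    assert (R1 : summable (fun m => K (1 + m) n * w ^ m)%C) by exact (Sm 1%nat _ _ H1).
    assert (R2 : summable (fun m => K (2 + m) n * w ^ m)%C) by exact (Sm 2%nat _ _ H1).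
    assert (R3 : summable (fun m => K (3 + m) n * w ^ m)%C) by exact (Sm 3%nat _ _ H1).
    rewrite (Csum_ext _ (fun m => (K m n * w ^ m + (- a n ^ 2) * (K m (n + 1)%Z * w ^ m))
      + (hcoef a q n * (K (2 + m) n * w ^ m)
         + (2 * p n) * (K (1 + m) n * w ^ m + K (3 + m) n * w ^ m)))%C).
    - assert (R13 := summable_plus _ _ R1 R3).
      rewrite (Csum_plus _ _ (summable_plus _ _ R0 (summable_scal (- a n ^ 2) _ R0'))
          (summable_plus _ _ (summable_scal (hcoef a q n) _ R2)
            (summable_scal (2 * p n) _ R13))),
        (Csum_plus _ _ R0 (summable_scal (- a n ^ 2) _ R0')), (Csum_scal _ _ R0'),
        (Csum_plus _ _ (summable_scal (hcoef a q n) _ R2) (summable_scal (2 * p n) _ R13)),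
        (Csum_scal _ _ R2), (Csum_scal _ _ R13), (Csum_plus _ _ R1 R3).
      unfold X, Fplus, pseval. simpl. ring.
    - intros m.
      replace (D (S (S (S (S m))))) with (K (4 + m) (n - 1)%Z - K (4 + m) n)%C
        by (unfold D; simpl; ring).
      rewrite K_diff4. simpl. ring. }
  cbv beta. rewrite E4.
  replace (D O) with (RtoC 0) by (unfold D; change (RtoC 0 = RtoC 1 + - RtoC 1 * RtoC 1)%C; ring).
  replace (D 1%nat) with (2 * p n)%C by (rewrite <- K_diff1; unfold D; ring).
  replace (D 2%nat) with (hcoef a q n + 2 * p n * K 1 n)%C by (rewrite <- K_diff2; unfold D; ring).
  replace (D 3%nat) with (hcoef a q n * K 1 n + 2 * p n * (K 2 n + 1))%C
    by (rewrite <- K_diff3; unfold D; ring).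
  change (Fplus n w) with (X O).
  rewrite (XS O), (XS 1%nat), (XS 2%nat). change (K 0 n) with (RtoC 1). ring.
Qed.

(** * The normalizing factors alpha^+ *)

Lemma prod_geom n k : Cmod (1 - a (n + Z.of_nat k)%Z) <= M * E n * dl ^ k.
Proof.
  rewrite Rmult_assoc, <- E_add. apply Rle_trans with (2 := HM _).
  assert (T1 := Cmod_ge_0 (p (n + Z.of_nat k)%Z)).
  assert (T2 := Cmod_ge_0 (q (n + Z.of_nat k)%Z)). lra.
Qed.

Lemma prod_ge_neq_0 n : prod_ge n a <> 0.
Proof.
  destruct (inv_bounded dl _ _ dl_bounds (prod_geom n) (fun k => ha _)) as [W HW].
  apply Cmod_gt_0.
  apply Rlt_le_trans with (2 := Cprod_lower _ _ _ _ dl_bounds (prod_geom n) (fun k => ha _) HW).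
  apply exp_pos.
Qed.

Lemma prod_ge_S n : prod_ge n a = (a n * prod_ge (n + 1) a)%C.
Proof.
  assert (L := Cprod_converges _ _ dl_bounds _ (prod_geom n)).
  assert (L1 := Cprod_converges _ _ dl_bounds _ (prod_geom (n + 1))).
  unfold prod_ge at 1, Cprod.
  apply Clim_unique. apply is_lim_seq_incr_1.
  apply is_lim_seq_ext with (fun N => Cmod (a n)
    * Cmod (Cprod_upto (fun k => a (n + 1 + Z.of_nat k)%Z) N - prod_ge (n + 1) a)).
  - intros N. rewrite Cprod_upto_S, Z.add_0_r, <- Cmod_mult. f_equal.
    replace (fun k => a (n + Z.of_nat (S k))%Z) with (fun k => a (n + 1 + Z.of_nat k)%Z).
    + ring.
    + apply functional_extensionality. intros k. f_equal. lia.
  - replace (Finite 0) with (Rbar_mult (Cmod (a n)) 0) by (simpl; f_equal; ring).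
    apply is_lim_seq_scal_l. exact L1.
Qed.

(** For n >= 0 the bound M dl^k and the bound W on the inverses, taken from index 0 on, serve all
    tails at once. *)
Lemma prod_ge_bounds : exists A, 0 < A /\
  forall n, (0 <= n)%Z -> / A <= Cmod (prod_ge n a) <= A.
Proof.
  assert (D := dl_bounds).
  destruct (inv_bounded dl _ _ dl_bounds (prod_geom 0) (fun k => ha _)) as [W HW].
  assert (HW0 : 0 <= W) by (apply Rle_trans with (2 := HW O), Cmod_ge_0).
  assert (HM0 := M_nonneg).
  assert (G : forall n, (0 <= n)%Z -> forall k, Cmod (1 - a (n + Z.of_nat k)%Z) <= M * dl ^ k).
  { intros n Hn k. apply Rle_trans with (1 := prod_geom n k).
    assert (A := E_antitone 0 n Hn).
    assert (Q0 : E 0 = 1) by (unfold E; rewrite Rmult_0_r; apply exp_0).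
    rewrite Q0 in A. assert (0 < dl ^ k) by (apply pow_lt; lra).
    apply Rmult_le_compat_r; [lra|]. nra. }
  set (x := M / (1 - dl)). set (y := W * M / (1 - dl)).
  assert (Hx : 0 <= x) by (unfold x; apply Rdiv_le_0_compat; lra).
  assert (Hy : 0 <= y) by (unfold y; apply Rdiv_le_0_compat; nra).
  exists (exp (x + y)). split; [apply exp_pos|].
  intros n Hn. split.
  - apply Rle_trans with (exp (- y)).
    + rewrite <- exp_Ropp. apply exp_le_compat. lra.
    + apply (Cprod_lower dl M W); trivial.
      * now apply G.
      * intros k. replace (n + Z.of_nat k)%Z with (0 + Z.of_nat (Z.to_nat n + k))%Z by lia.
        apply HW.
  - apply Rle_trans with (exp x); [|apply exp_le_compat; lra].
    apply (Cprod_upper dl M); [lra|]. now apply G.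
Qed.

Lemma sgnZ_S n : sgnZ (n + 1) = (- sgnZ n)%C.
Proof.
  unfold sgnZ. rewrite Z.even_add. simpl. destruct (Z.even n); simpl; ring.
Qed.

Lemma alpha_plus_S n : alpha_plus a (n + 1) = (- a n * alpha_plus a n)%C.
Proof.
  unfold alpha_plus. rewrite sgnZ_S, (prod_ge_S n). field. split; [apply prod_ge_neq_0 | apply ha].
Qed.

Lemma Cmod_sgnZ n : Cmod (sgnZ n) = 1.
Proof. unfold sgnZ. destruct Z.even; [apply Cmod_1 | rewrite Cmod_opp; apply Cmod_1]. Qed.

Lemma Cmod_alpha_plus n : Cmod (alpha_plus a n) = / Cmod (prod_ge n a).
Proof.
  unfold alpha_plus. rewrite Cmod_mult, Cmod_sgnZ, Rmult_1_l.
  apply Cmod_inv, prod_ge_neq_0.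
Qed.

Lemma alpha_plus_neq_0 n : alpha_plus a n <> 0.
Proof.
  apply Cmod_gt_0. rewrite Cmod_alpha_plus.
  apply Rinv_0_lt_compat, Cmod_gt_0, prod_ge_neq_0.
Qed.

(** * The Jost solution as a function of z *)

Definition uw (z : C) : C := Cexp (Ci * z / 2).

Lemma Cmod_uw z : Cmod (uw z) = exp (- Im z / 2).
Proof.
  unfold uw. rewrite Cmod_Cexp. f_equal.
  unfold Cdiv, Cinv, Cmult, Ci, Re, Im; simpl. field.
Qed.

Lemma Cmod_uw_le_1 z : 0 <= Im z -> Cmod (uw z) <= 1.
Proof. intros H. rewrite Cmod_uw, <- exp_0. apply exp_le_compat. lra. Qed.

Lemma uw_th z : 0 <= Im z -> Cmod (uw z) * th < 1.
Proof.
  intros H. assert (T := th_bounds). assert (T1 := Cmod_uw_le_1 z H).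
  assert (T2 := Cmod_ge_0 (uw z)). nra.
Qed.

Lemma jost_plus_eq z n : 0 <= Im z ->
  jost_plus a p q z n = (alpha_plus a n * Cexp (Ci * IZR n * z) * Fplus n (uw z))%C.
Proof.
  intros Hz. unfold jost_plus. f_equal. unfold Fplus, pseval.
  destruct (K_geom_all n) as [k Hk]. assert (T := th_bounds).
  rewrite (Csum_S (fun k => K k n * uw z ^ k)%C).
  - change (K 0 n) with (RtoC 1). simpl (_ ^ 0)%C. rewrite Cmult_1_r. f_equal.
    apply Csum_ext. intros j. unfold uw. rewrite <- Cexp_nat. unfold K.
    f_equal. f_equal. unfold Cdiv. ring.
  - apply pseval_summable with k th; [lra | exact Hk | now apply uw_th].
Qed.

Lemma Cexp_int_S z n :
  Cexp (Ci * IZR (n + 1) * z) = (Cexp (Ci * IZR n * z) * uw z ^ 2)%C.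
Proof.
  unfold uw. simpl. rewrite Cmult_1_r, <- !Cexp_plus. f_equal.
  rewrite plus_IZR, RtoC_plus. field.
Qed.

Lemma lam_uw z : lam z = (uw z + / uw z)%C.
Proof.
  unfold lam, Ccos, uw. rewrite <- Cexp_opp.
  replace (Ci * (z / 2))%C with (Ci * z / 2)%C by (field).
  field.
Qed.

(** With lam = w + 1/w, alpha^+_{n+1} = -a_n alpha^+_n and a factor w^2 per step in n, the equation
    L f = 0 is [Fplus_equation] up to a common factor. *)
Lemma jost_plus_solution z n : 0 <= Im z ->
  Lop a p q (lam z) (jost_plus a p q z) n = 0.
Proof.
  intros Hz. unfold Lop, fwd_diff. rewrite Z.add_simpl_r, Z.sub_add.
  rewrite !jost_plus_eq by exact Hz.
  assert (E1 := Cexp_int_S z n). assert (E0 := Cexp_int_S z (n - 1)).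
  rewrite Z.sub_add in E0. rewrite E1, E0.
  assert (A1 := alpha_plus_S n). assert (A0 := alpha_plus_S (n - 1)).
  rewrite Z.sub_add in A0. rewrite A1, A0, lam_uw.
  assert (F := Fplus_equation n (uw z) (uw_th z Hz)).
  assert (Hu : uw z <> 0) by apply Cexp_neq_0.
  assert (F' : Fplus (n - 1) (uw z) = (Fplus n (uw z) + (Fplus (n - 1) (uw z) - Fplus n (uw z)))%C) by ring.
  rewrite F', F. unfold hcoef.
  generalize (Fplus n (uw z)) (Fplus (n + 1) (uw z)) (Cexp (Ci * IZR (n - 1) * z)) (alpha_plus a (n - 1)).
  intros f f1 e al. field. exact Hu.
Qed.

(** Uniform over the closed unit disc; upper and lower bounds on the Jost solution as n tends to
    infinity both rest on it. *)
Lemma Fplus_close : exists d : nat -> R, is_lim_seq d 0 /\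
  forall w, Cmod w <= 1 -> forall n, Cmod (Fplus (Z.of_nat n) w - 1) <= d n.
Proof.
  destruct K_geom as [ka [Hk [Ha [Hl HK]]]]. assert (T := th_bounds).
  exists (fun n => ka (Z.of_nat n) * (th / (1 - th))). split.
  - replace (Finite 0) with (Rbar_mult 0 (th / (1 - th))) by (simpl; f_equal; ring).
    now apply is_lim_seq_scal_r.
  - intros w Hw n. unfold Fplus.
    destruct (K_geom_all (Z.of_nat n)) as [k Hkk].
    assert (Hw0 := Cmod_ge_0 w).
    rewrite (pseval_S _ k th); [| lra | exact Hkk | nra].
    cbv beta. change (K 0 (Z.of_nat n)) with (RtoC 1).
    replace (1 + w * pseval (fun k => K (S k) (Z.of_nat n)) w - 1)%C
      with (w * pseval (fun k => K (S k) (Z.of_nat n)) w)%C by ring.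
    rewrite Cmod_mult.
    assert (B : Cmod (pseval (fun k => K (S k) (Z.of_nat n)) w)
      <= ka (Z.of_nat n) * th / (1 - th)).
    { apply Csum_geom; [lra|]. intros j. rewrite Cmod_mult, Cmod_pow.
      assert (H := HK (S j) ltac:(lia) (Z.of_nat n)). simpl pow in H.
      assert (0 <= Cmod w ^ j <= 1).
      { split; [now apply pow_le|]. rewrite <- (pow1 j). now apply pow_incr. }
      assert (T2 := Cmod_ge_0 (K (S j) (Z.of_nat n))). nra. }
    assert (T2 := Cmod_ge_0 (pseval (fun k => K (S k) (Z.of_nat n)) w)).
    replace (ka (Z.of_nat n) * (th / (1 - th))) with (ka (Z.of_nat n) * th / (1 - th))
      by (field; lra). nra.
Qed.

Lemma Cmod_Cexp_int z n : Cmod (Cexp (Ci * IZR n * z)) = exp (- IZR n * Im z).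
Proof.
  rewrite Cmod_Cexp. f_equal. unfold Cmult, Ci, Re, Im; simpl. ring.
Qed.

Lemma jost_plus_bounded : exists B, forall z, 0 <= Im z ->
  forall n : nat, Cmod (jost_plus a p q z (Z.of_nat n)) <= B.
Proof.
  destruct prod_ge_bounds as [A [HA0 HA]]. destruct Fplus_close as [d [Hd HF]].
  destruct (is_lim_seq_0_bounded (fun n => Rabs (d n))) as [D HD].
  { intros n. apply Rabs_pos. }
  { now apply (is_lim_seq_abs_0 d). }
  exists (A * (1 + D)). intros z Hz n. rewrite jost_plus_eq by exact Hz.
  rewrite !Cmod_mult, Cmod_alpha_plus, Cmod_Cexp_int.
  destruct (HA (Z.of_nat n) ltac:(lia)) as [A1 A2].
  assert (P := Rinv_0_lt_compat _ HA0).
  assert (Q : / Cmod (prod_ge (Z.of_nat n) a) <= A).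
  { rewrite <- (Rinv_inv A). now apply Rinv_le_contravar. }
  assert (Q2 : exp (- IZR (Z.of_nat n) * Im z) <= 1).
  { rewrite <- exp_0. apply exp_le_compat.
    assert (0 <= IZR (Z.of_nat n)) by (apply IZR_le; lia). nra. }
  assert (Q3 : Cmod (Fplus (Z.of_nat n) (uw z)) <= 1 + D).
  { assert (T := HF _ (Cmod_uw_le_1 z Hz) n).
    assert (T2 := Cmod_triangle_inv (Fplus (Z.of_nat n) (uw z)) 1).
    rewrite Cmod_1 in T2. assert (T3 := Rle_abs (d n)). specialize (HD n). lra. }
  apply Rmult_le_compat; [| apply Cmod_ge_0 | | exact Q3].
  - apply Rmult_le_pos; left; [apply Rinv_0_lt_compat; lra | apply exp_pos].
  - rewrite <- (Rmult_1_r A). apply Rmult_le_compat; try lra.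
    + left; apply Rinv_0_lt_compat; lra.
    + left; apply exp_pos.
Qed.

(** On the real axis |exp (i n z)| = 1, so the modulus is governed by alpha^+_n and by [Fplus],
    which tends to 1. *)
Lemma jost_plus_away z : Im z = 0 -> exists c N, 0 < c /\
  forall n : nat, (N <= n)%nat -> c <= Cmod (jost_plus a p q z (Z.of_nat n)).
Proof.
  intros Hz.
  destruct prod_ge_bounds as [A [HA0 HA]]. destruct Fplus_close as [d [Hd HF]].
  destruct (proj2 (is_lim_seq_spec _ 0) Hd (mkposreal (1 / 2) ltac:(lra))) as [N HN].
  simpl in HN. exists (/ A * (1 / 2)), N.
  assert (P := Rinv_0_lt_compat _ HA0).
  split; [lra|]. intros n Hn. rewrite jost_plus_eq by lra.
  rewrite !Cmod_mult, Cmod_alpha_plus, Cmod_Cexp_int, Hz, Rmult_0_r, exp_0, Rmult_1_r.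
  destruct (HA (Z.of_nat n) ltac:(lia)) as [A1 A2].
  specialize (HN n Hn). rewrite Rminus_0_r in HN.
  apply Rmult_le_compat; try lra.
  - apply Rinv_le_contravar; lra.
  - assert (T := HF _ (Cmod_uw_le_1 z ltac:(lra)) n).
    assert (T2 := Cmod_triangle_inv 1 (1 - Fplus (Z.of_nat n) (uw z))).
    replace (1 - (1 - Fplus (Z.of_nat n) (uw z)))%C with (Fplus (Z.of_nat n) (uw z)) in T2 by ring.
    rewrite Cmod_minus_sym, Cmod_1 in T2. assert (T3 := Rle_abs (d n)). lra.
Qed.

(** Here n may be negative, when exp (i n z) grows with Im z; hence the bounded strip. *)
Lemma jost_plus_local_bound n : exists B, forall z, 0 <= Im z <= 1 ->
  Cmod (jost_plus a p q z n) <= B.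
Proof.
  destruct (K_geom_all n) as [k Hk]. assert (T := th_bounds).
  exists (Cmod (alpha_plus a n) * exp (Rabs (IZR n)) * (k / (1 - th))).
  intros z Hz. rewrite jost_plus_eq by lra.
  rewrite !Cmod_mult, Cmod_Cexp_int.
  assert (T1 := Cmod_uw_le_1 z ltac:(lra)). assert (T0 := Cmod_ge_0 (uw z)).
  apply Rmult_le_compat; try apply Cmod_ge_0.
  - apply Rmult_le_pos; [apply Cmod_ge_0 | left; apply exp_pos].
  - apply Rmult_le_compat_l; [apply Cmod_ge_0|]. apply exp_le_compat.
    apply Rle_trans with (1 := Rle_abs _). rewrite Rabs_mult, Rabs_Ropp, (Rabs_right (Im z)) by lra.
    assert (T2 := Rabs_pos (IZR n)). nra.
  - apply Csum_geom; [lra|]. intros j. rewrite Cmod_mult, Cmod_pow.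
    assert (0 <= Cmod (uw z) ^ j <= 1).
    { split; [now apply pow_le|]. rewrite <- (pow1 j). now apply pow_incr. }
    specialize (Hk j). assert (T2 := Cmod_ge_0 (K j n)). nra.
Qed.

End Jost.


(** * Reflection of the index *)

(** a_n belongs to the edge between n and n + 1, so reflection of the vertices shifts its index by
    one. *)
Definition refl_a (a : Z -> C) (n : Z) : C := a (- n - 1)%Z.
Definition refl (y : Z -> C) (n : Z) : C := y (- n)%Z.

Lemma sum_le_refl n u : sum_le n u = sum_ge (- n) (refl u).
Proof. unfold sum_le, sum_ge. apply Csum_ext. intros k. unfold refl. f_equal. lia. Qed.

Lemma hcoef_refl a q n : hcoef a q n = hcoef (refl_a a) (refl q) (- n).
Proof.
  unfold hcoef, refl_a, refl.
  replace (- - n - 1)%Z with (n - 1)%Z by lia. replace (- (- n - 1) - 1)%Z with n by lia.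
  rewrite Z.opp_involutive. ring.
Qed.

Lemma Kminus_refl a p q m n :
  Kminus a p q m n = Kplus (refl_a a) (refl p) (refl q) m (- n).
Proof.
  set (P := fun m => forall n,
    Kminus a p q m n = Kplus (refl_a a) (refl p) (refl q) m (- n)).
  assert (S0 : forall n u, sum_le (n - 1) u = sum_ge (- n + 1) (refl u)).
  { intros k u. rewrite sum_le_refl. f_equal. lia. }
  assert (SE : forall n u v, (forall r, u r = v (- r)%Z) ->
    sum_le (n - 1) u = sum_ge (- n + 1) v).
  { intros k u v H. rewrite S0. f_equal. apply functional_extensionality.
    intros r. unfold refl. rewrite H. f_equal. lia. }
  assert (A : forall r, refl_a a (- r) = a (r - 1)%Z).
  { intros r. unfold refl_a. f_equal. lia. }
  assert (Rp : forall r, refl p (- r) = p r).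
  { intros r. unfold refl. f_equal. lia. }
  assert (P1 : P 1%nat).
  { intros k. simpl. f_equal. apply SE. intros r. now rewrite Rp. }
  assert (P2 : P 2%nat).
  { intros k. change (sum_le (k - 1) (fun r => hcoef a q r + 2 * p r * Kminus a p q 1 r)%C
      = sum_ge (- k + 1) (fun r => hcoef (refl_a a) (refl q) r
          + 2 * refl p r * Kplus (refl_a a) (refl p) (refl q) 1 r)%C).
    apply SE. intros r. now rewrite <- hcoef_refl, Rp, P1. }
  assert (P3 : P 3%nat).
  { intros k. change (sum_le (k - 1) (fun r => hcoef a q r * Kminus a p q 1 r
        + 2 * p r * (Kminus a p q 2 r + 1))%C
      = sum_ge (- k + 1) (fun r => hcoef (refl_a a) (refl q) r
          * Kplus (refl_a a) (refl p) (refl q) 1 r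
          + 2 * refl p r * (Kplus (refl_a a) (refl p) (refl q) 2 r + 1))%C).
    apply SE. intros r. now rewrite <- hcoef_refl, Rp, P1, P2. }
  assert (P4 : P 4%nat).
  { intros k. change (sum_le (k - 1) (fun r => (1 - a (r - 1)%Z ^ 2)
        + hcoef a q r * Kminus a p q 2 r
        + 2 * p r * (Kminus a p q 3 r + Kminus a p q 1 r))%C
      = sum_ge (- k + 1) (fun r => (1 - refl_a a r ^ 2) + hcoef (refl_a a) (refl q) r
          * Kplus (refl_a a) (refl p) (refl q) 2 r
          + 2 * refl p r * (Kplus (refl_a a) (refl p) (refl q) 3 r
             + Kplus (refl_a a) (refl p) (refl q) 1 r))%C).
    apply SE. intros r. now rewrite <- hcoef_refl, Rp, P1, P2, P3, A. }
  (* Column m + 5 refers to columns m + 1 to m + 4, and the columns up to 4 are separate base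
     cases. *)
  assert (G : forall m, P m /\ P (S m) /\ P (S (S m)) /\ P (S (S (S m))) /\ P (S (S (S (S m))))).
  { clear m. induction m as [|m (I0 & I1 & I2 & I3 & I4)].
    - split; [intros k; reflexivity | now repeat (split; [assumption|])].
    - do 4 (split; [assumption|]). intros k.
      change (Kminus a p q (S m) (k - 1)%Z + sum_le (k - 1) (fun r =>
          (1 - a (r - 1)%Z ^ 2) * Kminus a p q (S m) (r - 1)%Z
          + hcoef a q r * Kminus a p q (S (S (S m))) r
          + 2 * p r * (Kminus a p q (S (S m)) r + Kminus a p q (S (S (S (S m)))) r))
        = Kplus (refl_a a) (refl p) (refl q) (S m) (- k + 1)%Z + sum_ge (- k + 1) (fun r =>
          (1 - refl_a a r ^ 2) * Kplus (refl_a a) (refl p) (refl q) (S m) (r + 1)%Z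
          + hcoef (refl_a a) (refl q) r * Kplus (refl_a a) (refl p) (refl q) (S (S (S m))) r
          + 2 * refl p r * (Kplus (refl_a a) (refl p) (refl q) (S (S m)) r
             + Kplus (refl_a a) (refl p) (refl q) (S (S (S (S m)))) r)))%C.
      f_equal.
      + rewrite I1. f_equal. lia.
      + apply SE. intros r. rewrite <- hcoef_refl, Rp, I1, I2, I3, I4, A.
        do 4 f_equal. lia. }
  exact (proj1 (G m) n).
Qed.

Lemma sgnZ_opp n : sgnZ (- n) = sgnZ n.
Proof. unfold sgnZ. now rewrite Z.even_opp. Qed.

Lemma jost_minus_refl a p q z n :
  jost_minus a p q z n = jost_plus (refl_a a) (refl p) (refl q) z (- n).
Proof.
  unfold jost_minus, jost_plus. f_equal; [f_equal|].
  - unfold alpha_minus, alpha_plus. rewrite sgnZ_opp. do 2 f_equal.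
    unfold prod_le, prod_ge. f_equal. apply functional_extensionality. intros k.
    unfold refl_a. f_equal. lia.
  - f_equal. rewrite opp_IZR, RtoC_opp. ring.
  - f_equal. apply Csum_ext. intros k. now rewrite Kminus_refl.
Qed.

Lemma Lop_refl a p q l y n :
  Lop (refl_a a) (refl p) (refl q) l (refl y) n = Lop a p q l y (- n).
Proof.
  unfold Lop, fwd_diff, refl, refl_a.
  rewrite !Z.add_simpl_r, !Z.sub_add.
  replace (- (n - 1) - 1)%Z with (- n)%Z by lia.
  replace (- (n + 1))%Z with (- n - 1)%Z by lia.
  replace (- (n - 1))%Z with (- n + 1)%Z by lia. ring.
Qed.

Lemma wronskian_refl a u v n :
  wronskian (refl_a a) (refl u) (refl v) n = (- wronskian a u v (- n - 1))%C.
Proof.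
  unfold wronskian, refl, refl_a. rewrite Z.sub_add.
  replace (- (n + 1))%Z with (- n - 1)%Z by lia. ring.
Qed.

Lemma ell2_refl y : ell2 y -> ell2 (refl y).
Proof.
  intros [H1 H2]. split; trivial.
  unfold refl. refine (ex_series_ext _ _ _ H1). intros n. now rewrite Z.opp_involutive.
Qed.

(** * Wronskians *)

(** The discrete Green identity. It yields both the constancy of Wronskians of solutions and their
    jump at a source. *)
Lemma wronskian_step a p q l u v n :
  (wronskian a u v n - wronskian a u v (n - 1))%C
  = (u n * Lop a p q l v n - v n * Lop a p q l u n)%C.
Proof.
  unfold wronskian, Lop, fwd_diff. rewrite !Z.add_simpl_r, !Z.sub_add. ring.
Qed.

Lemma wronskian_antisym a u v n : wronskian a u v n = (- wronskian a v u n)%C.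
Proof. unfold wronskian. ring. Qed.

(** The three-term relation between 2 x 2 minors. With f and g the two Jost solutions, it expresses
    y_n Phi through the Wronskians of y with them. *)
Lemma wronskian_plucker a f g y n :
  (y n * wronskian a f g n + f n * wronskian a g y n + g n * wronskian a y f n = 0)%C.
Proof. unfold wronskian. ring. Qed.

Lemma Z_const_ge (f : Z -> C) k : (forall n, (k < n)%Z -> f n = f (n - 1)%Z) ->
  forall n, (k <= n)%Z -> f n = f k.
Proof.
  intros H n Hn. replace n with (k + Z.of_nat (Z.to_nat (n - k)))%Z by lia.
  generalize (Z.to_nat (n - k)) as j. clear n Hn.
  induction j as [|j IH]; [f_equal; lia|].
  rewrite H by lia. rewrite <- IH. f_equal. lia.
Qed.

Lemma ell2_lim y : ell2 y -> is_lim_seq (fun n => Cmod (y (Z.of_nat n))) 0.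
Proof.
  intros [H _]. apply ex_series_lim_0 in H.
  apply is_lim_seq_ext with (fun n => sqrt (Cmod (y (Z.of_nat n)) ^ 2)).
  - intros n. apply sqrt_pow2, Cmod_ge_0.
  - rewrite <- sqrt_0. apply is_lim_seq_continuous; [|exact H].
    apply continuity_pt_sqrt. lra.
Qed.

(** To the right of k the Wronskian is constant, and it tends to 0 because y does while a and f are
    bounded. The equation for y is asked only beyond k, so that columns of the resolvent kernel
    qualify. *)
Lemma wronskian_zero_right a p q l y f k A B :
  (forall n, Cmod (a n) <= A) -> ell2 y ->
  (forall n, (k < n)%Z -> Lop a p q l y n = 0) ->
  (forall n, Lop a p q l f n = 0) ->
  (forall n : nat, Cmod (f (Z.of_nat n)) <= B) ->
  forall n, (k <= n)%Z -> wronskian a y f n = 0.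
Proof.
  intros HA Hy Ly Lf HB.
  assert (Hc : forall n, (k <= n)%Z -> wronskian a y f n = wronskian a y f k).
  { apply Z_const_ge. intros n Hn.
    assert (Hs := wronskian_step a p q l y f n).
    rewrite Ly, Lf in Hs by exact Hn.
    replace (wronskian a y f n) with
      ((wronskian a y f n - wronskian a y f (n - 1)) + wronskian a y f (n - 1))%C by ring.
    rewrite Hs. ring. }
  intros n Hn. rewrite (Hc n Hn). apply Cmod_eq_0.
  apply Rle_antisym; [|apply Cmod_ge_0].
  set (N := Z.to_nat (Z.max k 0)).
  assert (Ll := ell2_lim y Hy).
  assert (L1 := proj1 (is_lim_seq_incr_n _ N _) Ll).
  assert (L2 := proj1 (is_lim_seq_incr_n _ (S N) _) Ll).
  assert (L := is_lim_seq_scal_l _ (A * B) _ (is_lim_seq_plus' _ _ _ _ L1 L2)).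
  simpl in L. replace (A * B * (0 + 0)) with 0 in L by ring.
  refine (is_lim_seq_le (fun _ => Cmod (wronskian a y f k)) _ _ 0 _ (is_lim_seq_const _) L).
  intros j. cbv beta.
  rewrite <- (Hc (Z.of_nat (j + N))%Z) by (unfold N; lia).
  unfold wronskian. rewrite Cmod_mult.
  replace (Z.of_nat (j + N) + 1)%Z with (Z.of_nat (j + S N)) by lia.
  rewrite Rmult_assoc. apply Rmult_le_compat; try apply Cmod_ge_0; [apply HA|].
  eapply Rle_trans; [apply Cmod_triangle_minus|]. rewrite !Cmod_mult.
  assert (B1 := HB (j + N)%nat). assert (B2 := HB (j + S N)%nat).
  assert (T1 := Cmod_ge_0 (y (Z.of_nat (j + N)))).
  assert (T2 := Cmod_ge_0 (y (Z.of_nat (j + S N)))). nra.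
Qed.

Lemma wronskian_zero_left a p q l y f k A B :
  (forall n, Cmod (a n) <= A) -> ell2 y ->
  (forall n, (n < k)%Z -> Lop a p q l y n = 0) ->
  (forall n, Lop a p q l f n = 0) ->
  (forall n : nat, Cmod (f (- Z.of_nat n)%Z) <= B) ->
  forall n, (n < k)%Z -> wronskian a y f n = 0.
Proof.
  intros HA Hy Ly Lf HB n Hn.
  assert (H := wronskian_zero_right (refl_a a) (refl p) (refl q) l (refl y) (refl f) (- k) A B).
  replace (wronskian a y f n) with (- wronskian (refl_a a) (refl y) (refl f) (- n - 1))%C.
  - rewrite H; try lia; trivial.
    + ring.
    + intros j. apply HA.
    + now apply ell2_refl.
    + intros j Hj. rewrite Lop_refl. apply Ly. lia.
    + intros j. rewrite Lop_refl. apply Lf.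
  - rewrite wronskian_refl. replace (- (- n - 1) - 1)%Z with n by lia. ring.
Qed.

(** * The map [z -> lam z] *)

(** The roots of w^2 - l w + 1 have product 1, so one of them lies in the closed unit disc; z is -2
    i times its logarithm. *)
Lemma lam_surjective l : exists z, 0 <= Im z /\ - PI <= Re z <= 3 * PI /\ lam z = l.
Proof.
  destruct (Csqrt_exists (l * l - 4)) as [s Hs].
  assert (E : exists w, (w * w - l * w + 1 = 0)%C /\ Cmod w <= 1).
  { assert (H1 : ((l + s) / 2 * ((l - s) / 2) = 1)%C).
    { transitivity ((l * l - s * s) / 4)%C; [field | rewrite Hs; field]. }
    assert (Q : forall w, (w = (l + s) / 2 \/ w = (l - s) / 2 -> w * w - l * w + 1 = 0)%C).
    { intros w [-> | ->]; rewrite <- H1; field. }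
    assert (H2 := f_equal Cmod H1). rewrite Cmod_mult, Cmod_1 in H2.
    destruct (Rle_dec (Cmod ((l + s) / 2)) 1) as [H|H].
    - exists ((l + s) / 2)%C. split; [apply Q; now left | exact H].
    - exists ((l - s) / 2)%C. split; [apply Q; now right|].
      assert (T := Cmod_ge_0 ((l - s) / 2)). nra. }
  destruct E as [w [Hw Hw1]].
  assert (Hw0 : w <> 0).
  { intros ->. apply C1_nz. rewrite <- Hw. ring. }
  destruct (Clog_exists w Hw0) as [x [Hx Hb]].
  exists (- (2 * (Ci * x)))%C.
  assert (Er : Re (- (2 * (Ci * x)))%C = 2 * Im x)
    by (unfold Copp, Cmult, Ci, Re, Im; simpl; ring).
  assert (Ei : Im (- (2 * (Ci * x)))%C = - 2 * Re x)
    by (unfold Copp, Cmult, Ci, Re, Im; simpl; ring).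
  assert (U : uw (- (2 * (Ci * x)))%C = w).
  { rewrite <- Hx. unfold uw. f_equal.
    replace (Ci * - (2 * (Ci * x)) / 2)%C with (- (Ci * Ci) * x)%C by field.
    replace (Ci * Ci)%C with (- (1))%C by (unfold Cmult, Copp, Ci, RtoC; simpl; f_equal; ring). ring. }
  assert (P := PI_RGT_0).
  split; [|split].
  - rewrite Ei. rewrite <- Hx, Cmod_Cexp in Hw1.
    assert (Re x <= 0); [|lra].
    apply Rnot_lt_le. intros H. apply exp_increasing in H. rewrite exp_0 in H. lra.
  - rewrite Er. lra.
  - rewrite lam_uw, U.
    replace (w + / w)%C with (((w * w - l * w + 1) + l * w) / w)%C by (field; exact Hw0).
    rewrite Hw. field. exact Hw0.
Qed.

(** * Products of power series *)

(** Each of the n + 1 terms is at most k1 k2 exp (-s n). Half of the rate absorbs the factor n + 1,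
    since (n + 1) exp (-s n / 2) <= 1 + 2/s. *)
Lemma Cconv_geom u v k1 k2 s :  0 < s ->
  (forall n, Cmod (u n) <= k1 * exp (- s) ^ n) ->
  (forall n, Cmod (v n) <= k2 * exp (- s) ^ n) ->
  forall n, Cmod (Cconv u v n) <= k1 * k2 * (1 + 2 / s) * exp (- (s / 2)) ^ n.
Proof.
  intros Hs Hu Hv n.
  assert (Hk1 : 0 <= k1) by (specialize (Hu O); assert (T := Cmod_ge_0 (u O)); simpl in Hu; lra).
  assert (Hk2 : 0 <= k2) by (specialize (Hv O); assert (T := Cmod_ge_0 (v O)); simpl in Hv; lra).
  assert (P : 0 < exp (- s)) by apply exp_pos.
  assert (B : forall m, (m <= n)%nat ->
    Cmod (sum_n (fun k => u k * v (n - k)%nat)%C m) <= INR (S m) * (k1 * k2 * exp (- s) ^ n)).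
  { assert (T : forall m, (m <= n)%nat -> Cmod (u m * v (n - m)%nat) <= k1 * k2 * exp (- s) ^ n).
    { intros m Hm. replace n with (m + (n - m))%nat at 2 by lia. rewrite pow_add, Cmod_mult.
      apply Rle_trans with ((k1 * exp (- s) ^ m) * (k2 * exp (- s) ^ (n - m)));
        [apply Rmult_le_compat; try apply Cmod_ge_0; [apply Hu | apply Hv] | right; ring]. }
    induction m as [|m IH]; intros Hm.
    - rewrite sum_O. simpl INR. rewrite Rmult_1_l. now apply T.
    - rewrite sum_Sn, S_INR, Rmult_plus_distr_r, Rmult_1_l.
      eapply Rle_trans; [apply Cmod_triangle|].
      apply Rplus_le_compat; [apply IH; lia | now apply T]. }
  apply Rle_trans with (1 := B n (Nat.le_refl n)).
  assert (E : exp (- s) ^ n = exp (- (s / 2)) ^ n * exp (- (s / 2)) ^ n).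
  { rewrite <- Rpow_mult_distr, <- exp_plus. do 2 f_equal. field. }
  assert (P2 : 0 < exp (- (s / 2)) ^ n) by (apply pow_lt, exp_pos).
  assert (Q : INR (S n) * exp (- (s / 2)) ^ n <= 1 + 2 / s).
  { rewrite S_INR.
    assert (Ep : exp (- (s / 2)) ^ n = / exp (INR n * (s / 2))).
    { rewrite <- exp_Ropp. clear. induction n as [|n IH].
      - simpl. rewrite Rmult_0_l, Ropp_0, exp_0. reflexivity.
      - rewrite S_INR. simpl. rewrite IH, <- exp_plus. f_equal. ring. }
    rewrite Ep. set (x := INR n * (s / 2)).
    assert (X0 : 0 <= x) by (unfold x; apply Rmult_le_pos; [apply pos_INR | lra]).
    assert (X1 := exp_ineq1_le x).
    apply Rle_div_l; [apply exp_pos|].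
    replace (INR n) with (2 / s * x) by (unfold x; field; lra).
    assert (0 < 2 / s) by (apply Rdiv_lt_0_compat; lra). nra. }
  rewrite E.
  replace (INR (S n) * (k1 * k2 * (exp (- (s / 2)) ^ n * exp (- (s / 2)) ^ n)))
    with (k1 * k2 * (INR (S n) * exp (- (s / 2)) ^ n) * exp (- (s / 2)) ^ n) by ring.
  apply Rmult_le_compat_r; [lra|]. apply Rmult_le_compat_l; [nra | exact Q].
Qed.

Lemma pseval_Cconv u v w : summable (fun k => u k * w ^ k)%C ->
  summable (fun k => v k * w ^ k)%C ->
  pseval (Cconv u v) w = (pseval u w * pseval v w)%C.
Proof.
  intros Hu Hv. unfold pseval. rewrite <- Csum_Cconv by assumption.
  apply Csum_ext. intros n. unfold Cconv.
  assert (G : forall m, (m <= n)%nat ->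
    (sum_n (fun k => u k * v (n - k)%nat)%C m * w ^ n
    = sum_n (fun k => u k * w ^ k * (v (n - k)%nat * w ^ (n - k)))%C m)%C).
  { assert (T : forall m, (m <= n)%nat -> (u m * v (n - m)%nat * w ^ n
      = u m * w ^ m * (v (n - m)%nat * w ^ (n - m)))%C).
    { intros m Hm. replace n with (m + (n - m))%nat at 2 by lia. rewrite Cpow_add_r. ring. }
    induction m as [|m IH]; intros Hm.
    - rewrite !sum_O. now apply T.
    - rewrite !sum_Sn, <- IH by lia. rewrite <- T by exact Hm.
      apply Cmult_plus_distr_r. }
  now apply G.
Qed.

(** [lin_mul 1 0] is multiplication by w. *)
Lemma shift_geom h k r : 0 < r -> (forall n, Cmod (h n) <= k * r ^ n) ->
  forall n, Cmod (lin_mul 1 0 h n) <= k / r * r ^ n.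
Proof.
  intros Hr Hh n.
  assert (Hk : 0 <= k) by (specialize (Hh O); assert (T := Cmod_ge_0 (h O)); simpl in Hh; lra).
  destruct n as [|n]; simpl lin_mul.
  - rewrite Cmult_0_l, Cmod_0. simpl. rewrite Rmult_1_r. apply Rdiv_le_0_compat; lra.
  - rewrite Cmult_0_l, Cplus_0_r, Cmult_1_l.
    replace (k / r * r ^ S n) with (k * r ^ n) by (simpl; field; lra). apply Hh.
Qed.


(** * Zeros of [Phi] *)

Section Phi.

Variables (a p q : Z -> C) (eps M : R).
Hypothesis ha : forall n, a n <> 0.
Hypothesis Heps : 0 < eps.
Hypothesis HM : forall n,
  Cmod (1 - a n) + Cmod (p n) + Cmod (q n) <= M * exp (- eps * IZR n).
Hypothesis HM' : forall n, Cmod (1 - a n) + Cmod (p n) + Cmod (q n) <= M.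
Hypothesis HN : forall n, Cmod (1 - refl_a a n) + Cmod (refl p n) + Cmod (refl q n)
  <= M * exp (- eps * IZR n).
Hypothesis HN' : forall n,
  Cmod (1 - refl_a a n) + Cmod (refl p n) + Cmod (refl q n) <= M.

Let ha' : forall n, refl_a a n <> 0.
Proof. intros n. apply ha. Qed.

Let Sol := jost_plus_solution a p q eps M ha Heps HM HM'.
Let Sol' := jost_plus_solution (refl_a a) (refl p) (refl q) eps M ha' Heps HN HN'.

Lemma jost_minus_solution z n : 0 <= Im z ->
  Lop a p q (lam z) (jost_minus a p q z) n = 0.
Proof.
  intros Hz. rewrite <- (Z.opp_involutive n), <- Lop_refl.
  rewrite <- (Sol' z (- n)%Z Hz). f_equal. apply functional_extensionality.
  intros k. change (jost_minus a p q z (- k) = jost_plus (refl_a a) (refl p) (refl q) z k).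
  now rewrite jost_minus_refl, Z.opp_involutive.
Qed.

Lemma jost_minus_bounded : exists B, forall z, 0 <= Im z ->
  forall n : nat, Cmod (jost_minus a p q z (- Z.of_nat n)) <= B.
Proof.
  destruct (jost_plus_bounded (refl_a a) (refl p) (refl q) eps M ha' Heps HN HN') as [B HB].
  exists B. intros z Hz n. rewrite jost_minus_refl, Z.opp_involutive. now apply HB.
Qed.

Lemma jost_minus_local_bound n : exists B, forall z, 0 <= Im z <= 1 ->
  Cmod (jost_minus a p q z n) <= B.
Proof.
  destruct (jost_plus_local_bound (refl_a a) (refl p) (refl q) eps M Heps HN HN' (- n)%Z) as [B HB].
  exists B. intros z Hz. rewrite jost_minus_refl. now apply HB.
Qed.

Lemma a_bounded n : Cmod (a n) <= 1 + M.
Proof.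
  assert (T := Cmod_triangle_minus 1 (1 - a n)).
  replace (1 - (1 - a n))%C with (a n) in T by ring. rewrite Cmod_1 in T.
  assert (T2 := HM' n). assert (T3 := Cmod_ge_0 (p n)). assert (T4 := Cmod_ge_0 (q n)). lra.
Qed.

(** * Square-summable solutions and the vanishing of Phi *)

Lemma wronskian_jost_right z y k : 0 <= Im z -> ell2 y ->
  (forall n, (k < n)%Z -> Lop a p q (lam z) y n = 0) ->
  forall n, (k <= n)%Z -> wronskian a y (jost_plus a p q z) n = 0.
Proof.
  intros Hz Hy HL.
  destruct (jost_plus_bounded a p q eps M ha Heps HM HM') as [B HB].
  apply wronskian_zero_right with p q (lam z) (1 + M) B; trivial.
  - apply a_bounded.
  - intros n. now apply Sol.
  - intros n. now apply HB.
Qed.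

Lemma wronskian_jost_left z y k : 0 <= Im z -> ell2 y ->
  (forall n, (n < k)%Z -> Lop a p q (lam z) y n = 0) ->
  forall n, (n < k)%Z -> wronskian a y (jost_minus a p q z) n = 0.
Proof.
  intros Hz Hy HL. destruct jost_minus_bounded as [B HB].
  apply wronskian_zero_left with p q (lam z) (1 + M) B; trivial.
  - apply a_bounded.
  - intros n. now apply jost_minus_solution.
  - intros n. now apply HB.
Qed.

Lemma Phi_wronskian z n : 0 <= Im z ->
  wronskian a (jost_minus a p q z) (jost_plus a p q z) n = Phi a p q z.
Proof.
  intros Hz. unfold Phi.
  set (W := wronskian a (jost_minus a p q z) (jost_plus a p q z)).
  assert (H : forall n, W n = W (n - 1)%Z).
  { intros m. assert (E := wronskian_step a p q (lam z) (jost_minus a p q z) (jost_plus a p q z) m).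
    rewrite (Sol z m Hz), (jost_minus_solution z m Hz) in E. fold W in E.
    replace (W m) with ((W m - W (m - 1)%Z) + W (m - 1)%Z)%C by ring. rewrite E. ring. }
  destruct (Z.le_ge_cases 0 n) as [H0|H0].
  - apply Z_const_ge; [intros; apply H | exact H0].
  - symmetry. apply Z_const_ge; [intros; apply H | exact H0].
Qed.

Lemma Phi_zero_of_solution z y n : 0 <= Im z -> ell2 y ->
  (forall n, Lop a p q (lam z) y n = 0) -> y n <> 0 -> Phi a p q z = 0.
Proof.
  intros Hz Hy HL Hn.
  assert (E := wronskian_plucker a (jost_minus a p q z) (jost_plus a p q z) y n).
  rewrite (Phi_wronskian z n Hz), (wronskian_antisym a (jost_plus a p q z) y),
    (wronskian_jost_right z y n Hz Hy (fun m _ => HL m) n (Z.le_refl n)),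
    (wronskian_jost_left z y (n + 1) Hz Hy (fun m _ => HL m) n) in E by lia.
  destruct (Ceq_dec (Phi a p q z) 0) as [H|H]; [exact H|].
  exfalso. apply (Cmult_neq_0 _ _ Hn H). rewrite <- E. ring.
Qed.

(** The equation at n + 1 can be solved for y_n because a_n is nonzero, so zeros propagate to the
    left. *)
Lemma solution_zero_of_tail l y N : (forall n, Lop a p q l y n = 0) ->
  (forall n, (N <= n)%Z -> y n = 0) -> forall n, y n = 0.
Proof.
  intros HL HN0.
  assert (G : forall j n, (N - Z.of_nat j <= n)%Z -> y n = 0).
  { induction j as [|j IH]; intros n Hn; [apply HN0; lia|].
    assert (H := HL (n + 1)%Z). unfold Lop, fwd_diff in H.
    rewrite !Z.add_simpl_r in H.
    rewrite (IH (n + 1)%Z), (IH (n + 1 + 1)%Z) in H by lia.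
    destruct (Ceq_dec (y n) 0) as [Hy|Hy]; [exact Hy|].
    exfalso. apply (Cmult_neq_0 _ _ (ha n) Hy). rewrite <- H. ring. }
  intros n. apply (G (Z.to_nat (N - n))). lia.
Qed.

(** Rules out the boundary case left open by [lam_surjective], as [P_plus] requires Im z > 0. The
    Wronskian with f^+ vanishes, so far to the right y is proportional to f^+, which stays away from
    0 while y tends to 0. *)
Lemma no_ell2_solution_real z y : Im z = 0 -> ell2 y ->
  (forall n, Lop a p q (lam z) y n = 0) -> forall n, y n = 0.
Proof.
  intros Hz Hy HL.
  destruct (jost_plus_away a p q eps M ha Heps HM HM' z Hz) as [c [N [Hc HN0]]].
  set (f := jost_plus a p q z) in *.
  assert (Hz' : 0 <= Im z) by lra.
  assert (HW : forall n, (y n * f (n + 1)%Z = y (n + 1)%Z * f n)%C).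
  { intros n. assert (E := wronskian_jost_right z y n Hz' Hy (fun m _ => HL m) n (Z.le_refl n)).
    unfold wronskian in E. fold f in E.
    replace (y n * f (n + 1)%Z)%C with (/ a n * (a n * (y n * f (n + 1)%Z - y (n + 1)%Z * f n))
      + y (n + 1)%Z * f n)%C by (field; apply ha).
    rewrite E. ring. }
  assert (Hf : forall n : nat, (N <= n)%nat -> f (Z.of_nat n) <> 0).
  { intros n Hn. apply Cmod_gt_0. specialize (HN0 n Hn). lra. }
  (* Proportionality in cross-multiplied form; the induction divides by f_n, which is nonzero from N
     on. *)
  assert (HP : forall k, (y (Z.of_nat (k + N)) * f (Z.of_nat N)
    = y (Z.of_nat N) * f (Z.of_nat (k + N)))%C).
  { induction k as [|k IH]; [reflexivity|].
    set (n := (k + N)%nat) in *.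
    replace (Z.of_nat (S k + N)) with (Z.of_nat n + 1)%Z by (unfold n; lia).
    assert (Hfn := Hf n ltac:(unfold n; lia)).
    transitivity ((y (Z.of_nat n + 1)%Z * f (Z.of_nat n)) * f (Z.of_nat N) / f (Z.of_nat n))%C;
      [field; exact Hfn|].
    rewrite <- HW.
    transitivity ((y (Z.of_nat n) * f (Z.of_nat N)) * f (Z.of_nat n + 1)%Z / f (Z.of_nat n))%C;
      [field; exact Hfn|].
    rewrite IH. field. exact Hfn. }
  assert (HyN : y (Z.of_nat N) = 0).
  { assert (L := is_lim_seq_scal_r _ (Cmod (f (Z.of_nat N))) _
      (proj1 (is_lim_seq_incr_n _ N _) (ell2_lim y Hy))).
    simpl in L. rewrite Rmult_0_l in L.
    assert (Hle : Cmod (y (Z.of_nat N)) * c <= 0).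
    { refine (is_lim_seq_le (fun _ => Cmod (y (Z.of_nat N)) * c) _
        (Cmod (y (Z.of_nat N)) * c) 0 _ (is_lim_seq_const _) L).
      intros k. rewrite <- Cmod_mult, HP, Cmod_mult.
      apply Rmult_le_compat_l; [apply Cmod_ge_0|]. apply HN0. lia. }
    apply Cmod_eq_0. assert (T := Cmod_ge_0 (y (Z.of_nat N))). nra. }
  apply solution_zero_of_tail with (lam z) (Z.of_nat N); [exact HL|].
  intros n Hn. replace n with (Z.of_nat ((Z.to_nat n - N) + N)) by lia.
  assert (E := HP (Z.to_nat n - N)%nat). rewrite HyN, Cmult_0_l in E.
  set (m := Z.of_nat (Z.to_nat n - N + N)) in *.
  destruct (Ceq_dec (y m) 0) as [H|H]; [exact H|].
  exfalso. exact (Cmult_neq_0 _ _ H (Hf N (Nat.le_refl N)) E).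
Qed.

Lemma eigenvalue_zero l : eigenvalue a p q l ->
  exists z, P_plus z /\ l = lam z /\ Phi a p q z = 0.
Proof.
  intros [y [Hy [[n Hn] HL]]].
  destruct (lam_surjective l) as [z [Hz [Hr <-]]].
  exists z. split; [|split; [reflexivity | now apply (Phi_zero_of_solution z y n)]].
  split; [exact Hr|]. destruct Hz as [Hz|Hz]; [exact Hz|].
  exfalso. apply Hn. now apply (no_ell2_solution_real z y (eq_sym Hz)).
Qed.

(** ** Power series of [Phi] in [exp (i z / 2)] *)

(** At n = 0 the product f^-_0 f^+_1 carries w^2 and f^-_1 f^+_0 carries w^(-2), so after
    multiplication by w^2 they carry w^4 and 1. By reflection [be0] and [be1] are alpha^-_0 and
    alpha^-_1. *)
Lemma Phi_power_series : exists g k s, 0 < s /\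
  (forall m, Cmod (g m) <= k * exp (- s) ^ m) /\ g O <> RtoC 0 /\
  forall z, 0 <= Im z -> (Phi a p q z * uw z ^ 2 = pseval g (uw z))%C.
Proof.
  assert (Eth : exp (- eps / 4) = exp (- (eps / 4))) by (f_equal; field).
  destruct (K_geom_all a p q eps M Heps HM HM' 0) as [k0 H0].
  destruct (K_geom_all a p q eps M Heps HM HM' 1) as [k1 H1].
  destruct (K_geom_all (refl_a a) (refl p) (refl q) eps M Heps HN HN' 0) as [j0 J0].
  destruct (K_geom_all (refl_a a) (refl p) (refl q) eps M Heps HN HN' (-1)) as [j1 J1].
  set (al0 := alpha_plus a 0). set (al1 := alpha_plus a 1).
  set (be0 := alpha_plus (refl_a a) 0). set (be1 := alpha_plus (refl_a a) (-1)).
  set (u0 := fun m => Kplus a p q m 0) in *. set (u1 := fun m => Kplus a p q m 1) in *.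
  set (v0 := fun m => Kplus (refl_a a) (refl p) (refl q) m 0) in *.
  set (v1 := fun m => Kplus (refl_a a) (refl p) (refl q) m (-1)) in *.
  assert (Hs : 0 < eps / 4) by lra.
  change (forall m, Cmod (u0 m) <= k0 * exp (- eps / 4) ^ m) in H0.
  change (forall m, Cmod (u1 m) <= k1 * exp (- eps / 4) ^ m) in H1.
  change (forall m, Cmod (v0 m) <= j0 * exp (- eps / 4) ^ m) in J0.
  change (forall m, Cmod (v1 m) <= j1 * exp (- eps / 4) ^ m) in J1.
  rewrite Eth in H0, H1, J0, J1.
  assert (C1 := Cconv_geom v0 u1 j0 k1 (eps / 4) Hs J0 H1).
  assert (C2 := Cconv_geom v1 u0 j1 k0 (eps / 4) Hs J1 H0).
  set (s := eps / 4 / 2) in *. assert (Hs2 : 0 < s) by (unfold s; lra).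
  set (kc := j0 * k1 * (1 + 2 / (eps / 4))) in *.
  set (kd := j1 * k0 * (1 + 2 / (eps / 4))) in *.
  assert (P : 0 < exp (- s)) by apply exp_pos.
  assert (P1 : exp (- s) < 1) by (rewrite <- exp_0; apply exp_increasing; lra).
  assert (G1 := shift_geom _ _ _ P C1). assert (G2 := shift_geom _ _ _ P G1).
  assert (G3 := shift_geom _ _ _ P G2). assert (G4 := shift_geom _ _ _ P G3).
  (* Four multiplications by w produce the factor w^4 of the first product. *)
  set (h1 := lin_mul 1 0 (Cconv v0 u1)) in *. set (h2 := lin_mul 1 0 h1) in *.
  set (h3 := lin_mul 1 0 h2) in *. set (h4 := lin_mul 1 0 h3) in *.
  set (c1 := (a 0%Z * be0 * al1)%C). set (c2 := (- (a 0%Z * be1 * al0))%C).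
  set (k4 := kc / exp (- s) / exp (- s) / exp (- s) / exp (- s)) in *.
  exists (fun m => c1 * h4 m + c2 * Cconv v1 u0 m)%C, (Cmod c1 * k4 + Cmod c2 * kd), s.
  split; [exact Hs2|]. split; [|split].
  - intros m. eapply Rle_trans; [apply Cmod_triangle|]. rewrite !Cmod_mult, Rmult_plus_distr_r.
    apply Rplus_le_compat; rewrite Rmult_assoc; apply Rmult_le_compat_l; try apply Cmod_ge_0;
      [apply G4 | apply C2].
  (* Because of w^4 only the second product reaches the constant term, where both series start with
     1. *)
  - assert (Z1 : h4 O = 0) by exact (Cmult_0_l (h3 O)).
    assert (Z2 : Cconv v1 u0 O = 1).
    { unfold Cconv. rewrite sum_O. exact (Cmult_1_l 1). }
    rewrite Z1, Z2, Cmult_0_r, Cplus_0_l, Cmult_1_r. unfold c2. intros E.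
    assert (E2 : (a 0%Z * be1 * al0 = 0)%C) by (replace (a 0%Z * be1 * al0)%C with (- - (a 0%Z * be1 * al0))%C by ring; rewrite E; ring).
    revert E2. apply Cmult_neq_0; [apply Cmult_neq_0; [apply ha|]|].
    + apply (alpha_plus_neq_0 (refl_a a) (refl p) (refl q) eps M ha' Heps HN).
    + apply (alpha_plus_neq_0 a p q eps M ha Heps HM).
  - intros z Hz. set (w := uw z).
    assert (Hw1 : Cmod w <= 1) by now apply Cmod_uw_le_1.
    assert (Hw0 := Cmod_ge_0 w).
    assert (W0 : w <> 0) by apply Cexp_neq_0.
    assert (Hws : Cmod w * exp (- s) < 1) by nra.
    assert (Hwt : Cmod w * exp (- (eps / 4)) < 1).
    { rewrite <- Eth. now apply uw_th. }
    assert (Q : 0 <= exp (- (eps / 4))) by (left; apply exp_pos).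
    assert (Su0 := pseval_summable u0 k0 _ w Q H0 Hwt).
    assert (Su1 := pseval_summable u1 k1 _ w Q H1 Hwt).
    assert (Sv0 := pseval_summable v0 j0 _ w Q J0 Hwt).
    assert (Sv1 := pseval_summable v1 j1 _ w Q J1 Hwt).
    assert (P0 := Rlt_le _ _ P).
    assert (R0 := pseval_summable _ _ _ w P0 C1 Hws).
    assert (R1 := pseval_summable _ _ _ w P0 G1 Hws).
    assert (R2 := pseval_summable _ _ _ w P0 G2 Hws).
    assert (R3 := pseval_summable _ _ _ w P0 G3 Hws).
    assert (R4 := pseval_summable _ _ _ w P0 G4 Hws).
    assert (R5 := pseval_summable _ _ _ w P0 C2 Hws).
    assert (E4 : pseval h4 w = (w ^ 4 * (pseval v0 w * pseval u1 w))%C).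
    { unfold h4. rewrite pseval_lin_mul by exact R3. unfold h3. rewrite pseval_lin_mul by exact R2.
      unfold h2. rewrite pseval_lin_mul by exact R1. unfold h1. rewrite pseval_lin_mul by exact R0.
      rewrite pseval_Cconv by assumption. ring. }
    assert (EG : pseval (fun m => c1 * h4 m + c2 * Cconv v1 u0 m)%C w
      = (c1 * pseval h4 w + c2 * (pseval v1 w * pseval u0 w))%C).
    { rewrite <- pseval_Cconv by assumption. unfold pseval.
      rewrite <- (Csum_scal c1 _ R4), <- (Csum_scal c2 _ R5).
      rewrite <- (Csum_plus _ _ (summable_scal c1 _ R4) (summable_scal c2 _ R5)).
      apply Csum_ext. intros m. ring. }
    rewrite EG, E4. unfold Phi, wronskian. change (0 + 1)%Z with 1%Z.
    rewrite (jost_minus_refl a p q z 0), (jost_minus_refl a p q z 1). change (- (0))%Z with 0%Z. change (- (1))%Z with (-1)%Z.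
    rewrite (jost_plus_eq a p q eps M Heps HM HM' z 0 Hz),
      (jost_plus_eq a p q eps M Heps HM HM' z 1 Hz),
      (jost_plus_eq _ _ _ eps M Heps HN HN' z 0 Hz),
      (jost_plus_eq _ _ _ eps M Heps HN HN' z (-1) Hz).
    assert (X0 : Cexp (Ci * 0 * z) = 1) by (rewrite <- Cexp_0; f_equal; ring).
    assert (X1 := Cexp_int_S z 0). change (0 + 1)%Z with 1%Z in X1. rewrite X0 in X1.
    assert (X2 := Cexp_int_S z (-1)). change (-1 + 1)%Z with 0%Z in X2. rewrite X0 in X2.
    rewrite X0, X1. fold w in X2 |- *.
    assert (X3 : Cexp (Ci * (-1) * z) = (/ w ^ 2)%C).
    { replace (Cexp (Ci * (-1) * z)) with ((Cexp (Ci * (-1) * z) * w ^ 2) * / w ^ 2)%C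
        by (field; exact W0).
      rewrite <- X2. ring. }
    rewrite X3. unfold Fplus. fold al0 al1 be0 be1. fold u0 u1 v0 v1.
    unfold c1, c2. field. exact W0.
Qed.

Lemma Phi_zeros_finite :
  exists N, forall l, NoDup l ->
    (forall w, In w l -> exists z, 0 <= Im z /\ uw z = w /\ Phi a p q z = 0) ->
    (length l <= N)%nat.
Proof.
  destruct Phi_power_series as [g [k [s [Hs [Hg [Hg0 HP]]]]]].
  destruct (zeros_bounded g k (exp (- s))) as [N HN0]; trivial.
  - split; [left; apply exp_pos|]. rewrite <- exp_0. apply exp_increasing. lra.
  - exists N. intros l Hl Hz. apply HN0; [exact Hl|].
    intros w Hw. destruct (Hz w Hw) as [z [Hi [<- Hp]]]. split.
    + now apply Cmod_uw_le_1.
    + rewrite <- HP, Hp by exact Hi. ring.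
Qed.

(** The zeros z repeat with period 4 PI, but lam z = w + 1/w depends on w alone, so finitely many w
    leave finitely many values. *)
Lemma Phi_zero_values_finite :
  finite_Cset (fun l => exists z, 0 <= Im z /\ l = lam z /\ Phi a p q z = 0).
Proof.
  destruct Phi_zeros_finite as [N HN0].
  destruct (finite_Cset_of_bound
    (fun w => exists z, 0 <= Im z /\ uw z = w /\ Phi a p q z = 0) N) as [l Hl].
  { intros l Hl H. now apply HN0. }
  exists (map (fun w => w + / w)%C l). intros x [z [Hz [-> Hp]]].
  apply in_map_iff. exists (uw z). split; [symmetry; apply lam_uw|].
  apply Hl. exists z. split; [exact Hz | split; [reflexivity | exact Hp]].
Qed.

(** ** Local expansion of [Phi] in [z] *)

Lemma exp_pow x n : exp x ^ n = exp (INR n * x).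
Proof.
  induction n as [|n IH].
  - simpl. now rewrite Rmult_0_l, exp_0.
  - rewrite S_INR. simpl. rewrite IH, <- exp_plus. f_equal. ring.
Qed.

(** With w = w0 exp (i t / 2), Phi (z0 + t) becomes the exponential sum with coefficients g_m
    w0^(m-2) and exponents i (m - 2) t / 2. It converges in a full disc around t = 0, also below the
    real axis. *)
Lemma Phi_taylor z0 : 0 <= Im z0 -> exists c k r d, 0 <= r /\ 0 < d /\
  (forall m, Cmod (c m) <= k * r ^ m) /\
  forall t, Cmod t < d -> 0 <= Im (z0 + t)%C -> Phi a p q (z0 + t)%C = pseval c t.
Proof.
  intros Hz0. destruct Phi_power_series as [g [k [s [Hs [Hg [_ HP]]]]]].
  set (w0 := uw z0). assert (W0 : w0 <> 0) by apply Cexp_neq_0.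
  assert (W1 : Cmod w0 <= 1) by now apply Cmod_uw_le_1.
  assert (Wp := Cmod_ge_0 w0).
  set (b := fun m => (/ w0 ^ 2 * (g m * w0 ^ m))%C).
  set (x := fun m => (Ci * ((INR m - 2) / 2)%R)%C).
  (* Then 3 tau |x_m| <= s (m + 2) / 2, which uses up half of the decay exp (-s m) and leaves exp
     (-s m / 2). *)
  set (tau := s / 3). assert (Ht : 0 < tau) by (unfold tau; lra).
  assert (Hsum : ex_series (fun m => Cmod (b m) * exp (3 * (tau * Cmod (x m))))).
  { refine (@ex_series_le R_AbsRing R_CompleteNormedModule _
      (fun m => Cmod (/ w0 ^ 2) * k * exp s * exp (- (s / 2)) ^ m) _ _).
    - intros m. change (Rabs (Cmod (b m) * exp (3 * (tau * Cmod (x m))))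
        <= Cmod (/ w0 ^ 2) * k * exp s * exp (- (s / 2)) ^ m).
      rewrite Rabs_right
        by (apply Rle_ge, Rmult_le_pos; [apply Cmod_ge_0 | left; apply exp_pos]).
      assert (Hb : Cmod (b m) <= Cmod (/ w0 ^ 2) * (k * exp (- s) ^ m)).
      { unfold b. rewrite !Cmod_mult, Cmod_pow. apply Rmult_le_compat_l; [apply Cmod_ge_0|].
        assert (0 <= Cmod w0 ^ m <= 1).
        { split; [now apply pow_le|]. rewrite <- (pow1 m). now apply pow_incr. }
        specialize (Hg m). assert (T := Cmod_ge_0 (g m)). nra. }
      assert (Hx : exp (3 * (tau * Cmod (x m))) <= exp (INR m * (s / 2) + s)).
      { apply exp_le_compat. unfold x. rewrite Cmod_mult, Cmod_Ci, Cmod_R, Rmult_1_l.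
        assert (Hm := pos_INR m).
        assert (Rabs ((INR m - 2) / 2) <= (INR m + 2) / 2) by (apply Rabs_le; lra).
        unfold tau. nra. }
      apply Rle_trans with (Cmod (/ w0 ^ 2) * (k * exp (- s) ^ m) * exp (INR m * (s / 2) + s)).
      { apply Rmult_le_compat; trivial; [apply Cmod_ge_0 | left; apply exp_pos]. }
      right. rewrite !exp_pow.
      replace (INR m * - (s / 2)) with (INR m * - s + INR m * (s / 2)) by field.
      rewrite !exp_plus. ring.
    - apply ex_series_geom_scal. split; [left; apply exp_pos|].
      rewrite <- exp_0. apply exp_increasing. lra. }
  exists (expsum_coef b x), (Series (fun m => Cmod (b m) * exp (3 * (tau * Cmod (x m))))),
    (/ tau), tau.
  split; [left; now apply Rinv_0_lt_compat|]. split; [exact Ht|]. split.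
  - now apply expsum_coef_bound.
  - intros t Htt Hi. rewrite (expsum_pseries b x tau Ht Hsum) by lra.
    set (e := Cexp (Ci * t / 2)). assert (e0 : e <> 0) by apply Cexp_neq_0.
    assert (Eu : uw (z0 + t) = (w0 * e)%C).
    { unfold w0, e, uw. rewrite <- Cexp_plus. f_equal. field. }
    assert (Ex : forall m, Cexp (x m * t) = (/ e ^ 2 * e ^ m)%C).
    { intros m. unfold e. rewrite <- !Cexp_nat, <- Cexp_opp, <- Cexp_plus. f_equal.
      unfold x. rewrite RtoC_div, RtoC_minus by lra. simpl INR. rewrite RtoC_plus. field. }
    assert (H := HP _ Hi). rewrite Eu in H.
    assert (Sg : summable (fun m => g m * (w0 * e) ^ m)%C).
    { rewrite <- Eu. apply pseval_summable with k (exp (- s)); trivial.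
      - left; apply exp_pos.
      - assert (T := Cmod_uw_le_1 _ Hi). assert (T0 := Cmod_ge_0 (uw (z0 + t))).
        assert (exp (- s) < 1) by (rewrite <- exp_0; apply exp_increasing; lra).
        assert (0 < exp (- s)) by apply exp_pos. nra. }
    rewrite (Csum_ext _ (fun m => / (w0 * e) ^ 2 * (g m * (w0 * e) ^ m))%C).
    + rewrite (Csum_scal _ _ Sg). change (Csum _) with (pseval g (w0 * e)).
      rewrite <- H. field. now split.
    + intros m. rewrite Ex. unfold b. rewrite !Cpow_mult_l. field. now split.
Qed.

Lemma Phi_zero_multiplicity z0 : 0 <= Im z0 -> exists m, zero_multiplicity (Phi a p q) z0 m.
Proof.
  intros Hz0. destruct (Phi_taylor z0 Hz0) as [c [k [r [d [Hr [Hd [Hc HP]]]]]]].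
  apply (zero_multiplicity_exists _ _ c k r d); trivial.
  apply NNPP. intros Hn.
  assert (Hc0 : forall j, c j = 0).
  { intros j. apply NNPP. intros H. apply Hn. now exists j. }
  assert (Hv : forall t, pseval c t = 0).
  { intros t. apply Cmod_eq_0, Rle_antisym; [|apply Cmod_ge_0].
    replace 0 with (0 / (1 - 0)) by field. apply Csum_geom; [lra|].
    intros j. rewrite Hc0, Cmult_0_l, Cmod_0. lra. }
  (* The points z0 + i sg j stay in the closed upper half-plane even for real z0, and their
     imaginary parts, hence |w| and w, are pairwise different. *)
  set (sg := fun j : nat => d / (INR j + 2)).
  assert (Hsg : forall j, 0 < sg j < d).
  { intros j. assert (T := pos_INR j). unfold sg. split; [apply Rdiv_lt_0_compat; lra|].
    apply Rlt_div_l; [lra|]. nra. }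
  assert (Im1 : forall j, Im (z0 + Ci * sg j)%C = Im z0 + sg j).
  { intros j. unfold Cplus, Cmult, Ci, Im, RtoC; simpl. ring. }
  destruct Phi_zeros_finite as [N HN0].
  assert (L := HN0 (map (fun j => uw (z0 + Ci * sg j)) (seq 0 (S N)))).
  rewrite length_map, length_seq in L.
  enough (S N <= N)%nat by lia. apply L.
  - apply Injective_map_NoDup; [|apply seq_NoDup].
    intros i j E. apply (f_equal Cmod) in E. rewrite !Cmod_uw in E.
    apply exp_inv in E. rewrite !Im1 in E. apply INR_eq.
    assert (Ei := pos_INR i). assert (Ej := pos_INR j).
    assert (E2 : sg i = sg j) by lra. unfold sg in E2.
    apply (f_equal (fun y => y * (INR i + 2) * (INR j + 2) / d)) in E2.
    replace (d / (INR i + 2) * (INR i + 2) * (INR j + 2) / d) with (INR j + 2) in E2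
      by (field; lra).
    replace (d / (INR j + 2) * (INR i + 2) * (INR j + 2) / d) with (INR i + 2) in E2
      by (field; lra). lra.
  - intros w Hw. apply in_map_iff in Hw. destruct Hw as [j [<- _]].
    assert (Hj := Hsg j).
    assert (Hi : 0 <= Im (z0 + Ci * sg j)%C) by (rewrite Im1; lra).
    exists (z0 + Ci * sg j)%C. repeat split; trivial.
    rewrite HP; trivial. rewrite Cmod_mult, Cmod_Ci, Cmod_R, Rabs_right; lra.
Qed.

Lemma Phi_away z0 : 0 <= Im z0 -> Phi a p q z0 <> 0 -> exists d e, 0 < d /\ 0 < e /\
  forall t, Cmod t < d -> 0 <= Im (z0 + t)%C -> e <= Cmod (Phi a p q (z0 + t)%C).
Proof.
  intros Hz0 H0. destruct (Phi_taylor z0 Hz0) as [c [k [r [d [Hr [Hd [Hc HP]]]]]]].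
  assert (E0 : Phi a p q z0 = c O).
  { rewrite <- pseval_0, <- HP; [f_equal; ring | rewrite Cmod_0; exact Hd |].
    now replace (z0 + 0)%C with z0 by ring. }
  assert (Hpos := proj1 (Cmod_gt_0 _) H0). rewrite E0 in Hpos.
  assert (Hk : 0 <= k) by (specialize (Hc O); simpl in Hc; lra).
  set (e := Cmod (c O) / 2).
  set (d1 := Rmin (1 / 2) e / (2 * k * r + r + 1)).
  assert (Q : 0 <= 2 * k * r) by (repeat apply Rmult_le_pos; lra).
  assert (Hm : 0 < Rmin (1 / 2) e) by (apply Rmin_glb_lt; unfold e; lra).
  assert (Hd1 : 0 < d1) by (unfold d1; apply Rdiv_lt_0_compat; lra).
  exists (Rmin d d1), e. split; [now apply Rmin_glb_lt|]. split; [unfold e; lra|].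
  intros t Ht Hi.
  assert (T1 := Rlt_le_trans _ _ _ Ht (Rmin_l _ _)).
  assert (T2 := Rlt_le_trans _ _ _ Ht (Rmin_r _ _)).
  assert (T0 := Cmod_ge_0 t).
  unfold d1 in T2. apply Rlt_div_r in T2; [|lra].
  assert (M1 := Rmin_l (1 / 2) e). assert (M2 := Rmin_r (1 / 2) e).
  assert (0 <= Cmod t * (2 * k * r)) by now apply Rmult_le_pos.
  assert (0 <= Cmod t * r) by now apply Rmult_le_pos.
  rewrite (HP t T1 Hi).
  assert (L := pseval_lipschitz c k r t Hr Hc ltac:(lra)).
  assert (TT := Cmod_triangle_inv (c O) (pseval c t)). rewrite Cmod_minus_sym in TT.
  unfold e in *. lra.
Qed.

Lemma Z_const_lt (f : Z -> C) k : (forall n, (n < k)%Z -> f n = f (n - 1)%Z) ->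
  forall n, (n < k)%Z -> f n = f (k - 1)%Z.
Proof.
  intros H n Hn. replace n with (k - 1 - Z.of_nat (Z.to_nat (k - 1 - n)))%Z by lia.
  generalize (Z.to_nat (k - 1 - n)) as j. clear n Hn.
  induction j as [|j IH]; [f_equal; lia|].
  rewrite <- IH. rewrite (H (k - 1 - Z.of_nat j)%Z) by lia. f_equal. lia.
Qed.

(** ** The resolvent kernel *)

(** The classical Green function: y_n Phi is f^+_n f^-_k for n >= k and f^-_n f^+_k for n < k. On
    one side of k one Wronskian of y vanishes, and the other takes its value from the jump that
    Green's identity gives at k. The symmetric bound covers both cases. *)
Lemma kernel_Phi z k y n : 0 <= Im z -> ell2 y ->
  (forall n, Lop a p q (lam z) y n = delta k n) ->
  Cmod (y n) * Cmod (Phi a p q z)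
  <= (Cmod (jost_plus a p q z n) + Cmod (jost_minus a p q z n))
     * (Cmod (jost_plus a p q z k) + Cmod (jost_minus a p q z k)).
Proof.
  intros Hz Hy HL.
  set (f := jost_plus a p q z) in *. set (g := jost_minus a p q z) in *.
  assert (D1 : delta k k = 1) by (unfold delta; now rewrite Z.eqb_refl).
  assert (D0 : forall m, m <> k -> Lop a p q (lam z) y m = 0).
  { intros m Hm. rewrite HL. unfold delta. apply Z.eqb_neq in Hm. now rewrite Hm. }
  assert (WR : forall m, (k <= m)%Z -> wronskian a y f m = 0).
  { apply wronskian_jost_right; trivial. intros m Hm. apply D0. lia. }
  assert (WL : forall m, (m < k)%Z -> wronskian a y g m = 0).
  { apply wronskian_jost_left; trivial. intros m Hm. apply D0. lia. }
  assert (SR := wronskian_step a p q (lam z) y f).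
  assert (SL := wronskian_step a p q (lam z) y g).
  assert (Lf : forall m, Lop a p q (lam z) f m = 0) by (intros m; now apply Sol).
  assert (Lg : forall m, Lop a p q (lam z) g m = 0) by (intros m; now apply jost_minus_solution).
  assert (E := wronskian_plucker a g f y n).
  unfold f, g in E. rewrite (Phi_wronskian z n Hz) in E. fold f g in E.
  rewrite (wronskian_antisym a f y) in E.
  assert (P : forall A B X Y, 0 <= A -> 0 <= B -> 0 <= X -> 0 <= Y ->
    A * X <= (B + A) * (Y + X) /\ A * Y <= (A + B) * (Y + X)) by (intros; split; nra).
  assert (F1 := Cmod_ge_0 (f n)). assert (F2 := Cmod_ge_0 (g n)).
  assert (F3 := Cmod_ge_0 (f k)). assert (F4 := Cmod_ge_0 (g k)).
  rewrite <- Cmod_mult.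
  destruct (Z.le_gt_cases k n) as [H|H].
  - assert (V : wronskian a y g n = (- g k)%C).
    { rewrite (Z_const_ge (wronskian a y g) k).
      - specialize (SL k). rewrite Lg, HL, D1, (WL (k - 1)%Z) in SL by lia.
        replace (wronskian a y g k) with (wronskian a y g k - 0)%C by ring. rewrite SL. ring.
      - intros m Hm. specialize (SL m). rewrite Lg, (D0 m) in SL by lia.
        replace (wronskian a y g m) with ((wronskian a y g m - wronskian a y g (m - 1))
          + wronskian a y g (m - 1))%C by ring. rewrite SL. ring.
      - exact H. }
    rewrite (WR n H), V in E.
    replace (y n * Phi a p q z)%C with (f n * g k)%C.
    + rewrite Cmod_mult. nra.
    + replace (y n * Phi a p q z)%C with
        ((y n * Phi a p q z + g n * - 0 + f n * - g k) + f n * g k)%C by ring.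
      rewrite E. ring.
  - assert (V : wronskian a y f n = f k).
    { rewrite (Z_const_lt (wronskian a y f) k).
      - specialize (SR k). rewrite Lf, HL, D1, (WR k (Z.le_refl k)) in SR.
        replace (wronskian a y f (k - 1)) with (- (0 - wronskian a y f (k - 1)))%C by ring.
        rewrite SR. ring.
      - intros m Hm. specialize (SR m). rewrite Lf, (D0 m) in SR by lia.
        replace (wronskian a y f m) with ((wronskian a y f m - wronskian a y f (m - 1))
          + wronskian a y f (m - 1))%C by ring. rewrite SR. ring.
      - lia. }
    rewrite (WL n ltac:(lia)), V in E.
    replace (y n * Phi a p q z)%C with (g n * f k)%C.
    + rewrite Cmod_mult. nra.
    + replace (y n * Phi a p q z)%C with
        ((y n * Phi a p q z + g n * - f k + f n * 0) + g n * f k)%C by ring.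
      rewrite E. ring.
Qed.

Lemma spectral_singularity_zero l : spectral_singularity a p q l ->
  exists z, P_zero z /\ l = lam z /\ Phi a p q z = 0.
Proof.
  intros [z0 [Hz0 [Hl [G [HG [n [k Hpole]]]]]]].
  exists z0. split; [exact Hz0|]. split; [exact Hl|].
  destruct Hz0 as [_ [Him _]].
  apply NNPP. intros H0.
  destruct (Phi_away z0 ltac:(lra) H0) as [d [e [Hd [He HPhi]]]].
  apply locally_Cmod in HG. destruct HG as [d1 [Hd1 HG]].
  destruct (jost_plus_local_bound a p q eps M Heps HM HM' n) as [B1 HB1].
  destruct (jost_plus_local_bound a p q eps M Heps HM HM' k) as [B2 HB2].
  destruct (jost_minus_local_bound n) as [B3 HB3].
  destruct (jost_minus_local_bound k) as [B4 HB4].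
  (* The radius is at most 1 to keep Im (z0 + t) in [0, 1], where the Jost values at the indices n
     and k are bounded. *)
  apply (upper_pole_unbounded (fun z => G z n k) z0 (Rmin (Rmin d d1) 1)
    ((B1 + B3) * (B2 + B4) / e)); trivial.
  - repeat apply Rmin_glb_lt; lra.
  - intros t Ht Hi.
    assert (T : Cmod t < d /\ Cmod t < d1 /\ Cmod t < 1).
    { unfold Rmin in Ht. repeat destruct Rle_dec; lra. }
    destruct T as [T1 [T2 T3]].
    assert (Hi1 : Im (z0 + t)%C <= 1).
    { assert (Q := Rle_trans _ _ _ (Rle_abs _) (im_le_Cmod t)).
      change (Im z0 + Im t <= 1). lra. }
    destruct (HG t T2 Hi) as [_ HK]. destruct (HK k) as [HK1 HK2].
    assert (Q := kernel_Phi (z0 + t) k _ n (Rlt_le _ _ Hi) HK1 HK2).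
    specialize (HPhi t T1 (Rlt_le _ _ Hi)).
    assert (Hi2 : 0 <= Im (z0 + t)%C <= 1) by lra.
    specialize (HB1 _ Hi2). specialize (HB2 _ Hi2).
    specialize (HB3 _ Hi2). specialize (HB4 _ Hi2).
    apply Rle_div_r; [exact He|].
    assert (N0 := Cmod_ge_0 (G (z0 + t)%C n k)).
    apply Rle_trans with (Cmod (G (z0 + t)%C n k) * Cmod (Phi a p q (z0 + t)));
      [now apply Rmult_le_compat_l|].
    apply Rle_trans with (1 := Q).
    apply Rmult_le_compat; try (apply Rplus_le_le_0_compat; apply Cmod_ge_0); lra.
Qed.

Lemma P_plus_or_zero_Im z : P_plus z \/ P_zero z -> 0 <= Im z.
Proof. intros [[_ H]|[_ [H _]]]; lra. Qed.

Lemma spectrum_finite :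
  finite_Cset (eigenvalue a p q) /\
  finite_Cset (spectral_singularity a p q) /\
  (forall l : C, eigenvalue a p q l \/ spectral_singularity a p q l ->
     finite_multiplicity a p q l).
Proof.
  destruct Phi_zero_values_finite as [s Hs].
  split; [|split].
  - exists s. intros l Hl. destruct (eigenvalue_zero l Hl) as [z [Hz [El Ez]]].
    apply Hs. exists z. split; [|now split]. apply P_plus_or_zero_Im. now left.
  - exists s. intros l Hl. destruct (spectral_singularity_zero l Hl) as [z [Hz [El Ez]]].
    apply Hs. exists z. split; [|now split]. apply P_plus_or_zero_Im. now right.
  - intros l Hl. split.
    + destruct Hl as [Hl|Hl].
      * destruct (eigenvalue_zero l Hl) as [z [Hz Ez]]. exists z. split; [now left | exact Ez].
      * destruct (spectral_singularity_zero l Hl) as [z [Hz Ez]].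
        exists z. split; [now right | exact Ez].
    + intros z [Hz _]. apply Phi_zero_multiplicity. now apply P_plus_or_zero_Im.
Qed.

End Phi.

Theorem theorem3 (a p q : Z -> C)
  (ha : forall n : Z, a n <> RtoC 0)
  (hdecay : exists eps : R, (0 < eps)%R /\
     exists M : R, forall n : Z,
       (exp (eps * Rabs (IZR n)) *
        (Cmod (RtoC 1 - a n)%C + Cmod (p n) + Cmod (q n)) <= M)%R) :
  finite_Cset (eigenvalue a p q) /\
  finite_Cset (spectral_singularity a p q) /\
  (forall l : C, eigenvalue a p q l \/ spectral_singularity a p q l ->
     finite_multiplicity a p q l).
Proof.
  destruct hdecay as [eps [Heps [M HM]]].
  assert (He : 1 <= exp eps) by (rewrite <- exp_0; apply exp_le_compat; lra).
  assert (HS : forall n, Cmod (1 - a n) + Cmod (p n) + Cmod (q n)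
    <= M * exp (- eps * Rabs (IZR n))).
  { intros n. specialize (HM n).
    replace (- eps * Rabs (IZR n)) with (- (eps * Rabs (IZR n))) by ring.
    rewrite exp_Ropp. apply Rle_div_r; [apply exp_pos|]. lra. }
  assert (HM0 : 0 <= M).
  { assert (T := HM 0%Z). rewrite Rabs_R0, Rmult_0_r, exp_0, Rmult_1_l in T.
    assert (T1 := Cmod_ge_0 (1 - a 0%Z)). assert (T2 := Cmod_ge_0 (p 0%Z)).
    assert (T3 := Cmod_ge_0 (q 0%Z)). lra. }
  assert (Hdec : forall n c, c <= Rabs (IZR n) ->
    Cmod (1 - a n) + Cmod (p n) + Cmod (q n) <= M * exp (- eps * c)).
  { intros n c Hc. apply Rle_trans with (1 := HS n).
    apply Rmult_le_compat_l; [exact HM0|]. apply exp_le_compat. nra. }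
  assert (Hbd : forall n, Cmod (1 - a n) + Cmod (p n) + Cmod (q n) <= M).
  { intros n. assert (H := Hdec n 0 (Rabs_pos _)). rewrite Rmult_0_r, exp_0 in H. lra. }
  assert (Hx : forall x, 0 <= M * exp x).
  { intros x. apply Rmult_le_pos; [exact HM0 | left; apply exp_pos]. }
  (* The summand exp eps pays for the index shift in [refl_a]: exp (-eps (n - 1)) = exp eps exp
     (-eps n). *)
  apply (spectrum_finite a p q eps (M * (1 + exp eps)) ha Heps).
  - intros n. assert (H := Hdec n (IZR n) (Rle_abs _)).
    assert (H1 := Hx (- eps * IZR n)). nra.
  - intros n. assert (H := Hbd n). nra.
  - intros n. unfold refl_a, refl.
    assert (H1 := Hdec (- n)%Z (IZR n)). rewrite opp_IZR, Rabs_Ropp in H1.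
    specialize (H1 (Rle_abs _)).
    assert (H2 := Hdec (- n - 1)%Z (IZR n - 1)).
    rewrite minus_IZR, opp_IZR in H2.
    assert (H3 : IZR n - 1 <= Rabs (- IZR n - 1)).
    { apply Rle_trans with (2 := Rabs_maj2 _). lra. }
    specialize (H2 H3).
    replace (- eps * (IZR n - 1)) with (- eps * IZR n + eps) in H2 by ring.
    rewrite exp_plus in H2.
    assert (T1 := Cmod_ge_0 (1 - a (- n)%Z)). assert (T2 := Cmod_ge_0 (p (- n - 1)%Z)).
    assert (T3 := Cmod_ge_0 (q (- n - 1)%Z)). lra.
  - intros n. unfold refl_a, refl.
    assert (H1 := Hbd (- n)%Z). assert (H2 := Hbd (- n - 1)%Z).
    assert (T1 := Cmod_ge_0 (1 - a (- n)%Z)). assert (T2 := Cmod_ge_0 (p (- n - 1)%Z)).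
    assert (T3 := Cmod_ge_0 (q (- n - 1)%Z)). nra.
Qed.
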